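(* For any ice quiver $\mathsf{Q}$ and any field $\mathbb{K}$, the lower bound algebra $\mathcal{L}(\mathsf{Q})$ over $\mathbb{K}$ is Cohen-Macaulay.
   Context: An ice quiver $\mathsf{Q}$ is a finite directed graph (multiple arrows allowed) without loops or directed $2$-cycles, with vertex set $\{1,\dots,n\}$, in which each vertex is designated unfrozen or frozen. For each unfrozen vertex $i$ define monomials by $p_i^+ := \prod_{\text{arrows } a,\ \mathrm{source}(a)=i} x_{\mathrm{target}(a)}$ and $p_i^- := \prod_{\text{arrows } a,\ \mathrm{target}(a)=i} x_{\mathrm{source}(a)}$ (products over arrows of $\mathsf{Q}$, with multiplicity). Set $x_i' := x_i^{-1}(p_i^++p_i^-)$ if $i$ is unfrozen and $x_i':=x_i^{-1}$ if $i$ is frozen. The lower bound algebra over $\mathbb{Z}$ is the subalgebra of $\mathbb{Z}[x_1^{\pm1},\dots,x_n^{\pm1}]$ generated by $x_1,\dots,x_n,x_1',\dots,x_n'$; the lower bound algebra over $\mathbb{K}$, denoted $\mathcal{L}(\mathsf{Q})$, is its tensor product over $\mathbb{Z}$ with $\mathbb{K}$. *)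

(* Defs.v *)
From HB Require Import structures.
From mathcomp Require Import all_boot all_order all_algebra.
From mathcomp Require Import boolp classical_sets.
From mathcomp Require Import mpoly.
From mathcomp Require Import ring.

Set Implicit Arguments.
Unset Strict Implicit.
Unset Printing Implicit Defensive.

Import GRing.Theory.
Local Open Scope ring_scope.
Local Open Scope classical_set_scope.
Local Open Scope quotient_scope.

(* The ring structures used are [comPzRingType]s, so the zero ring is allowed;
   it is Noetherian and has no maximal ideal, hence is Cohen-Macaulay. *)

Section Ideals.
Variable R : comPzRingType.
Implicit Types (I M P : set R) (s : seq R).

Definition ideal I : Prop :=
  [/\ I 0, (forall x y, I x -> I y -> I (x + y))
     & (forall a x, I x -> I (a * x))].

Definition prime_ideal P : Prop :=
  [/\ ideal P, ~ P 1 & (forall x y, P (x * y) -> P x \/ P y)].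

Definition maximal_ideal M : Prop :=
  [/\ ideal M, ~ M 1
     & (forall I, ideal I -> ~ I 1 -> M `<=` I -> I `<=` M)].

Definition ideal_span s : set R :=
  [set x | exists c : nat -> R, x = \sum_(i < size s) c i * s`_i].

Definition noetherian : Prop :=
  forall I, ideal I -> exists s, I = ideal_span s.

Definition prime_chain (d : nat) (C : nat -> set R) : Prop :=
  (forall i, (i <= d)%N -> prime_ideal (C i)) /\
  (forall i, (i < d)%N -> C i `<` C i.+1).

Definition krull_dim (d : nat) : Prop :=
  (exists C, prime_chain d C) /\
  (forall d' C, prime_chain d' C -> (d' <= d)%N).

(* The condition on [s`_i] says that it is a nonzerodivisor on
   R / (s_0, ..., s_{i-1}). *)
Definition regular_sequence s : Prop :=
  ~ ideal_span s 1 /\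
  forall i, (i < size s)%N -> forall y,
    ideal_span (take i s) (s`_i * y) -> ideal_span (take i s) y.

Definition regular_sequence_in M s : Prop :=
  regular_sequence s /\ (forall x, x \in s -> M x).

Definition depth M (d : nat) : Prop :=
  (exists s, regular_sequence_in M s /\ size s = d) /\
  (forall s, regular_sequence_in M s -> (size s <= d)%N).

Definition is_local_ring M : Prop :=
  maximal_ideal M /\ (forall M', maximal_ideal M' -> M' = M).

Definition cohen_macaulay_local : Prop :=
  noetherian /\
  exists M d, [/\ is_local_ring M, krull_dim d & depth M d].

End Ideals.

Section Localization.
Variables (R : comPzRingType) (P : set R) (hP : prime_ideal P).

Record loc_den : Type := LocDen { den : R; _ : den \in ~` P }.
HB.instance Definition _ := [isSub for den].
HB.instance Definition _ := [Choice of loc_den by <:].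

Lemma loc_denP (s : loc_den) : ~ P (den s).
Proof. by case: s => s /=; rewrite inE. Qed.

Lemma loc_den1_subproof : 1 \in ~` P.
Proof. by rewrite inE; case: hP. Qed.

Lemma loc_denM_subproof s t : ~ P s -> ~ P t -> s * t \in ~` P.
Proof. by rewrite inE => Ps Pt Pst; case: hP => _ _ /(_ _ _ Pst) []. Qed.

Definition loc_den1 : loc_den := LocDen loc_den1_subproof.
Definition loc_denM (s t : loc_den) : loc_den :=
  LocDen (loc_denM_subproof (@loc_denP s) (@loc_denP t)).

Definition loc_frac : Type := (R * loc_den)%type.
HB.instance Definition _ := Choice.on loc_frac.

Definition loc_eq (x y : loc_frac) : bool :=
  `[< exists u, ~ P u /\ u * (x.1 * den y.2) = u * (y.1 * den x.2) >].

Lemma loc_eq_equiv : equiv_class_of loc_eq.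
Proof.
split.
- by move=> x; apply/asboolP; exists 1; split=> //; case: hP.
- by move=> x y; apply/asboolP/asboolP => -[u [Pu e]]; exists u.
- move=> y x z /asboolP[u [Pu e]] /asboolP[v [Pv f]]; apply/asboolP.
  have := loc_denM_subproof (set_mem (loc_denM_subproof Pu Pv)) (@loc_denP y.2).
  move/set_mem => Q; exists (u * v * den y.2); split=> //.
  transitivity (v * den z.2 * (u * (x.1 * den y.2))); first by ring.
  rewrite e; transitivity (u * den x.2 * (v * (y.1 * den z.2))); first by ring.
  by rewrite f; ring.
Qed.

Canonical loc_eq_equivrel := EquivRelPack loc_eq_equiv.

Definition localization : Type := {eq_quot loc_eq}.
HB.instance Definition _ : EqQuotient loc_frac loc_eq localization :=
  EqQuotient.on localization.
HB.instance Definition _ := Choice.on localization.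

Definition loc_zero : localization := \pi_localization (0, loc_den1).
Definition loc_one : localization := \pi_localization (1, loc_den1).
Definition loc_add (x y : localization) : localization :=
  \pi_localization ((repr x).1 * den (repr y).2 + (repr y).1 * den (repr x).2,
       loc_denM (repr x).2 (repr y).2).
Definition loc_opp (x : localization) : localization :=
  \pi_localization (- (repr x).1, (repr x).2).
Definition loc_mul (x y : localization) : localization :=
  \pi_localization ((repr x).1 * (repr y).1, loc_denM (repr x).2 (repr y).2).

Lemma loc_eqP (x y : loc_frac) :
  reflect (exists u, ~ P u /\ u * (x.1 * den y.2) = u * (y.1 * den x.2))
          (\pi_localization x == \pi_localization y).
Proof. by rewrite eqmodE; apply: asboolP. Qed.

Lemma loc_reprP (x : loc_frac) :
  exists u, ~ P u /\ u * ((repr (\pi_localization x)).1 * den x.2)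
                   = u * (x.1 * den (repr (\pi_localization x)).2).
Proof. by apply/loc_eqP; rewrite reprK. Qed.

Lemma loc_addE (x y : loc_frac) :
  loc_add (\pi x) (\pi y) =
  \pi_localization (x.1 * den y.2 + y.1 * den x.2, loc_denM x.2 y.2).
Proof.
have [u [Pu e]] := loc_reprP x; have [v [Pv f]] := loc_reprP y.
rewrite /loc_add; move: (repr _) (repr _) e f => y' x' e f.
apply/eqP/loc_eqP; exists (u * v).
split; first exact/set_mem/loc_denM_subproof.
rewrite /=.
transitivity (v * den y'.2 * den y.2 * (u * (x'.1 * den x.2))
  + u * den x'.2 * den x.2 * (v * (y'.1 * den y.2))); first by ring.
by rewrite e f; ring.
Qed.

Lemma loc_oppE (x : loc_frac) : loc_opp (\pi x) = \pi_localization (- x.1, x.2).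
Proof.
have [u [Pu e]] := loc_reprP x.
rewrite /loc_opp; move: (repr _) e => x' e.
apply/eqP/loc_eqP; exists u; split=> //=.
by rewrite !mulNr !mulrN e.
Qed.

Lemma loc_mulE (x y : loc_frac) :
  loc_mul (\pi x) (\pi y) = \pi_localization (x.1 * y.1, loc_denM x.2 y.2).
Proof.
have [u [Pu e]] := loc_reprP x; have [v [Pv f]] := loc_reprP y.
rewrite /loc_mul; move: (repr _) (repr _) e f => y' x' e f.
apply/eqP/loc_eqP; exists (u * v).
split; first exact/set_mem/loc_denM_subproof.
rewrite /=.
transitivity ((u * (x'.1 * den x.2)) * (v * (y'.1 * den y.2))); first by ring.
by rewrite e f; ring.
Qed.

Lemma loc_pi_eq (x y : loc_frac) :
  x.1 * den y.2 = y.1 * den x.2 -> \pi_localization x = \pi_localization y.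
Proof.
move=> e; apply/eqP/loc_eqP; exists 1; rewrite e; split=> //.
by case: hP.
Qed.

Lemma loc_addA : associative loc_add.
Proof.
elim/quotW=> x; elim/quotW=> y; elim/quotW=> z.
by rewrite !loc_addE; apply: loc_pi_eq => /=; ring.
Qed.

Lemma loc_addC : commutative loc_add.
Proof.
elim/quotW=> x; elim/quotW=> y.
by rewrite !loc_addE; apply: loc_pi_eq => /=; ring.
Qed.

Lemma loc_add0 : left_id loc_zero loc_add.
Proof.
by elim/quotW=> x; rewrite !loc_addE; apply: loc_pi_eq => /=; ring.
Qed.

Lemma loc_addN : left_inverse loc_zero loc_opp loc_add.
Proof.
elim/quotW=> x; rewrite loc_oppE loc_addE.
by apply: loc_pi_eq => /=; ring.
Qed.

HB.instance Definition _ :=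
  GRing.isZmodule.Build localization loc_addA loc_addC loc_add0 loc_addN.

Lemma loc_mulA : associative loc_mul.
Proof.
elim/quotW=> x; elim/quotW=> y; elim/quotW=> z.
by rewrite !loc_mulE; apply: loc_pi_eq => /=; ring.
Qed.

Lemma loc_mulC : commutative loc_mul.
Proof.
elim/quotW=> x; elim/quotW=> y.
by rewrite !loc_mulE; apply: loc_pi_eq => /=; ring.
Qed.

Lemma loc_mul1 : left_id loc_one loc_mul.
Proof.
by elim/quotW=> x; rewrite !loc_mulE; apply: loc_pi_eq => /=; ring.
Qed.

Lemma loc_mulDl : left_distributive loc_mul loc_add.
Proof.
elim/quotW=> x; elim/quotW=> y; elim/quotW=> z.
by rewrite !(loc_addE, loc_mulE); apply: loc_pi_eq => /=; ring.
Qed.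

HB.instance Definition _ := GRing.Zmodule_isComPzRing.Build localization
  loc_mulA loc_mulC loc_mul1 loc_mulDl.

End Localization.

Definition cohen_macaulay (R : comPzRingType) : Prop :=
  noetherian R /\
  forall (P : set R) (hP : prime_ideal P),
    maximal_ideal P -> cohen_macaulay_local (localization hP).

(* The tensor product over the integers of two commutative rings.  The pair
   list [:: (a_1, b_1); ...; (a_k, b_k)] stands for the sum of the a_i (x) b_i;
   two such sums are identified when no biadditive map separates them.
   [tensor_lift] below is the universal property. *)
Section Tensor.
Variables A B : comPzRingType.

Definition biadditive (V : zmodType) (f : A -> B -> V) : Prop :=
  (forall b, zmod_morphism (f^~ b)) /\ (forall a, zmod_morphism (f a)).

Definition formal_sum : Type := seq (A * B).
HB.instance Definition _ := Choice.on formal_sum.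
Implicit Types s t : formal_sum.

Definition formal_eval (V : zmodType) (f : A -> B -> V) s : V :=
  \sum_(x <- s) f x.1 x.2.

Definition tensor_eq s t : bool :=
  `[< forall (V : zmodType) (f : A -> B -> V),
        biadditive f -> formal_eval f s = formal_eval f t >].

Lemma tensor_eq_equiv : equiv_class_of tensor_eq.
Proof.
split=> [s|s t|t s u]; first exact/asboolP.
- by apply/asboolP/asboolP => e V f hf; rewrite e.
- move=> /asboolP e /asboolP e'; apply/asboolP => V f hf.
  by rewrite e // e'.
Qed.

Canonical tensor_eq_equivrel := EquivRelPack tensor_eq_equiv.

Definition tensor : Type := {eq_quot tensor_eq}.
HB.instance Definition _ : EqQuotient formal_sum tensor_eq tensor :=
  EqQuotient.on tensor.
HB.instance Definition _ := Choice.on tensor.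

Definition formal_opp s : formal_sum := [seq (- x.1, x.2) | x <- s].
Definition formal_mul s t : formal_sum :=
  [seq (x.1 * y.1, x.2 * y.2) | x <- s, y <- t].

Definition tensor_zero : tensor := \pi_tensor ([::] : formal_sum).
Definition tensor_one : tensor := \pi_tensor ([:: (1, 1)] : formal_sum).
Definition tensor_add (x y : tensor) : tensor :=
  \pi_tensor (repr x ++ repr y : formal_sum).
Definition tensor_opp (x : tensor) : tensor := \pi_tensor (formal_opp (repr x)).
Definition tensor_mul (x y : tensor) : tensor :=
  \pi_tensor (formal_mul (repr x) (repr y)).

Lemma tensor_eqP s t :
  \pi_tensor s = \pi_tensor t <->
  (forall (V : zmodType) (f : A -> B -> V),
     biadditive f -> formal_eval f s = formal_eval f t).
Proof.
split; first by move/eqP; rewrite eqmodE => /asboolP.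
by move=> h; apply/eqP; rewrite eqmodE; apply/asboolP.
Qed.

Lemma formal_reprE s (V : zmodType) (f : A -> B -> V) :
  biadditive f -> formal_eval f (repr (\pi_tensor s)) = formal_eval f s.
Proof. by move: V f; apply/tensor_eqP; rewrite reprK. Qed.

Lemma formal_eval_cat (V : zmodType) (f : A -> B -> V) s t :
  formal_eval f (s ++ t) = formal_eval f s + formal_eval f t.
Proof. by rewrite /formal_eval big_cat. Qed.

Lemma formal_eval_opp (V : zmodType) (f : A -> B -> V) s :
  biadditive f -> formal_eval f (formal_opp s) = - formal_eval f s.
Proof.
move=> [fl _]; rewrite /formal_eval big_map -sumrN.
apply: eq_bigr => -[a b] _ /=.
have f0 : f 0 b = 0 by have := fl b 0 0; rewrite !subrr.
by rewrite -[- a]sub0r fl f0 sub0r.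
Qed.

Lemma formal_eval_mul (V : zmodType) (f : A -> B -> V) s t :
  formal_eval f (formal_mul s t) =
  formal_eval (fun a b => formal_eval (fun a' b' => f (a * a') (b * b')) t) s.
Proof. by rewrite /formal_eval big_allpairs_dep. Qed.

Lemma formal_eval_mulC (V : zmodType) (f : A -> B -> V) s t :
  formal_eval f (formal_mul s t) = formal_eval f (formal_mul t s).
Proof.
rewrite !formal_eval_mul /formal_eval exchange_big.
by do 2![apply: eq_bigr => ? _]; rewrite mulrC [X in f _ X]mulrC.
Qed.

Lemma biadditive_mul (V : zmodType) (f : A -> B -> V) t : biadditive f ->
  biadditive (fun a b => formal_eval (fun a' b' => f (a * a') (b * b')) t).
Proof.
by move=> [fl fr]; split=> [b a a'|a b b'];
  rewrite /formal_eval -sumrB; apply: eq_bigr => x _;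
  rewrite mulrBl ?fl ?fr.
Qed.

Lemma tensor_addE s t :
  tensor_add (\pi s) (\pi t) = \pi_tensor (s ++ t : formal_sum).
Proof.
by apply/tensor_eqP => V f hf; rewrite !formal_eval_cat !formal_reprE.
Qed.

Lemma tensor_oppE s : tensor_opp (\pi s) = \pi_tensor (formal_opp s).
Proof.
by apply/tensor_eqP => V f hf; rewrite !formal_eval_opp ?formal_reprE.
Qed.

Lemma tensor_mulE s t : tensor_mul (\pi s) (\pi t) = \pi_tensor (formal_mul s t).
Proof.
apply/tensor_eqP => V f hf; rewrite formal_eval_mul formal_reprE; last first.
  exact: biadditive_mul.
rewrite -formal_eval_mul formal_eval_mulC formal_eval_mul formal_reprE.
  by rewrite -formal_eval_mul formal_eval_mulC.
exact: biadditive_mul.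
Qed.

Lemma tensor_addA : associative tensor_add.
Proof.
elim/quotW=> x; elim/quotW=> y; elim/quotW=> z.
by rewrite !tensor_addE catA.
Qed.

Lemma tensor_addC : commutative tensor_add.
Proof.
elim/quotW=> x; elim/quotW=> y; rewrite !tensor_addE.
by apply/tensor_eqP => V f hf; rewrite !formal_eval_cat addrC.
Qed.

Lemma tensor_add0 : left_id tensor_zero tensor_add.
Proof. by elim/quotW=> x; rewrite tensor_addE. Qed.

Lemma tensor_addN : left_inverse tensor_zero tensor_opp tensor_add.
Proof.
elim/quotW=> x; rewrite tensor_oppE tensor_addE.
apply/tensor_eqP => V f hf; rewrite formal_eval_cat formal_eval_opp // addNr.
by rewrite /formal_eval big_nil.
Qed.

HB.instance Definition _ := GRing.isZmodule.Build tensor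
  tensor_addA tensor_addC tensor_add0 tensor_addN.

Lemma tensor_mulA : associative tensor_mul.
Proof.
elim/quotW=> x; elim/quotW=> y; elim/quotW=> z; rewrite !tensor_mulE.
apply/tensor_eqP => V f hf; rewrite !formal_eval_mul.
apply: eq_bigr => a _; rewrite formal_eval_mul.
by do 2![apply: eq_bigr => ? _]; rewrite !mulrA.
Qed.

Lemma tensor_mulC : commutative tensor_mul.
Proof.
elim/quotW=> x; elim/quotW=> y; rewrite !tensor_mulE.
by apply/tensor_eqP => V f hf; rewrite formal_eval_mulC.
Qed.

Lemma tensor_mul1 : left_id tensor_one tensor_mul.
Proof.
elim/quotW=> x; rewrite tensor_mulE; apply/tensor_eqP => V f hf.
rewrite formal_eval_mul /formal_eval big_seq1 /=.
by apply: eq_bigr => y _; rewrite !mul1r.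
Qed.

Lemma tensor_mulDl : left_distributive tensor_mul tensor_add.
Proof.
elim/quotW=> x; elim/quotW=> y; elim/quotW=> z.
rewrite !(tensor_addE, tensor_mulE); apply/tensor_eqP => V f hf.
by rewrite !(formal_eval_mul, formal_eval_cat).
Qed.

HB.instance Definition _ := GRing.Zmodule_isComPzRing.Build tensor
  tensor_mulA tensor_mulC tensor_mul1 tensor_mulDl.

Definition pure_tensor (a : A) (b : B) : tensor :=
  \pi_tensor ([:: (a, b)] : formal_sum).

Lemma pi_formal_sum s : \pi_tensor s = \sum_(x <- s) pure_tensor x.1 x.2.
Proof.
elim: s => [|[a b] s IHs]; first by rewrite big_nil.
by rewrite big_cons -IHs; exact/esym/tensor_addE.
Qed.

Lemma pure_tensor_biadditive : biadditive pure_tensor.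
Proof.
have E (V : zmodType) (f : A -> B -> V) a b :
  formal_eval f [:: (a, b)] = f a b by rewrite /formal_eval big_seq1.
have H (s t u : formal_sum) : (forall (V : zmodType) (f : A -> B -> V),
    biadditive f -> formal_eval f s = formal_eval f t - formal_eval f u) ->
    \pi_tensor s = \pi_tensor t - \pi_tensor u.
  move=> h; have -> : \pi_tensor t - \pi_tensor u = \pi_tensor (t ++ formal_opp u).
    by rewrite -tensor_addE -tensor_oppE.
  apply/tensor_eqP => V f hf.
  by rewrite h // formal_eval_cat formal_eval_opp.
by split=> [b a a'|a b b']; apply: H => V f [fl fr]; rewrite !E ?fl ?fr.
Qed.

Lemma pure_tensorM a a' b b' :
  pure_tensor a b * pure_tensor a' b' = pure_tensor (a * a') (b * b').
Proof. exact: tensor_mulE. Qed.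

Lemma pure_tensor1 : pure_tensor 1 1 = 1.
Proof. by []. Qed.

Lemma tensor_lift (V : zmodType) (f : A -> B -> V) : biadditive f ->
  exists! g : tensor -> V,
    zmod_morphism g /\ forall a b, g (pure_tensor a b) = f a b.
Proof.
move=> hf; exists (fun x => formal_eval f (repr x)); split; [split|].
- elim/quotW=> x; elim/quotW=> y.
  have -> : \pi_tensor x - \pi_tensor y = \pi_tensor (x ++ formal_opp y).
    by rewrite -tensor_addE -tensor_oppE.
  by rewrite !formal_reprE // formal_eval_cat formal_eval_opp.
- by move=> a b; rewrite formal_reprE // /formal_eval big_seq1.
move=> g [gB gE]; apply/funext; elim/quotW=> s; rewrite formal_reprE //.
have g0 : g 0 = 0 by have := gB 0 0; rewrite !subrr.
have gD x y : g (x + y) = g x + g y.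
  by rewrite -{1}[y]opprK gB -[- y]sub0r gB g0 sub0r opprK.
rewrite pi_formal_sum (big_morph g gD g0).
by apply: eq_bigr => x _; rewrite gE.
Qed.

End Tensor.

Section SubringSpan.
Variables (F : comPzRingType) (S : set F).

Definition subring_span : {pred F} :=
  [pred x | `[< forall D : {pred F}, subring_closed D ->
                  (forall y, S y -> y \in D) -> x \in D >]].

Lemma subring_span_closed : subring_closed subring_span.
Proof.
split=> [|x y /asboolP hx /asboolP hy|x y /asboolP hx /asboolP hy];
  apply/asboolP => D hD hS; case: (hD) => D1 DB DM //.
- by apply: DB; [exact: hx | exact: hy].
- by apply: DM; [exact: hx | exact: hy].
Qed.

HB.instance Definition _ :=
  GRing.isSubringClosed.Build F subring_span subring_span_closed.

Record subring_of : Type :=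
  SubringOf { subring_val :> F; _ : subring_val \in subring_span }.

HB.instance Definition _ := [isSub for subring_val].
HB.instance Definition _ := [Choice of subring_of by <:].
HB.instance Definition _ := GRing.SubChoice_isSubComPzRing.Build F subring_span
  subring_of subring_span_closed.

Lemma mem_subring_span x : S x -> x \in subring_span.
Proof. by move=> Sx; apply/asboolP => D _; apply. Qed.

End SubringSpan.

Record ice_quiver (n : nat) : Type := IceQuiver {
  arrow : finType;
  source : arrow -> 'I_n;
  target : arrow -> 'I_n;
  unfrozen : {set 'I_n};
  no_loop : forall a, source a <> target a;
  no_2cycle : forall a b, ~ (source a = target b /\ target a = source b)
}.

Section LowerBound.
Variable n : nat.

(* Laurent polynomials are computed in the field of fractions of Z[x_1..x_n];
   the Laurent polynomial ring is its subring [laurent]. *)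
Definition ratfun : fieldType := {fraction {mpoly int[n]}}.

Definition var (i : 'I_n) : ratfun := tofrac 'X_i.

Definition laurent : {pred ratfun} :=
  subring_span [set y | exists i, y = var i \/ y = (var i)^-1].

Variable Q : ice_quiver n.

Definition p_plus (i : 'I_n) : ratfun :=
  \prod_(a : arrow Q | source a == i) var (target a).

Definition p_minus (i : 'I_n) : ratfun :=
  \prod_(a : arrow Q | target a == i) var (source a).

Definition adjacent_var (i : 'I_n) : ratfun :=
  if i \in unfrozen Q then (var i)^-1 * (p_plus i + p_minus i)
  else (var i)^-1.

Definition lower_bound_gens : set ratfun :=
  [set y | exists i, y = var i \/ y = adjacent_var i].

Definition lower_bound_int : comPzRingType := subring_of lower_bound_gens.

Lemma lower_bound_gens_laurent y : lower_bound_gens y -> y \in laurent.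
Proof.
have hX i : var i \in laurent by apply: mem_subring_span; exists i; left.
have hV i : (var i)^-1 \in laurent by apply: mem_subring_span; exists i; right.
case=> i [->|->] //; rewrite /adjacent_var; case: ifP => // _.
by rewrite rpredM // rpredD // rpred_prod.
Qed.

Lemma lower_bound_laurent (y : lower_bound_int) : subring_val y \in laurent.
Proof.
case: y => y /= /asboolP; apply; first exact: subring_span_closed.
exact: lower_bound_gens_laurent.
Qed.

End LowerBound.

Definition lower_bound_algebra (n : nat) (Q : ice_quiver n) (K : fieldType) :
  comPzRingType := tensor (lower_bound_int Q) K.

(* Main.v *)
Require Import Defs.
From HB Require Import structures.
From mathcomp Require Import all_boot all_order all_algebra fingroup perm.
From mathcomp Require Import boolp classical_sets.
From mathcomp Require Import mpoly.
From mathcomp Require Import ring zify.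

Set Implicit Arguments.
Unset Strict Implicit.
Unset Printing Implicit Defensive.

Import Order.TTheory GRing.Theory Num.Theory.
Local Open Scope ring_scope.
Local Open Scope classical_set_scope.

(** Write y_i for the adjacent variable x_i' and p_i for x_i * y_i, which is the
    exchange binomial at an unfrozen vertex and 1 at a frozen one.  The algebra
    turns out to be a finite free module over a polynomial ring in n variables,
    and this forces it to be Cohen-Macaulay.

    _Standard monomials_.  Call a nonempty set of unfrozen vertices stuck when
    each of its vertices has an arrow into the set and an arrow from the set;
    a set of vertices that contains no stuck set is acyclic.  A monomial in the
    x_i and the y_i is standard when no x_i * y_i divides it and the y_i that
    divide it are indexed by an acyclic set.  The standard monomials form a
    basis of the integral lower bound algebra.

    They span it: let x_i have weight 1 and y_i a weight larger than the
    number of arrows.  Then x_i * y_i = p_i rewrites the left hand side into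
    terms of smaller weight.  On a stuck set T the same relations say that
    (x_i), i in T, is a kernel vector of a square matrix with the y_i on the
    diagonal and polynomials in the x_j elsewhere, so that the determinant of
    this matrix vanishes, which rewrites the product of the y_i, i in T, into
    terms of smaller weight ([stuck_reduces], [pfil_sfil]).

    They are independent ([mono_free]): evaluate a linear relation at
    x_i = q ^ u_i for a large integer q.  For a generic choice of weights only
    one standard monomial of the relation has maximal weight.  Let S be the set
    of i such that y_i divides it.  If u solves the tropical equations
    u_i = max (p_i^+ (u), p_i^- (u)) - weight of y_i for i in S, with u_i the
    weight of x_i elsewhere (and 0 for the maximum at a frozen vertex), then
    that monomial grows like q to its weight
    and all others grow more slowly.  There is a solution because S is
    acyclic ([trop_solution]).

    A basis over the integers gives a basis after tensoring with a field
    ([tensor_straightening]).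

    _From the basis to the Cohen-Macaulay property_.  There are O(r ^ n) standard
    monomials of weight at most r, so n + 1 elements always satisfy a polynomial
    relation.  By the elementary dimension theory of Coquand and Lombardi, such
    relations bound by n the length of chains of primes and of regular sequences
    in every localization; conversely a regular sequence of length n yields a
    chain of n + 1 primes ([cohen_macaulay_crit]).  It remains to find a regular
    sequence of length n in a maximal ideal M.  With D the weight of y_i, put
    theta_i = x_i ^ D + y_i.  By Zariski's lemma M contains q_i (theta_i) for
    some monic polynomial q_i.  Up to terms that are lower in a refined order,
    multiplication by q_i (theta_i) maps a standard monomial to a standard
    monomial: it raises the power of y_i if y_i divides the monomial, and the
    power of x_i otherwise.  Hence the algebra is free over the polynomial
    ring in the elements q_i (theta_i), which therefore form a regular sequence
    ([params_regular]). *)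

(** * Krull monoids, chains of primes and regular sequences *)

Section KrullMonoid.
Variable R : comPzRingType.
Implicit Types (s : seq R) (I P : set R).

(** The elements a_1^m_1 * (a_2^m_2 * (... (u + a_k * c_k) ...) + a_1 * c_1)
    with u a unit.  A ring has Krull dimension less than k exactly when the
    Krull monoid of each sequence of length k contains 0.  Units instead of 1
    make the monoid itself insensitive to multiplying the a_i by units. *)
Fixpoint krull_monoid s : set R :=
  if s is a :: s' then
    [set z | exists m c t, krull_monoid s' t /\ z = a ^+ m * (t + a * c)]
  else [set u | exists v, u * v = 1].

Lemma krull_monoid_unit s u v : u * v = 1 -> krull_monoid s u.
Proof.
elim: s => [|a s IHs] uv1 /=; first by exists v.
by exists 0%N, 0, u; rewrite expr0 mul1r mulr0 addr0; split=> //; apply: IHs.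
Qed.

Lemma krull_monoid1 s : krull_monoid s 1.
Proof. by apply: (@krull_monoid_unit _ _ 1); rewrite mulr1. Qed.

Lemma krull_monoidM s x y :
  krull_monoid s x -> krull_monoid s y -> krull_monoid s (x * y).
Proof.
elim: s x y => [|a s IHs] x y /=.
  by move=> [u xu] [v yv]; exists (u * v); rewrite mulrACA xu yv mulr1.
move=> [m [c [t [st ->]]]] [m' [c' [t' [st' ->]]]].
exists (m + m')%N, (t * c' + c * t' + a * c * c'), (t * t').
by split; [exact: IHs | rewrite exprD; ring].
Qed.

Lemma krull_monoid_head a s : krull_monoid (a :: s) a.
Proof.
exists 1%N, 0, 1; rewrite mulr0 addr0 mulr1; split=> //.
exact: krull_monoid1.
Qed.

(** Passing from a ring to a localization, elements have to be replaced by
    multiples by units to clear denominators. *)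
Lemma krull_monoid_assoc s s' z :
  size s = size s' ->
  (forall i, (i < size s)%N ->
     exists u v, u * v = 1 /\ s`_i = u * s'`_i) ->
  krull_monoid s z -> krull_monoid s' z.
Proof.
elim: s s' z => [|a s IHs] [|a' s'] z //= [] sz h.
have [u [v [uv1 /= ->]]] := h 0%N isT.
move=> [m [c [t [st ->]]]].
exists m, (u ^+ m.+1 * c), (u ^+ m * t); split; last first.
  by rewrite exprMn exprS; ring.
apply: krull_monoidM.
  by apply: (@krull_monoid_unit _ _ (v ^+ m)); rewrite -exprMn uv1 expr1n.
by apply: IHs st => // i ltis; apply: (h i.+1).
Qed.

Lemma ideal_spanP s : ideal (ideal_span s).
Proof.
split=> [|x y [c ->] [d ->]|a x [c ->]].
- by exists (fun=> 0); rewrite big1 // => i _; rewrite mul0r.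
- by exists (fun i => c i + d i); rewrite -big_split; apply: eq_bigr => i _;
    rewrite mulrDl.
- by exists (fun i => a * c i); rewrite mulr_sumr; apply: eq_bigr => i _;
    rewrite mulrA.
Qed.

Lemma mem_ideal_span s i : (i < size s)%N -> ideal_span s s`_i.
Proof.
move=> ltis; exists (fun j => (j == i)%:R).
rewrite (bigD1 (Ordinal ltis)) //= eqxx mul1r big1 ?addr0 // => j.
by rewrite -val_eqE /= => /negPf ->; rewrite mul0r.
Qed.

Lemma ideal_sum I (J : Type) (r : seq J) (p : pred J) (F : J -> R) :
  ideal I -> (forall j, p j -> I (F j)) -> I (\sum_(j <- r | p j) F j).
Proof. by case=> I0 ID _ IF; elim/big_ind: _ => // *; apply: ID. Qed.

Lemma ideal_span_min s I :
  ideal I -> (forall i, (i < size s)%N -> I s`_i) -> ideal_span s `<=` I.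
Proof.
move=> idI sI _ [c ->]; apply: ideal_sum => // i _.
by case: idI => _ _; apply; apply: sI.
Qed.

Lemma ideal_span_take s i j : (i <= j)%N ->
  ideal_span (take i s) `<=` ideal_span (take j s).
Proof.
move=> leij; apply: ideal_span_min; first exact: ideal_spanP.
move=> k; rewrite size_take_min leq_min => /andP[ltki ltks].
rewrite nth_take // -(@nth_take j) ?(leq_trans ltki) //.
by apply: mem_ideal_span; rewrite size_take_min leq_min (leq_trans ltki).
Qed.

Lemma idealB I x y : ideal I -> I x -> I y -> I (x - y).
Proof. by case=> _ ID IM Ix Iy; apply: ID => //; rewrite -mulN1r;
  apply: IM. Qed.

(** If 0 = a_1^m * (t + a_1 * c) with a_1 regular, then t is in the ideal
    spanned by a_1; as a_2 is regular modulo a_1 the next factor can be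
    cancelled, and so on until a unit lands in the ideal of the sequence. *)
Lemma regular_krull_monoid s : regular_sequence s -> ~ krull_monoid s 0.
Proof.
move=> [s1 reg] km0; apply: s1.
suff h k z : (k <= size s)%N -> krull_monoid (drop k s) z ->
    ideal_span (take k s) z -> ideal_span s 1.
  by apply: (h 0%N 0) => //; rewrite ?drop0 //; case: (ideal_spanP (take 0 s)).
elim: {k}(size s - k)%N {-2}k (leqnn (size s - k)) z => [|l IHl] k.
  rewrite leqn0 subn_eq0 => ges z les.
  have -> : k = size s by apply/eqP; rewrite eqn_leq ges les.
  rewrite drop_size take_size => -[v zv1] spz.
  by rewrite -zv1 mulrC; case: (ideal_spanP s) => _ _; apply.
move=> lel z les; have [ges|ltks] := leqP (size s) k.
  have -> : k = size s by apply/eqP; rewrite eqn_leq ges les.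
  rewrite drop_size take_size => -[v zv1] spz.
  by rewrite -zv1 mulrC; case: (ideal_spanP s) => _ _; apply.
rewrite (drop_nth 0) //= => -[m [c [t [st ->]]]] sp.
apply: (IHl k.+1 _ t) => //; first lia.
have {}sp : ideal_span (take k s) (t + s`_k * c).
  elim: m sp => [|m IHm]; first by rewrite expr0 mul1r.
  by rewrite exprS -mulrA => /(reg _ ltks)/IHm.
have -> : t = (t + s`_k * c) - c * s`_k by ring.
apply: idealB; first exact: ideal_spanP.
  exact: (ideal_span_take (leqnSn k)) sp.
case: (ideal_spanP (take k.+1 s)) => _ _; apply.
have := @mem_ideal_span (take k.+1 s) k.
by rewrite nth_take // size_take_min leq_min ltnSn ltks; apply.
Qed.

(** The same cancellation along a chain of primes: a factor a_i^m_i is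
    outside the i-th prime and a_i * c_i is inside the next one. *)
Lemma prime_chain_krull_monoid s C : prime_chain (size s) C ->
  (forall i, (i < size s)%N -> C i.+1 s`_i /\ ~ C i s`_i) ->
  forall z, C 0%N z -> ~ krull_monoid s z.
Proof.
move=> [prC sub] hs z Cz km;
  elim: s z C prC sub hs Cz km => [|a s IHs] z C prC sub hs Cz.
  move=> [v zv1]; case: (prC 0%N) => // -[_ _ CM] C1 _.
  by apply: C1; rewrite -zv1 mulrC; apply: CM.
move=> [m [c [t [st e]]]]; have [C1a C0a] := hs 0%N isT.
apply: (IHs t (C \o succn)) => // [i lei|i lti|i lti|].
- exact: prC.
- exact: sub.
- exact: (hs i.+1).
have [_ _ C0M] := prC 0%N isT.
have {e Cz}Cz : C 0%N (a ^+ m * (t + a * c)) by rewrite -e.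
have {Cz}Cz : C 0%N (t + a * c).
  elim: m Cz => [|m IHm]; first by rewrite expr0 mul1r.
  by rewrite exprS -mulrA => /C0M [].
have C1z : C 1%N (t + a * c) by apply: (sub 0%N isT).1.
rewrite (_ : t = t + a * c - c * a); last by ring.
have [idC1 _ _] := prC 1%N isT.
by apply: idealB => //; case: idC1 => _ _; apply.
Qed.

Definition mult_closed (S : set R) : Prop :=
  S 1 /\ forall x y, S x -> S y -> S (x * y).

Lemma krull_monoid_mult s : mult_closed (krull_monoid s).
Proof. by split; [exact: krull_monoid1 | exact: krull_monoidM]. Qed.

Lemma ideal_add_principal I a :
  ideal I -> ideal [set x | exists2 y, I y & exists c, x = y + a * c].
Proof.
move=> [I0 ID IM]; split=> [|x y [u Iu [c ->]] [v Iv [d ->]]|b x [u Iu [c ->]]].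
- by exists 0 => //; exists 0; rewrite mulr0 addr0.
- by exists (u + v); [exact: ID | exists (c + d); ring].
- by exists (b * u); [exact: IM | exists (b * c); ring].
Qed.

(** An ideal that is maximal among those disjoint from a multiplicative set is
    prime. *)
Lemma exists_prime_disjoint (S : set R) I : mult_closed S -> ideal I ->
  (forall x, I x -> ~ S x) ->
  exists P, [/\ prime_ideal P, I `<=` P & forall x, P x -> ~ S x].
Proof.
move=> [S1 SM] idI IS.
pose good : set (set R) := [set J | J = set0 \/
  [/\ ideal J, I `<=` J & forall x, J x -> ~ S x]].
have [|P [gP maxP]] := @Zorn_bigcup R good.
  (* the empty set is added to the family so that the empty chain has a bound *)
  move=> F Fgood Ftot; have [F0|/existsNP [J0]] :=
      pselect (forall J, F J -> J = set0).
    by left; apply/seteqP; split=> // x [J /F0 -> []].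
  move=> /not_implyP [FJ0 nJ0].
  have [//|[idJ0 IJ0 J0S]] := Fgood _ FJ0; right; split.
  - split=> [|x y [J FJ Jx] [J' FJ' J'y]|a x [J FJ Jx]].
    + by exists J0 => //; case: idJ0.
    + have [sJ|sJ] := Ftot _ _ FJ FJ'.
        exists J' => //; have [E|[[_ ID _] _ _]] := Fgood _ FJ'.
          by move: J'y; rewrite E.
        by apply: ID => //; apply: sJ.
      exists J => //; have [E|[[_ ID _] _ _]] := Fgood _ FJ.
        by move: Jx; rewrite E.
      by apply: ID => //; apply: sJ.
    + exists J => //; have [E|[[_ _ IM] _ _]] := Fgood _ FJ.
        by move: Jx; rewrite E.
      exact: IM.
  - by move=> x Ix; exists J0 => //; apply: IJ0.
  - move=> x [J FJ Jx]; have [E|[_ _]] := Fgood _ FJ; last exact.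
    by move: Jx; rewrite E.
have [P0|[idP IP PS]] := gP.
  case: (maxP I); last by right; split.
  rewrite P0; split; first exact: sub0set.
  by move=> h; have /h : I 0 by case: idI.
exists P; split=> //; split=> // [P1|x y Pxy]; first exact: (PS 1).
apply: contrapT => /not_orP[nPx nPy].
have meet z : ~ P z -> exists2 y', P y' & exists c, S (y' + z * c).
  move=> nPz; pose J := [set x | exists2 y, P y & exists c, x = y + z * c].
  apply: contrapT => no; apply: (maxP J).
    split; first by move=> u Pu; exists u => //; exists 0; rewrite mulr0 addr0.
    move=> JP; apply: nPz; apply: JP.
    by exists 0; [case: idP | exists 1; rewrite add0r mulr1].
  right; split; first exact: ideal_add_principal.
    by move=> u /IP Pu; exists u => //; exists 0; rewrite mulr0 addr0.
  by move=> u [v Pv [c ->]] Su; apply: no; exists v => //; exists c.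
have [u Pu [c Sc]] := meet _ nPx; have [v Pv [d Sd]] := meet _ nPy.
apply: (PS _ _ (SM _ _ Sc Sd)); case: (idP) => _ PD PM.
have -> : (u + x * c) * (v + y * d) =
  (v + y * d) * u + ((x * c) * v + (c * d) * (x * y)) by ring.
by apply: (PD); [exact: PM | apply: (PD); exact: PM].
Qed.

(** If P is disjoint from the Krull monoid of a :: s then P + (a) is disjoint
    from that of s, since p + a * c = t makes p = t - a * c an element of
    the former.  So the primes of the chain can be found one by one. *)
Lemma exists_prime_chain s I : ideal I ->
    (forall x, I x -> ~ krull_monoid s x) ->
  exists2 C, prime_chain (size s) C & I `<=` C 0%N.
Proof.
elim: s I => [|a s IHs] I idI dis.
  have [P [prP IP _]] := exists_prime_disjoint (krull_monoid_mult [::]) idI dis.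
  by exists (fun=> P).
have [P [prP IP PS]] :=
  exists_prime_disjoint (krull_monoid_mult (a :: s)) idI dis.
have idP : ideal P by case: prP.
have [|C [prC sC] PC] := IHs _ (ideal_add_principal a idP).
  move=> x [y Py [c ->]] st; apply: (PS y Py).
  by exists 0%N, (- c), (y + a * c); split=> //; ring.
exists (fun i => if i is j.+1 then C j else P) => //; split=> -[|i] //=.
- exact: prC.
- move=> _; split=> [x Px|CP].
    by apply: PC; exists x => //; exists 0; rewrite mulr0 addr0.
  apply: (PS a); last exact: krull_monoid_head.
  apply: CP; apply: PC; exists 0; first by case: idP.
  by exists 1; rewrite add0r mulr1.
- exact: sC.
Qed.

(** Membership of 0 in all Krull monoids of length n + 1 bounds both the
    dimension and the depth by n; a regular sequence of length n bounds both
    from below, as its Krull monoid omits 0. *)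
Lemma cohen_macaulay_local_crit (M : set R) n : noetherian R ->
  ideal M -> ~ M 1 -> (forall x, ~ M x -> exists y, x * y = 1) ->
  (forall s, size s = n.+1 -> krull_monoid s 0) ->
  (exists2 s, regular_sequence_in M s & size s = n) ->
  cohen_macaulay_local R.
Proof.
move=> nR idM M1 Munit km [s [regs sM] szs]; split=> //.
have IM I : ideal I -> ~ I 1 -> I `<=` M.
  move=> [_ _ II] I1 x Ix; apply: contrapT => /Munit [y xy1].
  by apply: I1; rewrite -xy1 mulrC; apply: II.
exists M, n; split.
- split; first by split=> // I idI I1 _; apply: IM.
  move=> M' [idM' M'1 maxM']; apply/seteqP; split; first exact: IM.
  by apply: maxM' => //; apply: IM.
- split.
    have [|C prC _] := @exists_prime_chain s (ideal_span [::]) (ideal_spanP _).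
      by move=> x [c ->]; rewrite big_ord0; apply: regular_krull_monoid.
    by exists C; rewrite -szs.
  move=> d C [prC sC]; rewrite leqNgt; apply/negP => ltnd.
  have pick i : exists a, (i <= n)%N -> C i.+1 a /\ ~ C i a.
    have [lein|] := leqP i n; last by exists 0.
    have [_ /existsNP[a /not_implyP h]] := sC i (leq_ltn_trans lein ltnd).
    by exists a.
  have [f hf] := choice pick.
  apply: (@prime_chain_krull_monoid (mkseq f n.+1) C _ _ 0).
  - by rewrite size_mkseq; split=> i lti; [apply: prC | apply: sC]; lia.
  - by rewrite size_mkseq => i lti; rewrite nth_mkseq //; apply: hf.
  - by case: (prC 0%N isT) => -[].
  - by apply: km; rewrite size_mkseq.
- split; first by exists s.
  move=> t [regt tM]; rewrite leqNgt; apply/negP => ltnt.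
  apply: (@regular_krull_monoid (take n.+1 t)); last first.
    by apply: km; rewrite size_takel.
  case: regt => t1 regt; split.
    by move=> /(ideal_span_take ltnt); rewrite take_size.
  rewrite size_takel // => i lti y; rewrite nth_take // take_takel; last lia.
  by apply: regt; lia.
Qed.

End KrullMonoid.

(** * Localization at a prime ideal *)

Section LocalizationMap.
Variables (R : comPzRingType) (P : set R) (hP : prime_ideal P).
Local Notation B := (localization hP).

Definition loc_map (a : R) : B := (\pi_(localization hP) (a, loc_den1 hP))%qT.

Lemma loc_map_is_zmod_morphism : zmod_morphism loc_map.
Proof.
move=> a b; rewrite /loc_map.
have -> : forall x y : B, x - y = loc_add x (loc_opp y) by [].
rewrite loc_oppE loc_addE; apply: loc_pi_eq => /=; ring.
Qed.

Lemma loc_map_is_monoid_morphism : monoid_morphism loc_map.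
Proof.
split=> // a b; have -> : forall x y : B, x * y = loc_mul x y by [].
by rewrite /loc_map loc_mulE; apply: loc_pi_eq => /=; ring.
Qed.

HB.instance Definition _ :=
  GRing.isZmodMorphism.Build R B loc_map loc_map_is_zmod_morphism.
HB.instance Definition _ :=
  GRing.isMonoidMorphism.Build R B loc_map loc_map_is_monoid_morphism.

Lemma loc_map_unit t : ~ P t -> exists v, loc_map t * v = 1.
Proof.
move=> nPt; have tP : t \in ~` P by rewrite inE.
exists (\pi_(localization hP) (1, LocDen tP))%qT.
have -> : forall x y : B, x * y = loc_mul x y by [].
by rewrite /loc_map loc_mulE; apply: loc_pi_eq => /=; ring.
Qed.

Lemma loc_mapP (z : B) : exists a t, ~ P t /\ z * loc_map t = loc_map a.
Proof.
elim/quotW: z => -[a t]; exists a, (den t); split; first exact: loc_denP.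
have -> : forall x y : B, x * y = loc_mul x y by [].
by rewrite /loc_map loc_mulE; apply: loc_pi_eq => /=; ring.
Qed.

Lemma loc_map_eq0 a : loc_map a = 0 -> exists2 u, ~ P u & u * a = 0.
Proof.
move=> /eqP; rewrite /loc_map.
have -> : (0 : B) = (\pi_(localization hP) (0, loc_den1 hP))%qT by [].
move=> /loc_eqP [u [Pu /=]]; rewrite !mulr1 mulr0 => e.
by exists u.
Qed.

Lemma loc_mem_span s z : ideal_span (map loc_map s) z ->
  exists a t, [/\ ~ P t, z * loc_map t = loc_map a & ideal_span s a].
Proof.
have [idP P1 Ppr] := hP.
move=> spz; pose I : set B := [set z | exists a t,
  [/\ ~ P t, z * loc_map t = loc_map a & ideal_span s a]].
suff /(_ z spz) : ideal_span (map loc_map s) `<=` I by [].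
have [I0 ID IM] := ideal_spanP s.
apply: ideal_span_min.
- split.
  + by exists 0, 1; rewrite rmorph0 mul0r.
  + move=> x y [a [t [Pt ex Ia]]] [b [u [Pu ey Ib]]].
    exists (u * a + t * b), (t * u); split.
    * by move/Ppr => [].
    * by rewrite rmorphD !rmorphM /= -ex -ey; ring.
    * by apply: (ID); apply: IM.
  + move=> x y [b [u [Pu ey Ib]]]; have [a [t [Pt ex]]] := loc_mapP x.
    exists (a * b), (t * u); split.
    * by move/Ppr => [].
    * by rewrite !rmorphM /= -ex -ey; ring.
    * exact: IM.
- move=> i; rewrite size_map => ltis; exists s`_i, 1; split=> //.
    by rewrite rmorph1 mulr1 (nth_map 0).
  exact: mem_ideal_span.
Qed.

Lemma loc_span_clear s a : ideal_span (map loc_map s) (loc_map a) ->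
  exists2 u, ~ P u & ideal_span s (u * a).
Proof.
move=> /loc_mem_span [b [t [Pt]]]; rewrite -rmorphM => e Ib.
have [u Pu eu] : exists2 u, ~ P u & u * (a * t - b) = 0.
  by apply: loc_map_eq0; rewrite rmorphB e subrr.
exists (u * t); first by have [_ _ Ppr] := hP; move/Ppr => [].
have -> : u * t * a = u * (a * t - b) + u * b by ring.
by rewrite eu add0r; case: (ideal_spanP s) => _ _; apply.
Qed.

Lemma loc_map_span s a : ideal_span s a ->
    ideal_span (map loc_map s) (loc_map a).
Proof.
move=> [c ->]; exists (fun i => loc_map (c i)).
rewrite size_map rmorph_sum; apply: eq_bigr => i _.
by rewrite rmorphM (nth_map 0).
Qed.

Lemma loc_regular s : regular_sequence_in P s ->
  regular_sequence (map loc_map s).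
Proof.
have [idP P1 Ppr] := hP; move=> [[_ reg] sP]; split.
  rewrite -(rmorph1 loc_map) => /loc_span_clear [u Pu]; rewrite mulr1 => su.
  by apply: Pu; apply: ideal_span_min su => // i ltis; apply/sP/mem_nth.
move=> i; rewrite size_map => ltis y; rewrite (nth_map 0) // -map_take.
have [a [t [Pt ey]]] := loc_mapP y; have [v tv] := loc_map_unit Pt.
set J := ideal_span _; have [_ _ JM] : ideal J := ideal_spanP _.
move=> /(JM (loc_map t)); rewrite mulrCA [_ * y]mulrC ey -rmorphM.
move=> /loc_span_clear [u Pu]; rewrite mulrCA => /(reg _ ltis)/loc_map_span.
rewrite rmorphM /= -ey => Jy; have [w uw] := loc_map_unit Pu.
have -> : y = (w * v) * (loc_map u * (y * loc_map t)).
  transitivity ((loc_map u * w) * (loc_map t * v) * y); last by ring.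
  by rewrite uw tv !mul1r.
exact: JM.
Qed.

Lemma loc_noetherian : noetherian R -> noetherian B.
Proof.
move=> nR I [I0 ID IM].
have [|s es] := nR [set a | I (loc_map a)].
  split=> [|x y|a x] /=; first by rewrite rmorph0.
    by rewrite rmorphD; apply: ID.
  by rewrite rmorphM; apply: IM.
exists (map loc_map s); apply/seteqP; split.
  move=> z Iz; have [a [t [Pt ez]]] := loc_mapP z.
  have [v tv] := loc_map_unit Pt.
  have : ideal_span s a by rewrite -es /= -ez mulrC; apply: IM.
  move=> /loc_map_span; rewrite -ez => h.
  have -> : z = v * (z * loc_map t) by rewrite mulrCA mulrC [v * _]mulrC tv
    mul1r.
  by case: (ideal_spanP (map loc_map s)) => _ _; apply.
apply: ideal_span_min; first by split.
move=> i; rewrite size_map => ltis; rewrite (nth_map 0) //.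
have : ideal_span s s`_i by apply: mem_ideal_span.
by rewrite -es.
Qed.

Lemma rmorph_krull_monoid s z : krull_monoid s z ->
  krull_monoid (map loc_map s) (loc_map z).
Proof.
elim: s z => [|a s IHs] z /=.
  by move=> [v zv]; exists (loc_map v); rewrite -rmorphM zv rmorph1.
move=> [m [c [t [/IHs st ->]]]]; exists m, (loc_map c), (loc_map t).
by split=> //; rewrite rmorphM rmorphXn rmorphD rmorphM.
Qed.

Lemma loc_krull_monoid n : (forall s : seq R, size s = n -> krull_monoid s 0) ->
  forall s : seq B, size s = n -> krull_monoid s 0.
Proof.
move=> km s szs.
have /choice[f hf] (z : B) : exists a, exists u v,
  u * v = 1 /\ loc_map a = u * z.
  have [a [t [Pt ez]]] := loc_mapP z; have [v tv] := loc_map_unit Pt.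
  by exists a, (loc_map t), v; split=> //; rewrite -ez mulrC.
apply: (@krull_monoid_assoc _ (map loc_map (map f s))).
- by rewrite !size_map.
- move=> i; rewrite !size_map => ltis; rewrite -map_comp (nth_map 0) //=.
- rewrite -(rmorph0 loc_map); apply: rmorph_krull_monoid; apply: km.
  by rewrite size_map.
Qed.

End LocalizationMap.

Theorem cohen_macaulay_crit (R : comPzRingType) n : noetherian R ->
  (forall s : seq R, size s = n.+1 -> krull_monoid s 0) ->
  (forall M : set R, maximal_ideal M ->
     exists2 s, regular_sequence_in M s & size s = n) ->
  cohen_macaulay R.
Proof.
move=> nR km regM; split=> // M hM maxM; have [idM M1 Mpr] := hM.
have [M0 MD MM] := idM.
pose N : set (localization hM) := [set z | exists a t,
  [/\ ~ M t, z * loc_map hM t = loc_map hM a & M a]].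
apply: (@cohen_macaulay_local_crit _ N n).
- exact: loc_noetherian.
- split.
  + by exists 0, 1; rewrite rmorph0 mul0r.
  + move=> x y [a [t [Pt ex Ia]]] [b [u [Pu ey Ib]]].
    exists (u * a + t * b), (t * u); split.
    * by move/Mpr => [].
    * by rewrite rmorphD !rmorphM /= -ex -ey; ring.
    * by apply: (MD); apply: MM.
  + move=> x y [b [u [Pu ey Ib]]]; have [a [t [Pt ex]]] := loc_mapP x.
    exists (a * b), (t * u); split.
    * by move/Mpr => [].
    * by rewrite !rmorphM /= -ex -ey; ring.
    * exact: MM.
- move=> [a [t [Mt]]]; rewrite mul1r => e Ma.
  have [u Mu] : exists2 u, ~ M u & u * (t - a) = 0.
    by apply: (@loc_map_eq0 _ _ hM); rewrite rmorphB /= e subrr.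
  rewrite mulrBr => /eqP; rewrite subr_eq0 => /eqP eu.
  have : M (u * t) by rewrite eu; apply: MM.
  by case/Mpr.
- move=> z nNz; have [a [t [Mt ez]]] := loc_mapP z.
  have Ma : ~ M a by move=> Ma; apply: nNz; exists a, t.
  have [v av] := loc_map_unit hM Ma; exists (loc_map hM t * v).
  by rewrite mulrA ez.
- exact: loc_krull_monoid.
- have [s regs szs] := regM M maxM; exists (map (loc_map hM) s).
    split; first exact: loc_regular.
    move=> _ /mapP[x xs ->]; exists x, 1; rewrite rmorph1 mulr1; split=> //.
    by case: regs => _; apply.
  by rewrite size_map.
Qed.

(** * Hilbert's basis theorem *)

Section IdealSpanMem.
Variable R : comPzRingType.
Implicit Types (s t : seq R) (I : set R).

Lemma in_ideal_span s x : x \in s -> ideal_span s x.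
Proof. by move=> /(nthP 0)[i ltis <-]; apply: mem_ideal_span. Qed.

Lemma ideal_span_sub s I : ideal I -> (forall x, x \in s -> I x) ->
  ideal_span s `<=` I.
Proof. by move=> idI sI; apply: ideal_span_min => // i /(mem_nth 0)/sI. Qed.

End IdealSpanMem.

Lemma noetherian_image (R S : comPzRingType) (f : {rmorphism R -> S}) :
  (forall y, exists x, f x = y) -> noetherian R -> noetherian S.
Proof.
move=> fsurj nR I idI; have [I0 ID IM] := idI.
have [|s es] := nR [set a | I (f a)].
  split=> [|x y|a x] /=; first by rewrite rmorph0.
    by rewrite rmorphD; apply: ID.
  by rewrite rmorphM; apply: IM.
exists (map f s); apply/seteqP; split.
  move=> y; have [x <-] := fsurj y => Ifx.
  have : ideal_span s x by rewrite -es.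
  move=> [c ->]; rewrite rmorph_sum; apply: ideal_sum => [|i _].
    exact: ideal_spanP.
  rewrite rmorphM; have [_ _] := ideal_spanP (map f s); apply.
  by apply/in_ideal_span/map_f/mem_nth.
apply: ideal_span_sub => // _ /mapP[x xs ->].
have : ideal_span s x by apply: in_ideal_span.
by rewrite -es.
Qed.

Section HilbertBasis.
Variable R : comNzRingType.
Implicit Types I J : set {poly R}.

Definition lead_ideal I k : set R :=
  [set a | exists p, [/\ I p, (size p <= k.+1)%N & p`_k = a]].

Lemma lead_idealP I k : ideal I -> ideal (lead_ideal I k).
Proof.
move=> [I0 ID IM]; split=>
  [|x y [p [Ip szp <-]] [q [Iq szq <-]]|a x [p [Ip szp <-]]].
- by exists 0; rewrite size_poly0 coef0.
- exists (p + q); rewrite coefD; split=> //; first exact: ID.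
  by apply: leq_trans (size_polyD _ _) _; rewrite geq_max szp.
- exists (a%:P * p); rewrite coefCM; split=> //; first exact: IM.
  by rewrite mul_polyC; apply: leq_trans (size_scale_leq _ _) _.
Qed.

Lemma lead_idealS I k l : ideal I -> (k <= l)%N ->
  lead_ideal I k `<=` lead_ideal I l.
Proof.
move=> [I0 ID IM] lekl a [p [Ip szp <-]].
exists ('X^(l - k) * p); rewrite coefXnM ltnNge leq_subr /= subKn //.
split=> //; first exact: IM.
apply: leq_trans (size_polyMleq _ _) _; rewrite size_polyXn addSn /=.
by apply: leq_trans (leq_add (leqnn _) szp) _; lia.
Qed.

Lemma lead_ideal_sub I J k : I `<=` J -> lead_ideal I k `<=` lead_ideal J k.
Proof. by move=> IJ a [p [/IJ Jp szp e]]; exists p. Qed.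

(** Leading terms can be cancelled one after the other, so that an ideal is
    determined inside a larger one by its leading coefficients in each
    degree. *)
Lemma sub_lead_ideals I J : ideal I -> ideal J -> J `<=` I ->
  (forall k, lead_ideal I k `<=` lead_ideal J k) -> I `<=` J.
Proof.
move=> idI idJ JI LIJ p; move: {2}(size p) (leqnn (size p)) => k.
elim: k p => [|k IHk] p szp Ip.
  by move: szp; rewrite leqn0 size_poly_eq0 => /eqP ->; case: idJ.
have /LIJ[q [Jq szq eq]] : lead_ideal I k p`_k by exists p.
rewrite -[p](subrK q); case: (idJ) => _ JD _; apply: (JD) => //; apply: IHk.
  apply/leq_sizeP => j; rewrite leq_eqVlt coefB => /predU1P[<-|ltkj].
    by rewrite eq subrr.
  by rewrite !nth_default ?subrr // ?(leq_trans szp) ?(leq_trans szq).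
by apply: idealB => //; apply: JI.
Qed.

(** The ideals of leading coefficients grow with the degree and stabilize at
    some N, so that finitely many of them, each finitely generated, have to be
    taken care of. *)
Lemma noetherian_poly : noetherian R -> noetherian {poly R}.
Proof.
move=> nR I idI; have [I0 ID IM] := idI.
(* finitely many elements of I suffice for the leading coefficients in degree k *)
have one k : exists s, (forall p, p \in s -> I p) /\
    lead_ideal I k `<=` lead_ideal (ideal_span s) k.
  have [s es] := nR _ (lead_idealP k idI).
  have /choice[f hf] (a : R) : exists p, a \in s ->
      [/\ I p, (size p <= k.+1)%N & p`_k = a].
    have [sa|_] := boolP (a \in s); last by exists 0.
    have : lead_ideal I k a by rewrite es; apply: in_ideal_span.
    by case=> p hp; exists p.
  exists (map f s); split=> [p /mapP[a /hf[Ip _ _] ->] //|].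
  rewrite es; apply: ideal_span_sub; first exact/lead_idealP/ideal_spanP.
  move=> a sa; exists (f a); case: (hf a sa) => Ifa szf fk; split=> //.
  exact/in_ideal_span/map_f.
(* and hence for the leading coefficients in all degrees up to N *)
have upto N : exists s, (forall p, p \in s -> I p) /\
    forall k, (k <= N)%N -> lead_ideal I k `<=` lead_ideal (ideal_span s) k.
  elim: N => [|N [s [sI hs]]].
    by have [s [sI hs]] := one 0%N; exists s; split=> // k;
      rewrite leqn0 => /eqP ->.
  have [t [tI ht]] := one N.+1; exists (s ++ t); split=> [p|k].
    by rewrite mem_cat => /orP[/sI|/tI].
  rewrite leq_eqVlt => /predU1P[->|]; [move=> a /ht|move=> /hs h a /h];
    apply: lead_ideal_sub; apply: ideal_span_sub (ideal_spanP _) _ => p ps;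
    by apply: in_ideal_span; rewrite mem_cat ps ?orbT.
have [s es] : exists s : seq R,
  [set a | exists k, lead_ideal I k a] = ideal_span s.
  apply: nR; split=> [|x y [k Ix] [l Iy]|a x [k Ix]].
  - by exists 0%N; case: (lead_idealP 0 idI).
  - exists (maxn k l); case: (lead_idealP (maxn k l) idI) => _ LD _.
    by apply: LD; [apply: lead_idealS Ix | apply: lead_idealS Iy];
      rewrite // (leq_maxl, leq_maxr).
  - by exists k; case: (lead_idealP k idI) => _ _; apply.
have [N hN] : exists N, forall a, a \in s -> lead_ideal I N a.
  have : forall a, a \in s -> exists k, lead_ideal I k a.
    by move=> a sa; have := in_ideal_span sa; rewrite -es.
  elim: {es}s => [|a s IHs] hs; first by exists 0%N.
  have [|N hN] := IHs; first by move=> b sb; apply: hs; rewrite inE sb orbT.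
  have [|k hk] := hs a; first by rewrite inE eqxx.
  exists (maxn k N) => b; rewrite inE => /predU1P[->|/hN].
    by apply: lead_idealS hk => //; apply: leq_maxl.
  by apply: lead_idealS => //; apply: leq_maxr.
have [t [tI ht]] := upto N; exists t; apply/seteqP; split; last first.
  exact: ideal_span_sub.
apply: sub_lead_ideals => //; [exact: ideal_spanP|exact: ideal_span_sub|].
move=> k; have [lekN|/ltnW leNk] := leqP k N; first exact: ht.
move=> a Ia; apply: (lead_idealS (ideal_spanP _) leNk); apply: ht => //.
have : ideal_span s a by rewrite -es; exists k.
by apply: ideal_span_sub => //; apply: lead_idealP.
Qed.

End HilbertBasis.

Lemma noetherian_field (K : fieldType) : noetherian K.
Proof.
move=> I [I0 ID IM]; have [nI|] := pselect (exists2 x, I x & x != 0).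
  exists [:: 1]; apply/seteqP; split=> x _.
    by exists (fun=> x); rewrite big_ord1 mulr1.
  have [y Iy y0] := nI; rewrite -[x](divfK y0); exact: IM.
move=> nI; exists [::]; apply/seteqP; split=> x; last first.
  by move=> [c ->]; rewrite big_ord0.
move=> Ix; exists (fun=> 0); rewrite big_ord0.
by apply/eqP/negPn/negP => x0; apply: nI; exists x.
Qed.

Lemma mpoly_closed_ind (R : nzRingType) n (D : {mpoly R[n]} -> Prop) :
  (forall c, D c%:MP) -> (forall i, D 'X_i) ->
  (forall p q, D p -> D q -> D (p + q)) ->
  (forall p q, D p -> D q -> D (p * q)) -> forall p, D p.
Proof.
move=> DC DX DD DM p; elim/mpolyind: p => [|c m p _ _ Dp].
  by have := DC 0; rewrite mpolyC0.
apply: DD => //; rewrite -mul_mpolyC; apply: (DM) => //.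
have D1 : D 1 by have := DC 1; rewrite mpolyC1.
rewrite mpolyXE_id; apply: big_ind => [//|p1 q Dp1 Dq|i _]; first exact: DM.
by elim: (m i) => [|k IHk]; rewrite ?expr0 // exprS; apply: DM.
Qed.

Lemma noetherian_mpoly (K : fieldType) n : noetherian {mpoly K[n]}.
Proof.
elim: n => [|n IHn].
  apply: (@noetherian_image _ _ (@mpolyC 0 K)); last exact: noetherian_field.
  elim/mpoly_closed_ind => [c|[]//|p q [a <-] [b <-]|p q [a <-] [b <-]].
  - by exists c.
  - by exists (a + b); rewrite rmorphD.
  - by exists (a * b); rewrite rmorphM.
pose f : {rmorphism {poly {mpoly K[n]}} -> {mpoly K[n.+1]}} :=
  (horner_eval ('X_ord_max) \o map_poly (@mwiden n K)).
apply: (@noetherian_image _ _ f); last exact: noetherian_poly.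
elim/mpoly_closed_ind => [c|i|p q [a <-] [b <-]|p q [a <-] [b <-]].
- by exists (c%:MP)%:P; rewrite /f /= map_polyC /= /horner_eval hornerC mwidenC.
- have [j ->|->] := unliftP ord_max i.
    exists ('X_j)%:P; rewrite /f /= map_polyC /= /horner_eval hornerC.
    rewrite mwidenX mnmwiden1; congr ('X_[U_(_)]).
    by apply: val_inj; rewrite /= /bump leqNgt ltn_ord.
  by exists 'X; rewrite /f /= map_polyX /horner_eval hornerX.
- by exists (a + b); rewrite rmorphD.
- by exists (a * b); rewrite rmorphM.
Qed.

Lemma digits_inj n B (a b : 'I_n -> nat) :
  (forall i, (a i < B)%N) -> (forall i, (b i < B)%N) ->
  (\sum_i a i * B ^ i = \sum_i b i * B ^ i)%N -> a =1 b.
Proof.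
elim: n a b => [|n IHn] a b ltaB ltbB; first by move=> _ [].
rewrite !big_ord_recl /= !expn0 !muln1.
have shift (c : 'I_n.+1 -> nat) :
    (\sum_(i < n) c (lift ord0 i) * B ^ bump 0 i =
     B * \sum_(i < n) c (lift ord0 i) * B ^ i)%N.
  by rewrite big_distrr; apply: eq_bigr => i _; rewrite /bump /= expnS mulnCA.
rewrite !shift => e.
have e0 : a ord0 = b ord0.
  have := congr1 (modn^~ B) e;
    rewrite /= ![(_ + B * _)%N]addnC ![(B * _)%N]mulnC.
  by rewrite !modnMDl !modn_small.
have B_gt0 : (0 < B)%N by apply: leq_ltn_trans (ltaB ord0).
have {}e : (\sum_(i < n) a (lift ord0 i) * B ^ i =
            \sum_(i < n) b (lift ord0 i) * B ^ i)%N.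
  by move/eqP: e; rewrite e0 eqn_add2l eqn_pmul2l // => /eqP.
move=> i; have [j ->|->//] := unliftP ord0 i.
exact: (IHn (fun i => a (lift ord0 i)) (fun i => b (lift ord0 i))).
Qed.

Lemma seq_argmax (T : eqType) (w : T -> nat) (s : seq T) : s != [::] ->
  exists2 x, x \in s & forall y, y \in s -> (w y <= w x)%N.
Proof.
elim: s => // a s IHs _; have [->|/IHs[x sx hx]] := eqVneq s [::].
  by exists a => [|y]; rewrite inE ?eqxx // => /eqP ->.
have [lexa|/ltnW leax] := leqP (w x) (w a).
  exists a => [|y]; rewrite inE ?eqxx // => /predU1P[->//|/hx h].
  exact: leq_trans lexa.
exists x => [|y]; rewrite inE ?sx ?orbT // => /predU1P[->//|]; exact: hx.
Qed.

Lemma mpoly_eqmorph (R : nzRingType) n (S : pzRingType)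
    (f g : {rmorphism {mpoly R[n]} -> S}) :
  (forall c, f c%:MP = g c%:MP) -> (forall i, f 'X_i = g 'X_i) -> f =1 g.
Proof.
move=> hC hX; elim/mpoly_closed_ind => [||p q ep eq|p q ep eq] //.
  by rewrite !rmorphD ep eq.
by rewrite !rmorphM ep eq.
Qed.

(** * Noether normalization and Zariski's lemma *)

Section Nagata.
Variables (K : fieldType) (r N : nat).

(** Nagata's change of variables: X_0 is mapped to T and X_i to X_i + T^(N^i).
    A monomial of exponents less than N becomes monic in T, of a degree whose
    base N digits are the exponents. *)
Definition nagata_var (i : 'I_r.+1) : {poly {mpoly K[r]}} :=
  if unlift ord0 i is Some j then 'X^(N ^ i) + ('X_j)%:P else 'X.

Definition nagata : {rmorphism {mpoly K[r.+1]} -> {poly {mpoly K[r]}}} :=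
  mmap (polyC \o @mpolyC r K) nagata_var.

Definition nagata_wt (m : 'X_{1..r.+1}) : nat := (\sum_i m i * N ^ i)%N.

Lemma nagataX_monic m : (0 < N)%N ->
  nagata 'X_[m] \is monic /\ size (nagata 'X_[m]) = (nagata_wt m).+1.
Proof.
move=> N_gt0; rewrite /nagata /= mmapX /mmap1 /nagata_wt.
have hvar i : nagata_var i \is monic /\ size (nagata_var i) = (N ^ i).+1.
  rewrite /nagata_var; case: unliftP => [j ->|->]; last first.
    by rewrite monicX size_polyX expn0.
  have sz : (size ('X_j : {mpoly K[r]})%:P < size
    ('X^(N ^ lift ord0 j) : {poly {mpoly K[r]}}))%N.
    rewrite size_polyXn (leq_ltn_trans (size_polyC_leq1 _)) // ltnS.
    by rewrite expn_gt0 N_gt0.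
  rewrite size_polyDl // size_polyXn; split=> //.
  by rewrite monicE lead_coefDl // lead_coefXn.
elim: (index_enum _) => [|i s [IHm IHs]].
  by rewrite !big_nil monic1 size_poly1.
have [vm vs] := hvar i.
rewrite !big_cons; split; first by rewrite monicMr // monic_exp.
have ve0 : nagata_var i ^+ m i != 0 by rewrite monic_neq0 // monic_exp.
rewrite size_Mmonic // IHs.
have -> : size (nagata_var i ^+ m i) = (m i * N ^ i).+1.
  by rewrite -(prednK (_ : 0 < size _)%N) ?size_poly_gt0 // size_exp vs mulnC.
by rewrite addSn addnS.
Qed.

(** Distinct monomials of Q have distinct degrees in T, so only one of them
    contributes to the leading coefficient. *)
Lemma nagata_lead_coef (Q : {mpoly K[r.+1]}) : Q != 0 ->
  (forall m, m \in msupp Q -> forall i, m i < N)%N ->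
  exists2 c : K, c != 0 & lead_coef (nagata Q) = c%:MP.
Proof.
move=> Q0 ltN; have [|m mQ maxm] := @seq_argmax _ nagata_wt (msupp Q).
  by rewrite msupp_eq0.
have N_gt0 : (0 < N)%N by apply: leq_ltn_trans (ltN m mQ ord0).
have eQ : nagata Q = \sum_(m <- msupp Q) (Q@_m)%:MP *: nagata 'X_[m].
  rewrite {1}[Q]mpolyE rmorph_sum; apply: eq_bigr => m' _.
  by rewrite -mul_mpolyC rmorphM /= mmapC /= mul_polyC.
have wt_inj m' : m' \in msupp Q -> nagata_wt m' = nagata_wt m -> m' = m.
  move=> m'Q e; apply/mnmP => i.
  by apply: (digits_inj (ltN m' m'Q) (ltN m mQ)).
have coefm : (nagata Q)`_(nagata_wt m) = (Q@_m)%:MP.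
  rewrite eQ coef_sum (bigD1_seq m) ?msupp_uniq //= big1_seq ?addr0.
    rewrite coefZ; have [/monicP mon sz] := nagataX_monic m N_gt0.
    by rewrite /lead_coef sz /= in mon; rewrite mon mulr1.
  move=> m' /andP[nm' m'Q]; rewrite nth_default //.
  apply: leq_trans (size_scale_leq _ _) _.
  have [_ ->] := nagataX_monic m' N_gt0; rewrite ltn_neqAle maxm // andbT.
  by apply: contraNneq nm' => /(wt_inj _ m'Q) ->.
exists Q@_m; first by rewrite -mcoeff_msupp.
rewrite /lead_coef; suff -> : size (nagata Q) = (nagata_wt m).+1 by [].
apply/eqP; rewrite eqn_leq; apply/andP; split; last first.
  rewrite ltnNge; apply: contraL mQ => /(nth_default 0).
  by rewrite coefm => /eqP; rewrite mpolyC_eq0 mcoeff_eq0.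
rewrite eQ big_seq; apply: (leq_trans (size_sum _ _ _)).
apply/bigmax_leqP_seq => m' m'Q _; apply: leq_trans (size_scale_leq _ _) _.
by have [_ ->] := nagataX_monic m' N_gt0; rewrite ltnS maxm.
Qed.

End Nagata.

Lemma integral_mpoly (K : fieldType) n (R F : comNzRingType)
    (g : {rmorphism R -> F}) (f : {rmorphism {mpoly K[n]} -> F}) :
  (forall c, integralOver g (f c%:MP)) -> (forall i, integralOver g (f 'X_i)) ->
  forall p, integralOver g (f p).
Proof.
move=> hC hX; elim/mpoly_closed_ind => // p q ip iq.
  by rewrite rmorphD; apply: integral_add.
by rewrite rmorphM; apply: integral_mul.
Qed.

Lemma integral_trans (R S F : comNzRingType) (g : {rmorphism R -> F})
    (f : {rmorphism S -> F}) :
  (forall p, integralOver g (f p)) -> forall u, integralOver f u ->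
    integralOver g u.
Proof.
move=> gf u [p mon_p rootpu];
  apply: (@integral_root_monic _ _ g u (map_poly f p)) => //.
  exact: monic_map.
move=> _ /(nthP 0)[i _ <-]; rewrite coef_map; exact: gf.
Qed.

(** Multiplying an integral equation of v of degree m + 1 by q^m expresses v
    as a polynomial in q. *)
Lemma integral_inverse (R F : comNzRingType) (f : {rmorphism R -> F}) q v :
  f q * v = 1 -> integralOver f v -> exists g, v = f g.
Proof.
move=> qv [p mon_p /rootP]; rewrite horner_coef size_map_poly_id0; last first.
  by rewrite (monicP mon_p) rmorph1 oner_neq0.
have : (0 < size p)%N by rewrite size_poly_gt0 monic_neq0.
case es: (size p) => [//|m] _; rewrite big_ord_recr /=.
have -> : (map_poly f p)`_m = 1.
  by rewrite coef_map /=; move/monicP: mon_p; rewrite /lead_coef es /= => ->;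
    rewrite rmorph1.
rewrite mul1r => /eqP; rewrite addrC addr_eq0 => /eqP e.
case: m es e => [|m] es e.
  move: e; rewrite expr0 big_ord0 oppr0 => /eqP; by rewrite oner_eq0.
exists (- \sum_(i < m.+1) p`_i * q ^+ (m - i)).
have -> : v = f q ^+ m * v ^+ m.+1.
  by rewrite exprSr mulrA -exprMn qv expr1n mul1r.
rewrite e mulrN rmorphN rmorph_sum mulr_sumr; congr (- _).
apply: eq_bigr => i _; rewrite coef_map rmorphM rmorphXn.
have {1}-> : m = ((m - i) + i)%N by rewrite subnK // -ltnS.
by rewrite exprD mulrCA -mulrA -exprMn qv expr1n mulr1.
Qed.

(** If f is injective then the inverse of f X_0, being integral, would be an
    inverse of X_0 in the polynomial ring.  So the generators are algebraically
    dependent, and Nagata's change of variables makes F integral over a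
    polynomial ring in one variable less. *)
Lemma zariski (K : fieldType) r (F : comNzRingType)
    (f : {rmorphism {mpoly K[r]} -> F}) :
  (forall v : F, v != 0 -> exists w, v * w = 1) ->
  (forall u, integralOver f u) -> forall u, integralOver (f \o @mpolyC r K) u.
Proof.
move=> Finv; elim: r f => [|r IHr] f fint u.
  have [p mon_p rootpu] := fint u.
  exists (map_poly (meval (fun=> 0)) p); first exact: monic_map.
  rewrite -map_poly_comp (_ : map_poly _ p = map_poly f p) //.
  apply: eq_map_poly => q /=; congr (f _).
  elim/mpoly_closed_ind: q => [c|[]//|q q' eq eq'|q q' eq eq'].
  - by rewrite mevalC.
  - by rewrite mevalD mpolyCD eq eq'.
  - by rewrite mevalM mpolyCM eq eq'.
have [finj|/existsNP[Q /not_implyP[fQ /eqP Q0]]] :=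
    pselect (forall Q, f Q = 0 -> Q = 0).
  have fX0 : f 'X_ord0 != 0.
    apply/eqP => /finj/(congr1 (meval (fun=> 1))).
    by rewrite mevalXU meval0 => /eqP; rewrite oner_eq0.
  have [w Xw] := Finv _ fX0; have [g ew] := integral_inverse Xw (fint w).
  have : 'X_ord0 * g = 1.
    apply/eqP; rewrite -subr_eq0; apply/eqP/finj.
    by rewrite rmorphB rmorphM rmorph1 /= -ew Xw subrr.
  move/(congr1 (meval (fun=> 0))); rewrite mevalM mevalXU mul0r meval1 => /eqP.
  by rewrite eq_sym oner_eq0.
pose N := msize Q.
have ltN m : m \in msupp Q -> forall i, (m i < N)%N.
  move=> mQ i; apply: leq_ltn_trans (msize_mdeg_lt mQ).
  by rewrite mdegE (bigD1 i) //= leq_addr.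
have [c c0 lead] := nagata_lead_coef Q0 ltN.
pose z' (i : 'I_r) := f 'X_(lift ord0 i) - f 'X_ord0 ^+ (N ^ lift ord0 i).
pose g : {rmorphism {mpoly K[r]} -> F} := mmap (f \o @mpolyC r.+1 K) z'.
have gC a : g a%:MP = f a%:MP by rewrite /g /= mmapC.
have gX i : g 'X_i = z' i by rewrite /g /= mmapX mmap1U.
have comp : horner_eval (f 'X_ord0) \o map_poly g \o nagata K r N =1 f.
  apply: mpoly_eqmorph => [a|i] /=.
    by rewrite mmapC /= map_polyC /= /horner_eval hornerC gC.
  rewrite mmapX mmap1U /nagata_var.
  case: unliftP => [j ->|->]; last by rewrite map_polyX /horner_eval hornerX.
  rewrite rmorphD /= map_polyXn map_polyC /= /horner_eval hornerD hornerXn.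
  by rewrite hornerC gX /z' addrC subrK.
have intX0 : integralOver g (f 'X_ord0).
  exists ((c^-1)%:MP *: nagata K r N Q).
    by rewrite monicE lead_coefZ lead -mpolyCM mulVf // mpolyC1.
  by rewrite map_polyZ rootE hornerZ; have := comp Q;
    rewrite /= /horner_eval fQ => ->; rewrite mulr0.
have gf p : integralOver g (f p).
  apply: integral_mpoly => [a|i]; first by rewrite -gC; apply: integral_id.
  have [j ->|->] := unliftP ord0 i; last exact: intX0.
  rewrite -[f _](subrK (f 'X_ord0 ^+ (N ^ lift ord0 j))); apply: integral_add.
    by rewrite -/(z' j) -gX; apply: integral_id.
  elim: (N ^ _)%N => [|k IHk]; first by rewrite expr0; apply: integral1.
  by rewrite exprS; apply: integral_mul.
have [p mon_p rootp] := IHr g (fun u => integral_trans gf (fint u)) u.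
exists p => //; rewrite (_ : map_poly _ p = map_poly (g \o @mpolyC r K) p) //.
by apply: eq_map_poly => a /=; rewrite gC.
Qed.

Lemma maximal_mpoly_algebraic (K : fieldType) r (M : set {mpoly K[r]}) p :
  maximal_ideal M -> exists2 q : {poly K}, q \is monic &
    M (map_poly (@mpolyC r K) q).[p].
Proof.
move=> [[M0 MD MM] M1 maxM].
pose I : {pred {mpoly K[r]}} := [pred x | `[< M x >]].
have Icl : idealr_closed I.
  split; [exact/asboolP | exact/asboolP |].
  move=> a x y /asboolP Mx /asboolP My; apply/asboolP.
  by apply: (MD) => //; apply: MM.
pose Ii : idealr {mpoly K[r]} := HB.pack I (isIdealr.Build _ I Icl).
pose F : comNzRingType := Quotient.quot Ii.
pose f : {rmorphism {mpoly K[r]} -> F} := (\pi_(Quotient.quot Ii))%qT.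
have f0 x : f x = 0 <-> M x.
  have -> : f x = 0 <-> x \in I.
    rewrite -{2}[x]subr0 -(rmorph0 f).
    by have := Quotient.idealrBE Ii x 0; rewrite /in_mem /= => ->; split=> /eqP.
  by split=> /asboolP.
have Finv (v : F) : v != 0 -> exists w, v * w = 1.
  elim/quotW: v => x /eqP fx.
  have nMx : ~ M x by move=> /f0.
  have [[m Mm [c e]]|no] :=
      pselect ([set u | exists2 y, M y & exists c, u = y + x * c] 1).
    exists (f c); rewrite -[X in X * _]/(f x) -rmorphM -(rmorph1 f) e rmorphD.
    by rewrite (f0 m).2 ?add0r.
  case: nMx; apply: (maxM _ _ no); first exact: ideal_add_principal.
    by move=> y My; exists y => //; exists 0; rewrite mulr0 addr0.
  by exists 0 => //; exists 1; rewrite mulr1 add0r.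
have fint (u : F) : integralOver f u.
  by elim/quotW: u => x; apply: (integral_id f).
have [q mon_q rootq] := zariski Finv fint (f p).
exists q => //; apply/f0; move/rootP: rootq.
by rewrite map_poly_comp horner_map.
Qed.

(** * Coordinates with respect to a basis *)

Section Coordinates.
Variables (R A : comPzRingType) (io : {rmorphism R -> A}).
Variables (I : choiceType) (P : I -> Prop) (g : I -> A).
Implicit Types (a b : A) (k : I -> R).

(** The sequence only witnesses that k has finite support; functions are
    compared more easily than formal sums. *)
Definition expansion a k : Prop := exists s : seq I,
  [/\ uniq s, (forall i, i \in s -> P i), (forall i, k i != 0 -> i \in s)
    & a = \sum_(i <- s) io (k i) * g i].

Lemma expansion_widen k (s t : seq I) : uniq s -> uniq t -> {subset s <= t} ->
  (forall i, k i != 0 -> i \in s) ->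
  \sum_(i <- s) io (k i) * g i = \sum_(i <- t) io (k i) * g i.
Proof.
move=> us ut st ks; rewrite [RHS](bigID (mem s)) /= [X in _ + X]big1 ?addr0.
  rewrite -[RHS]big_filter; apply/perm_big/uniq_perm => //;
    first exact: filter_uniq.
  by move=> i; rewrite mem_filter; case: (boolP (i \in s)) => // /st ->.
move=> i nis; have [->|/ks is_] := eqVneq (k i) 0;
  first by rewrite rmorph0 mul0r.
by rewrite is_ in nis.
Qed.

Lemma expansionB a b k l : expansion a k -> expansion b l ->
  expansion (a - b) (fun i => k i - l i).
Proof.
move=> [s [us sP ks ->]] [t [ut tP lt ->]].
exists (undup (s ++ t)); rewrite undup_uniq; split=> // [i|i|].
- by rewrite mem_undup mem_cat => /orP[/sP|/tP].
- rewrite mem_undup mem_cat; apply: contraNT; rewrite negb_or => /andP[nis nit].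
  have [->] : k i = 0 by apply/eqP; apply: contraNT nis => /ks.
  have [->] : l i = 0 by apply/eqP; apply: contraNT nit => /lt.
  by rewrite subrr.
rewrite (@expansion_widen k s (undup (s ++ t))) ?undup_uniq //; last first.
  by move=> i ii; rewrite mem_undup mem_cat ii.
rewrite (@expansion_widen l t (undup (s ++ t))) ?undup_uniq //; last first.
  by move=> i ii; rewrite mem_undup mem_cat ii orbT.
by rewrite -sumrB; apply: eq_bigr => i _; rewrite rmorphB mulrBl.
Qed.

Lemma expansion0 : expansion 0 (fun=> 0).
Proof. by exists [::]; split=> // [i /eqP//|]; rewrite big_nil. Qed.

Lemma expansionZ r a k : expansion a k ->
    expansion (io r * a) (fun i => r * k i).
Proof.
move=> [s [us sP ks ->]]; exists s; split=> // [i rk|].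
  by apply: ks; apply: contraNneq rk => ->; rewrite mulr0.
by rewrite mulr_sumr; apply: eq_bigr => i _; rewrite rmorphM mulrA.
Qed.

Lemma expansion_gen i : P i -> expansion (g i) (fun j => (i == j)%:R).
Proof.
move=> Pi; exists [:: i]; split=> // [j|j|].
- by rewrite inE => /eqP ->.
- by rewrite inE [j == i]eq_sym; case: (i == j); rewrite ?eqxx.
- by rewrite big_seq1 eqxx rmorph1 mul1r.
Qed.

Definition spanned a : Prop := exists k, expansion a k.

Lemma spanned0 : spanned 0.
Proof. by exists (fun=> 0); apply: expansion0. Qed.

Lemma spannedB a b : spanned a -> spanned b -> spanned (a - b).
Proof.
by move=> [k ak] [l bl]; exists (fun i => k i - l i); apply: expansionB.
Qed.

Lemma spannedD a b : spanned a -> spanned b -> spanned (a + b).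
Proof.
move=> sa sb; rewrite -[b]opprK -[- b]sub0r.
by do 2!apply: spannedB => //; apply: spanned0.
Qed.

Lemma spannedZ r a : spanned a -> spanned (io r * a).
Proof. by move=> [k ak]; exists (fun i => r * k i); apply: expansionZ. Qed.

Lemma spanned_gen i : P i -> spanned (g i).
Proof. by move=> Pi; exists (fun j => (i == j)%:R); apply: expansion_gen. Qed.

Record coordinates (c : A -> I -> R) : Prop := {
  coords_expansion a : expansion a (c a);
  coordsB a b i : c (a - b) i = c a i - c b i;
  coordsZ r a i : c (io r * a) i = r * c a i;
  coords_gen i j : P i -> c (g i) j = (i == j)%:R
}.

Lemma exists_coordinates : (forall a, spanned a) ->
  (forall k, expansion 0 k -> forall i, k i = 0) ->
  exists c, coordinates c.
Proof.
move=> spans free; have [c cE] := choice spans; exists c.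
have uniq_exp a k l i : expansion a k -> expansion a l -> k i = l i.
  move=> ak al; have := expansionB ak al; rewrite subrr => /free/(_ i)/eqP.
  by rewrite subr_eq0 => /eqP.
split=> // [a b i|r a i|i j Pi].
- exact: (uniq_exp _ _ _ i (cE _) (expansionB (cE a) (cE b))).
- exact: (uniq_exp _ _ _ i (cE _) (expansionZ r (cE a))).
- exact: (uniq_exp _ _ _ j (cE _) (expansion_gen Pi)).
Qed.

Section Theory.
Variables (c : A -> I -> R) (cP : coordinates c).

Lemma coords0 i : c 0 i = 0.
Proof. by rewrite -(subrr (0 : A)) (coordsB cP) subrr. Qed.

Lemma coordsN a i : c (- a) i = - c a i.
Proof. by rewrite -sub0r (coordsB cP) coords0 sub0r. Qed.

Lemma coordsD a b i : c (a + b) i = c a i + c b i.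
Proof. by rewrite -[b in LHS]opprK (coordsB cP) coordsN opprK. Qed.

Lemma coords_sum (J : Type) (s : seq J) (p : pred J) (F : J -> A) i :
  c (\sum_(j <- s | p j) F j) i = \sum_(j <- s | p j) c (F j) i.
Proof.
by rewrite (big_morph (c^~ i) (fun a b => coordsD a b i) (coords0 i)).
Qed.

Lemma coords_inj a : (forall i, c a i = 0) -> a = 0.
Proof.
move=> a0; have [s [_ _ _ ->]] := coords_expansion cP a.
by rewrite big1 // => i _; rewrite a0 rmorph0 mul0r.
Qed.

Definition supported (T : I -> Prop) a := forall i, c a i != 0 -> T i.

Lemma supported0 (T : I -> Prop) : supported T 0.
Proof. by move=> i; rewrite coords0 eqxx. Qed.

Lemma supportedD (T : I -> Prop) a b :
  supported T a -> supported T b -> supported T (a + b).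
Proof.
move=> Ta Tb i; rewrite coordsD => h.
have [a0|/Ta//] := eqVneq (c a i) 0; apply: Tb; apply: contraNneq h => ->.
by rewrite a0 addr0.
Qed.

Lemma supportedZ (T : I -> Prop) r a : supported T a -> supported T (io r * a).
Proof.
move=> Ta i; rewrite (coordsZ cP) => h; apply: Ta.
by apply: contraNneq h => ->; rewrite mulr0.
Qed.

Lemma supported_sum (T : I -> Prop) (J : Type) (s : seq J) (p : pred J)
    (F : J -> A) :
  (forall j, p j -> supported T (F j)) -> supported T (\sum_(j <- s | p j) F j).
Proof.
by move=> TF; elim/big_ind: _ => // [|a b];
  [apply: supported0 | apply: supportedD].
Qed.

Lemma supported_gen (T : I -> Prop) i : P i -> T i -> supported T (g i).
Proof.
move=> Pi Ti j; rewrite (coords_gen cP) //.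
by case: (i =P j) => [<- //|_]; rewrite eqxx.
Qed.

(** A statement about the image of a linear map may be checked on the basis
    elements that occur. *)
Lemma supported_linear (V : A -> Prop) (T : I -> Prop) (f : A -> A) a :
  (forall b b', V b -> V b' -> V (b + b')) -> V 0 ->
  (forall b b', f (b + b') = f b + f b') ->
    (forall r b, f (io r * b) = io r * f b) ->
  (forall r b, V b -> V (io r * b)) ->
  (forall i, P i -> T i -> V (f (g i))) -> supported T a -> V (f a).
Proof.
move=> VD V0 fD fZ VZ Vg Ta; have [s [us sP ks ->]] := coords_expansion cP a.
have f0 : f 0 = 0 by rewrite -{1}(mul0r (0 : A)) -(rmorph0 io) fZ rmorph0 mul0r.
rewrite (big_morph f fD f0) big_seq; elim/big_ind: _ => // i /sP Pi; rewrite fZ.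
have [->|/Ta Ti] := eqVneq (c a i) 0; first by rewrite rmorph0 mul0r.
by apply: VZ; apply: Vg.
Qed.

Lemma supported_mul (T U : I -> Prop) b a :
  (forall i, P i -> T i -> supported U (b * g i)) ->
  supported T a -> supported U (b * a).
Proof.
move=> bU; apply: (@supported_linear (supported U) T ( *%R b)) => //.
- by move=> *; apply: supportedD.
- exact: supported0.
- by move=> *; rewrite mulrDr.
- by move=> *; rewrite mulrCA.
- by move=> *; apply: supportedZ.
Qed.

End Theory.

End Coordinates.

(** * Standard monomials and their weights *)

Section Exponents.
Variable n : nat.

(** A nonnegative entry d i stands for the power x_i ^ d i and a negative one for
    the power y_i ^ |d i|; this encodes that x_i and y_i do not both occur. *)
Definition expo : choiceType := {ffun 'I_n -> int}.
Implicit Type d : expo.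

Definition upd d i (z : int) : expo := [ffun j => if j == i then z else d j].

Definition neg_set d : {set 'I_n} := [set i | d i < 0]%SET.

Definition ewt (D : nat) (z : int) : nat :=
    if 0 <= z then `|z|%N else (D * `|z|)%N.

Definition wt D d : nat := (\sum_i ewt D (d i))%N.

Lemma upd_id d i : upd d i (d i) = d.
Proof. by apply/ffunP => j; rewrite ffunE; case: eqP => [->|]. Qed.

Lemma upd_eq d i z : upd d i z i = z.
Proof. by rewrite ffunE eqxx. Qed.

Lemma upd_neq d i z j : j != i -> upd d i z j = d j.
Proof. by move=> /negPf h; rewrite ffunE h. Qed.

Lemma upd_upd d i z z' : upd (upd d i z) i z' = upd d i z'.
Proof. by apply/ffunP => j; rewrite !ffunE; case: eqP. Qed.

Lemma wt_upd D d i z : (wt D (upd d i z) + ewt D (d i) = wt D d + ewt D z)%N.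
Proof.
rewrite /wt (bigD1 i) //= [X in (_ = X + _)%N](bigD1 i) //= upd_eq.
have -> : (\sum_(j | j != i) ewt D (upd d i z j)
  = \sum_(j | j != i) ewt D (d j))%N.
  by apply: eq_bigr => j nji; rewrite upd_neq.
by move: (ewt D z) (ewt D (d i)) (\sum_(j | j != i) ewt D (d j))%N => a b c;
  lia.
Qed.

Lemma neg_set_upd d i z : (d i < 0) = (z < 0) ->
    neg_set (upd d i z) = neg_set d.
Proof.
move=> e; apply/setP => j; rewrite !inE ffunE.
by case: eqP => // ->.
Qed.

Lemma wt_x D d i k : 0 <= d i -> wt D (upd d i (d i + k%:Z)) = (wt D d + k)%N.
Proof.
move=> di; have := wt_upd D d i (d i + k%:Z).
rewrite /ewt di (_ : 0 <= d i + k%:Z); [|lia].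
lia.
Qed.

Lemma wt_y D d i k : d i <= 0 ->
    wt D (upd d i (d i - k%:Z)) = (wt D d + D * k)%N.
Proof.
move=> di; have := wt_upd D d i (d i - k%:Z); rewrite /ewt.
case: ifP => di'.
  have d0 : d i = 0 by lia.
  rewrite !d0 sub0r /=; case: ifP => [k0|_]; last by rewrite abszN; lia.
  have -> : k = 0%N by lia.
  by rewrite muln0 oppr0 !addn0.
rewrite ifF; last lia.
have -> : `|d i - k%:Z|%N = (`|d i| + k)%N by lia.
by rewrite mulnDr; lia.
Qed.

Lemma neg_set_y d i : d i <= 0 ->
    neg_set (upd d i (d i - 1)) = (i |: neg_set d)%SET.
Proof.
move=> di; apply/setP => j; rewrite !inE ffunE.
by case: eqP => [->|//]; rewrite orTb; lia.
Qed.

Variables (A : comPzRingType) (x y : 'I_n -> A).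

Definition emono i (z : int) : A := if 0 <= z then x i ^+ `|z| else y i ^+ `|z|.

Definition mono d : A := \prod_i emono i (d i).

Lemma mono_upd d i z :
    mono (upd d i z) = emono i z * \prod_(j | j != i) emono j (d j).
Proof.
rewrite /mono (bigD1 i) //= upd_eq; congr (_ * _).
by apply: eq_bigr => j nji; rewrite upd_neq.
Qed.

Lemma x_mono d i k : 0 <= d i ->
    x i ^+ k * mono d = mono (upd d i (d i + k%:Z)).
Proof.
move=> di; rewrite -[in LHS](upd_id d i) !mono_upd mulrA /emono di.
have -> : 0 <= d i + k%:Z by lia.
by rewrite -exprD; congr (_ ^+ _ * _); lia.
Qed.

Lemma y_mono d i : d i <= 0 -> y i * mono d = mono (upd d i (d i - 1)).
Proof.
move=> di; rewrite -[in LHS](upd_id d i) !mono_upd mulrA /emono.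
have -> : (0 <= d i - 1) = false by lia.
have -> : `|d i - 1|%N = `|d i|.+1 by lia.
case: ifP => [di'|_]; last by rewrite exprS.
have -> : d i = 0 by lia.
by rewrite /= expr0 mulr1 expr1.
Qed.

Definition expo0 : expo := [ffun=> 0].

Lemma mono0 : mono expo0 = 1.
Proof. by rewrite /mono big1 // => i _; rewrite ffunE. Qed.

Lemma neg_set0 : neg_set expo0 = finset.set0.
Proof. by apply/setP => i; rewrite !inE ffunE. Qed.

Lemma wt0 D : wt D expo0 = 0%N.
Proof. by rewrite /wt big1 // => i _; rewrite ffunE. Qed.

End Exponents.

(** * Polynomial expressions in a sequence of ring elements *)

Section Combinations.
Variables (R A : comPzRingType) (io : {rmorphism R -> A}).
Variable q : nat.
Implicit Types (s : seq A) (v : nat -> R).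

(** The polynomial in the entries of s with coefficient v j at the monomial
    whose exponents are the base q digits of j, most significant digit
    first. *)
Fixpoint pcomb s v : A :=
  if s is a :: s' then
    \sum_(k < q) a ^+ k * pcomb s' (fun j => v (k * q ^ size s' + j)%N)
  else io (v 0%N).

Lemma eq_pcomb s v w : (forall j, (j < q ^ size s)%N -> v j = w j) ->
  pcomb s v = pcomb s w.
Proof.
elim: s v w => [|a s IHs] v w vw /=; first by rewrite vw.
apply: eq_bigr => k _; congr (_ * _); apply: IHs => j ltj; apply: vw.
rewrite /= expnS; have := ltn_ord k;
  have : (k.+1 * q ^ size s <= q * q ^ size s)%N.
  by rewrite leq_mul2r ltn_ord orbT.
by rewrite mulSn; lia.
Qed.

Lemma pcombD s v w : pcomb s (fun j => v j + w j) = pcomb s v + pcomb s w.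
Proof.
elim: s v w => [|a s IHs] v w /=; first by rewrite rmorphD.
by rewrite -big_split; apply: eq_bigr => k _; rewrite IHs mulrDr.
Qed.

Lemma pcombZ s r v : pcomb s (fun j => r * v j) = io r * pcomb s v.
Proof.
elim: s v => [|a s IHs] v /=; first by rewrite rmorphM.
by rewrite mulr_sumr; apply: eq_bigr => k _; rewrite IHs mulrCA.
Qed.

Lemma pcomb0 s : pcomb s (fun=> 0) = 0.
Proof.
by rewrite -[RHS](mul0r (pcomb s (fun=> 0))) -(rmorph0 io) -pcombZ;
  apply: eq_pcomb => j _; rewrite mul0r.
Qed.

Lemma pcomb_sum s (J : Type) (t : seq J) (F : J -> nat -> R) :
  pcomb s (fun j => \sum_(l <- t) F l j) = \sum_(l <- t) pcomb s (F l).
Proof.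
elim: t => [|l t IHt].
  by rewrite big_nil -(pcomb0 s); apply: eq_pcomb => j _; rewrite big_nil.
by rewrite big_cons -IHt -pcombD; apply: eq_pcomb => j _; rewrite big_cons.
Qed.

Lemma pcomb_delta s v :
  pcomb s v = \sum_(l < q ^ size s) io (v l) * pcomb s (fun j => (j == l)%:R).
Proof.
transitivity (pcomb s (fun j => \sum_(l < q ^ size s) v l * (j == l)%:R)).
  apply: eq_pcomb => j ltj; rewrite (bigD1 (Ordinal ltj)) //= eqxx mulr1.
  by rewrite big1 ?addr0 // => l; rewrite -val_eqE /= eq_sym => /negPf ->;
    rewrite mulr0.
by rewrite pcomb_sum; apply: eq_bigr => l _; rewrite pcombZ.
Qed.

End Combinations.

(** Factor out the lowest power of the first entry of s that occurs: what is
    left is a nonzero polynomial in the other entries plus a multiple of the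
    first one. *)
Lemma krull_monoid_pcomb (K : fieldType) (A : comPzRingType)
    (io : {rmorphism K -> A}) q s v j :
  (j < q ^ size s)%N -> v j != 0 -> krull_monoid s (pcomb io q s v).
Proof.
elim: s v j => [|a s IHs] v j /=.
  rewrite expn0 ltnS leqn0 => /eqP -> v0; exists (io (v 0%N)^-1).
  by rewrite -rmorphM mulfV // rmorph1.
rewrite expnS => ltj vj; set Q := (q ^ size s)%N in ltj *.
have Q_gt0 : (0 < Q)%N by case: Q ltj => //; rewrite muln0.
pose good k := [exists i : 'I_Q, v (k * Q + i)%N != 0].
have exk : exists k, (k < q)%N && good k.
  exists (j %/ Q)%N; rewrite ltn_divLR // ltj; apply/existsP.
  by exists (Ordinal (ltn_pmod j Q_gt0)); rewrite /= -divn_eq.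
case: (ex_minnP exk) => m /andP[ltmq /existsP[i vi]] mmin.
exists m, (\sum_(k < q | (m < k)%N)
   a ^+ (k - m.+1) * pcomb io q s (fun j => v (k * Q + j)%N)),
  (pcomb io q s (fun j => v (m * Q + j)%N)); split.
  by apply: (IHs _ i).
rewrite mulrDr (bigD1 (Ordinal ltmq)) //=; congr (_ + _).
rewrite !mulr_sumr [LHS](bigID (fun k : 'I_q => (m < k)%N)) /= addrC big1
  ?add0r.
  apply: eq_big => [k|k /andP[_ ltmk]].
    by rewrite -val_eqE /=; case: ltngtP.
  by rewrite !mulrA -exprSr -exprD; congr (_ ^+ _ * _); lia.
move=> k /andP[nkm lekm]; have {nkm lekm}ltkm : (k < m)%N.
  by rewrite ltn_neqAle nkm leqNgt.
rewrite (@eq_pcomb _ _ _ _ _ _ (fun=> 0)) ?pcomb0 ?mulr0 // => l ltl.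
apply/eqP; apply: contraLR ltkm => vl; rewrite -leqNgt; apply: mmin.
by rewrite ltn_ord; apply/existsP; exists (Ordinal ltl).
Qed.

(** * Algebras with a basis of standard monomials *)

(** The standard monomials are a basis, and a product of a variable with a
    standard monomial that is not itself a standard monomial is a combination
    of standard monomials of smaller weight than expected, where x_i has weight
    1 and y_i has weight D. *)
Record straightening (R A : comPzRingType) (io : {rmorphism R -> A})
    (n D : nat) (x y : 'I_n -> A) (good : pred {set 'I_n})
    (c : A -> expo n -> R) : Prop := {
  st_coord : coordinates io (fun d => good (neg_set d)) (mono x y) c;
  st_D_gt0 : (0 < D)%N;
  st_good0 : good finset.set0;
  st_x d i : good (neg_set d) -> d i < 0 ->
    supported c (fun d' => wt D d' <= wt D d)%N (x i * mono x y d);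
  st_y d i : good (neg_set d) -> 0 < d i \/ ~~ good (i |: neg_set d)%SET ->
    supported c (fun d' => wt D d' < wt D d + D)%N (y i * mono x y d)
}.

Section Filtration.
Variables (K : fieldType) (A : comPzRingType) (io : {rmorphism K -> A}).
Variables (n D : nat) (x y : 'I_n -> A) (good : pred {set 'I_n}).
Variables (c : A -> expo n -> K) (st : straightening io D x y good c).
Let cP := st_coord st.
Let D_gt0 := st_D_gt0 st.
Local Notation xmono := (mono x y).
Local Notation std d := (good (neg_set d)).
Local Notation wtD := (wt D).

Implicit Types (d : expo n) (i : 'I_n) (a b : A).

Definition fil (r : nat) (a : A) : Prop :=
    supported c (fun d => wtD d <= r)%N a.

Lemma fil_leq r s a : (r <= s)%N -> fil r a -> fil s a.
Proof. by move=> lers Fa d /Fa /leq_trans; apply. Qed.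

Lemma fil1 : fil 0 1.
Proof.
rewrite -(mono0 x y); apply: (supported_gen cP); last by rewrite wt0.
by rewrite neg_set0 (st_good0 st).
Qed.

Lemma filZ r k a : fil r a -> fil r (io k * a).
Proof. exact: (supportedZ cP). Qed.

Lemma std_upd_x d i k : std d -> 0 <= d i -> std (upd d i (d i + k%:Z)).
Proof. by move=> sd di; rewrite neg_set_upd //; lia. Qed.

Lemma x_fil_mono d i : std d -> fil (wtD d).+1 (x i * xmono d).
Proof.
move=> sd; have [di|di] := lerP 0 (d i); last first.
  by apply: fil_leq (st_x st sd di); apply: leqnSn.
rewrite -[x i]expr1 x_mono //; apply: (supported_gen cP);
  last by rewrite (@wt_x _ _ _ _ 1%N) // addn1.
exact: std_upd_x.
Qed.

Lemma y_fil_mono d i : std d -> fil (wtD d + D) (y i * xmono d).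
Proof.
move=> sd; have [di|di] := lerP (d i) 0; last first.
  by move=> d' /(st_y st sd (or_introl di))/ltnW.
have [gd|ngd] := boolP (good (i |: neg_set d)%SET); last first.
  by move=> d' /(st_y st sd (or_intror ngd))/ltnW.
rewrite y_mono //; apply: (supported_gen cP); first by rewrite neg_set_y.
by rewrite (@wt_y _ _ _ _ 1%N) // muln1.
Qed.

Lemma x_fil r i a : fil r a -> fil r.+1 (x i * a).
Proof.
apply: (supported_mul cP) => d sd le_r.
by refine (fil_leq _ (x_fil_mono sd)); rewrite ltnS.
Qed.

Lemma y_fil r i a : fil r a -> fil (r + D) (y i * a).
Proof.
apply: (supported_mul cP) => d sd le_r.
by refine (fil_leq _ (y_fil_mono sd)); rewrite leq_add2r.
Qed.

Lemma xX_fil r i k a : fil r a -> fil (r + k) (x i ^+ k * a).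
Proof.
move=> Fa; elim: k => [|k IHk]; first by rewrite expr0 mul1r addn0.
by rewrite exprS -mulrA addnS; apply: x_fil.
Qed.

Lemma yX_fil r i k a : fil r a -> fil (r + D * k) (y i ^+ k * a).
Proof.
move=> Fa; elim: k => [|k IHk]; first by rewrite expr0 mul1r muln0 addn0.
by rewrite exprS -mulrA mulnS [(D + _)%N]addnC addnA; apply: y_fil.
Qed.

Lemma mono_fil r d a : fil r a -> fil (r + wtD d) (xmono d * a).
Proof.
move=> Fa; rewrite /mono /wt.
elim: (index_enum _) => [|i s IHs]; first by rewrite !big_nil mul1r addn0.
rewrite !big_cons -mulrA [(ewt D _ + _)%N]addnC addnA /emono /ewt.
by case: ifP => _; [apply: xX_fil | apply: yX_fil].
Qed.

Lemma filM r s a b : fil r a -> fil s b -> fil (r + s) (a * b).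
Proof.
rewrite mulrC => Fa Fb; move: Fa; apply: (supported_mul cP) => d sd le_r.
by rewrite mulrC; refine (fil_leq _ (@mono_fil s d b Fb));
  rewrite addnC leq_add2r.
Qed.

Lemma fil_sum r (J : Type) (s : seq J) (p : pred J) (F : J -> A) :
  (forall j, p j -> fil r (F j)) -> fil r (\sum_(j <- s | p j) F j).
Proof. exact: (supported_sum cP). Qed.

Lemma fil_exists a : exists r, fil r a.
Proof.
have [s [_ _ ks _]] := coords_expansion cP a.
exists (\max_(d <- s) wtD d)%N => d /ks ds.
by rewrite (big_rem d ds) leq_maxl.
Qed.

Lemma fil_exists_seq (s : seq A) : exists r, forall a, a \in s -> fil r a.
Proof.
elim: s => [|a s [r hr]]; first by exists 0%N.
have [r' hr'] := fil_exists a; exists (maxn r r') => b.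
rewrite inE => /predU1P[->|/hr hb];
  [refine (fil_leq _ hr')|refine (fil_leq _ hb)].
  exact: leq_maxr.
exact: leq_maxl.
Qed.

Lemma fil_pcomb r q s v : (forall a, a \in s -> fil r a) ->
  fil (size s * (q * r)) (pcomb io q s v).
Proof.
elim: s v => [|a s IHs] v sr /=.
  by rewrite mul0n -[io _]mulr1; apply/filZ/fil1.
apply: fil_sum => k _; rewrite mulSn; apply: filM; last first.
  by apply: IHs => b bs; apply: sr; rewrite inE bs orbT.
suff: fil (k * r) (a ^+ k) by apply: fil_leq; rewrite leq_mul2r ltnW ?orbT.
elim: (nat_of_ord k) => [|l IHl]; first by rewrite expr0 mul0n; apply: fil1.
by rewrite exprS mulSn; apply: filM => //; apply: sr; rewrite inE eqxx.
Qed.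

(** Entries from -r to r suffice for the exponents of weight at most r. *)
Definition box (r : nat) (e : {ffun 'I_n -> 'I_(r.*2.+1)}) : expo n :=
  [ffun i => (e i)%:Z - r%:Z].

Lemma boxP r d : (wtD d <= r)%N -> exists e, d = @box r e.
Proof.
move=> le_r; have le_d i : (`|d i| <= r)%N.
  apply: leq_trans le_r; rewrite /wt (bigD1 i) //=.
  apply: leq_trans (leq_addr _ _); rewrite /ewt; case: ifP => // _.
  by rewrite leq_pmull.
exists [ffun i => inord (absz (d i + r%:Z))]; apply/ffunP => i; rewrite !ffunE.
by rewrite inordK; have := le_d i; lia.
Qed.

(** The polynomials of degree less than q in each of the n + 1 entries of s
    form a space of dimension q ^ n.+1.  Their values have weight O(q), so they
    lie in a space of dimension O(q ^ n).  For large q some nonzero polynomial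
    vanishes at s. *)
Lemma krull_monoid_fil (s : seq A) : size s = n.+1 -> krull_monoid s 0.
Proof.
move=> szs; have [r hr] := fil_exists_seq s.
(* the values have weight at most n.+1 * q * r; the box for this weight has at
   most (C * q) ^ n < q ^ n.+1 points *)
pose C := (n.+1 * r).*2.+1; pose q := (C ^ n).+1.
pose rr := (size s * (q * r))%N.
have lt_box : (#|{ffun 'I_n -> 'I_(rr.*2.+1)}| < q ^ size s)%N.
  rewrite card_ffun !card_ord szs expnSr.
  have leC : (rr.*2.+1 <= C * q)%N.
    by rewrite /rr /C szs mulSn -!muln2; have : (0 < q)%N by []; nia.
  have leX m : (rr.*2.+1 ^ m <= (C * q) ^ m)%N by case: m => // m;
    rewrite leq_exp2r.
  apply: (leq_ltn_trans (leX n)).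
  by rewrite expnMn mulnC ltn_pmul2l // expn_gt0.
pose Q := (q ^ size s)%N; pose T := {ffun 'I_n -> 'I_(rr.*2.+1)}.
pose Mx : 'M[K]_(Q, #|T|) :=
  \matrix_(l, b) c (pcomb io q s (fun j => (j == l)%:R)) (box (enum_val b)).
have : kermx Mx != 0.
  rewrite -mxrank_eq0 mxrank_ker subn_eq0 -ltnNge.
  exact: leq_ltn_trans (rank_leq_col _) lt_box.
move=> /eqP/matrixP ker0.
have [e [l kel]] : exists e l, kermx Mx e l != 0.
  apply: contrapT => no; apply: ker0 => e l; rewrite [RHS]mxE.
  by apply/eqP/negPn/negP => h; apply: no; exists e, l.
pose v (j : nat) : K := if insub j is Some l then kermx Mx e l else 0.
have vE (l' : 'I_Q) : v l' = kermx Mx e l' by rewrite /v valK.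
have <- : pcomb io q s v = 0.
  apply: (coords_inj cP) => d.
  have := @fil_pcomb r q s v hr d; rewrite -/rr.
  have [//|ncd /(_ isT)/boxP[b ->]] := eqVneq (c (pcomb io q s v) d) 0.
  rewrite pcomb_delta (coords_sum cP).
  have := congr1 (fun X : 'M_(_, _) => X e (enum_rank b)) (mulmx_ker Mx).
  rewrite [LHS]mxE [RHS]mxE => ker_eb; rewrite -[RHS]ker_eb;
    apply: eq_bigr => l' _.
  by rewrite (coordsZ cP) vE [Mx _ _]mxE enum_rankK.
by apply: (@krull_monoid_pcomb _ _ io q s v l); rewrite ?vE.
Qed.

End Filtration.

(** * A regular sequence of maximal length *)

Section IntegerShift.
Variable D : nat.
Implicit Type z : int.

(** The effect on the exponent of index i of multiplication by the k-th power
    of theta_i, as far as leading terms are concerned. *)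
Definition zshift (k : nat) z : int :=
    if z < 0 then z - k%:Z else z + (D * k)%:Z.

Lemma zshift_lt0 k z : (zshift k z < 0) = (z < 0).
Proof. by rewrite /zshift; case: ifP; lia. Qed.

Lemma zshift_inj k : injective (zshift k).
Proof.
move=> z z' e; have e0 :
  (z < 0) = (z' < 0) by rewrite -(zshift_lt0 k) e zshift_lt0.
by move: e; rewrite /zshift e0; case: ifP => _; lia.
Qed.

Variable m : nat.
Hypotheses (D_gt0 : (0 < D)%N) (m_gt0 : (0 < m)%N).

(** Every exponent is obtained in a unique way from one of the finitely many
    exponents with zquo equal to 0 by iterating zshift m. *)
Definition zquo z : nat :=
  if z < 0 then ((`|z| - 1) %/ m)%N else (`|z| %/ (D * m))%N.

Definition zrem z : int :=
  if z < 0 then - (((`|z| - 1) %% m).+1)%:Z else (`|z| %% (D * m))%N%:Z.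

Lemma zquo_shift z : zquo (zshift m z) = (zquo z).+1.
Proof.
rewrite /zquo zshift_lt0 /zshift; case: ltrP => z0.
  have -> : (absz (z - m%:Z)%R - 1 = m + (`|z| - 1))%N by lia.
  by rewrite divnDl // divnn m_gt0 add1n.
have -> : (absz (z + (D * m)%N%:Z)%R = D * m + `|z|)%N by move: (D * m)%N => u;
  lia.
by rewrite divnDl // divnn muln_gt0 D_gt0 m_gt0 add1n.
Qed.

Lemma zrem_shift z : zrem (zshift m z) = zrem z.
Proof.
rewrite /zrem zshift_lt0 /zshift; case: ltrP => z0.
  have -> : (absz (z - m%:Z)%R - 1 = m + (`|z| - 1))%N by lia.
  by rewrite modnDl.
have -> : (absz (z + (D * m)%N%:Z)%R = D * m + `|z|)%N by move: (D * m)%N => u;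
  lia.
by rewrite modnDl.
Qed.

Lemma zrem_id z : zquo z = 0%N -> zrem z = z.
Proof.
rewrite /zquo /zrem; case: ifP => z0 /eqP;
  rewrite -leqn0 leqNgt divn_gt0 ?muln_gt0
  ?D_gt0 // -ltnNge => lt; rewrite modn_small //; lia.
Qed.

Lemma zquo_gt0 z : (0 < zquo z)%N -> exists z', z = zshift m z'.
Proof.
rewrite /zquo; case: ifP => z0; rewrite divn_gt0 ?muln_gt0 ?D_gt0 // => le.
  exists (z + m%:Z); rewrite /zshift; case: ifP; lia.
exists (z - (D * m)%N%:Z); rewrite /zshift; move: (D * m)%N le => u le.
by case: ifP; lia.
Qed.

End IntegerShift.

Section RegularSequence.
Variables (K : fieldType) (A : comNzRingType) (io : {rmorphism K -> A}).
Variables (n D : nat) (x y : 'I_n -> A) (good : pred {set 'I_n}).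
Variables (c : A -> expo n -> K) (st : straightening io D x y good c).
Let cP := st_coord st.
Let D_gt0 := st_D_gt0 st.
Local Notation xmono := (mono x y).
Local Notation std d := (good (neg_set d)).
Local Notation wtD := (wt D).
Implicit Types (d : expo n) (i : 'I_n) (a b : A).

(** Both terms have the same weight, so that theta_i is homogeneous. *)
Definition theta i : A := x i ^+ D + y i.

(** The weight alone does not single out a leading term: if neither x_i nor y_i
    divides a standard monomial then its products with x_i ^ D and y_i may both
    be standard.  The number of nonnegative exponents breaks the tie in favor of
    the former. *)
Definition fine_wt d : nat := (n.+1 * wtD d + #|~: neg_set d|)%N.

Definition low (w : nat) a : Prop := supported c (fun d => fine_wt d < w)%N a.

Definition shift i k d : expo n := upd d i (zshift D k (d i)).

Lemma low_leq v w a : (v <= w)%N -> low v a -> low w a.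
Proof. by move=> levw La d /La h; apply: leq_trans levw. Qed.

Lemma lowD w a b : low w a -> low w b -> low w (a + b).
Proof. exact: (supportedD cP). Qed.

Lemma lowZ w k a : low w a -> low w (io k * a).
Proof. exact: (supportedZ cP). Qed.

Lemma neg_set_shift i k d : neg_set (shift i k d) = neg_set d.
Proof. by rewrite /shift neg_set_upd // zshift_lt0. Qed.

Lemma wt_shift i k d : wtD (shift i k d) = (wtD d + D * k)%N.
Proof.
rewrite /shift /zshift; case: ifP => di; first by rewrite (wt_y D) //; lia.
by rewrite (wt_x D) //; lia.
Qed.

Lemma fine_wt_shift i k d :
    fine_wt (shift i k d) = (fine_wt d + n.+1 * (D * k))%N.
Proof. by rewrite /fine_wt neg_set_shift wt_shift mulnDr addnAC. Qed.

Lemma shift_shift i k l d : shift i k (shift i l d) = shift i (l + k) d.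
Proof.
rewrite /shift upd_upd; congr upd; rewrite upd_eq /zshift.
by case: (ltrP (d i) 0) => di; case: ifP => di'; rewrite ?mulnDr; lia.
Qed.

Lemma fil_low r d a : (r < wtD d + D)%N -> fil D c r a ->
    low (fine_wt d + n.+1 * D) a.
Proof.
move=> ltr Fa e /Fa le_e; rewrite /fine_wt.
have : (#|~: neg_set e| <= n)%N by rewrite -[X in (_ <= X)%N]card_ord max_card.
have : (n.+1 * wtD e <= n.+1 * r)%N by rewrite leq_mul2l le_e orbT.
have : (n.+1 * r.+1 <= n.+1 * (wtD d + D))%N by rewrite leq_mul2l ltr orbT.
rewrite mulnS mulnDr;
  move: (n.+1 * wtD e)%N (n.+1 * r)%N (n.+1 * D)%N (n.+1 * wtD d)%N.
by move=> *; lia.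
Qed.

(** If y_i divides the monomial then its product with x_i ^ D is not standard,
    and if x_i divides it then its product with y_i is not standard; such a
    product has smaller weight. *)
Lemma theta_mono i d : std d ->
  low (fine_wt d + n.+1 * D) (theta i * xmono d - xmono (shift i 1 d)).
Proof.
move=> sd; rewrite /theta mulrDl /shift /zshift muln1; case: ltrP => di.
  rewrite y_mono ?ltW // addrK.
  apply: (@fil_low (wtD d + D.-1)); first lia.
  have -> : x i ^+ D = x i ^+ D.-1 * x i by rewrite -exprSr prednK.
  rewrite -mulrA.
  exact: (xX_fil st (st_x st sd di)).
rewrite x_mono // addrAC subrr add0r.
have [di0|di0] := eqVneq (d i) 0; last first.
  apply: (@fil_low (wtD d + D).-1);
    first by rewrite prednK // addn_gt0 D_gt0 orbT.
  have h : 0 < d i by lia.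
  move=> e /(st_y st sd (or_introl h)); lia.
have [gd|ngd] := boolP (good (i |: neg_set d)%SET); last first.
  apply: (@fil_low (wtD d + D).-1);
    first by rewrite prednK // addn_gt0 D_gt0 orbT.
  move=> e /(st_y st sd (or_intror ngd)); lia.
have di' : d i <= 0 by rewrite di0.
rewrite y_mono //; apply: (supported_gen cP); first by rewrite neg_set_y.
rewrite /fine_wt (@wt_y _ _ _ _ 1%N) // neg_set_y // muln1 mulnDr.
have : (#|~: (i |: neg_set d)%SET| < #|~: neg_set d|)%N.
  apply: proper_card; rewrite properE; apply/andP; split.
    by apply/fintype.subsetP => j; rewrite !inE negb_or => /andP[].
  by apply/fintype.subsetPn; exists i; rewrite !inE ?di0 // eqxx.
by move=> h; rewrite addnAC ltn_add2r ltn_add2l.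
Qed.

Lemma low_theta w i a : low w a -> low (w + n.+1 * D) (theta i * a).
Proof.
apply: (supported_mul cP) => d sd ltw.
rewrite -[X in supported _ _ X](subrK (xmono (shift i 1 d))).
apply: lowD; first by refine (low_leq _ (theta_mono sd));
  rewrite leq_add2r ltnW.
apply: (supported_gen cP); first by rewrite neg_set_shift.
by rewrite fine_wt_shift muln1 ltn_add2r.
Qed.

Lemma low_thetaX w i k a : low w a ->
    low (w + n.+1 * (D * k)) (theta i ^+ k * a).
Proof.
move=> La; elim: k => [|k IHk]; first by rewrite expr0 mul1r !muln0 addn0.
by rewrite exprS -mulrA mulnS mulnDr [(n.+1 * D + _)%N]addnC addnA;
  apply: low_theta.
Qed.

Lemma thetaX_mono i k d : std d ->
  low (fine_wt d + n.+1 * (D * k))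
    (theta i ^+ k * xmono d - xmono (shift i k d)).
Proof.
move=> sd; elim: k => [|k IHk].
  have -> : shift i 0 d = d.
    rewrite /shift (_ : zshift D 0 (d i) = d i) ?upd_id // /zshift muln0.
    by case: ifP; lia.
  rewrite expr0 mul1r subrr.
  exact: (supported0 cP).
rewrite exprS -mulrA mulnS mulnDr [(n.+1 * D + _)%N]addnC addnA.
have -> : theta i * (theta i ^+ k * xmono d) - xmono (shift i k.+1 d) =
  theta i * (theta i ^+ k * xmono d - xmono (shift i k d)) +
  (theta i * xmono (shift i k d) - xmono (shift i 1 (shift i k d))).
  by rewrite shift_shift addn1; ring.
apply: lowD; first exact: low_theta.
by rewrite -(fine_wt_shift i); apply: theta_mono; rewrite neg_set_shift.
Qed.

Section SystemOfParameters.
Variable q : 'I_n -> {poly K}.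
Hypothesis q_monic : forall i, q i \is monic.
Hypothesis q_size : forall i, (1 < size (q i))%N.

Definition qdeg i : nat := (size (q i)).-1.

Definition param i : A := \sum_(k < size (q i)) io (q i)`_k * theta i ^+ k.

Lemma qdeg_gt0 i : (0 < qdeg i)%N.
Proof. by rewrite /qdeg -subn1 subn_gt0 q_size. Qed.

Lemma paramE i :
  param i = \sum_(k < qdeg i) io (q i)`_k * theta i ^+ k + theta i ^+ qdeg i.
Proof.
rewrite /param; have :
  size (q i) = (qdeg i).+1 by rewrite prednK // ltnW ?q_size.
move=> ->; rewrite big_ord_recr /=; congr (_ + _).
by move/monicP: (q_monic i); rewrite /lead_coef -/(qdeg i) => ->;
  rewrite rmorph1 mul1r.
Qed.

Lemma low_param w i a : low w a -> low (w + n.+1 * (D * qdeg i)) (param i * a).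
Proof.
move=> La; rewrite paramE mulrDl mulr_suml; apply: lowD; last exact: low_thetaX.
apply: (supported_sum cP) => k _; rewrite -mulrA; apply: lowZ.
refine (low_leq _ (low_thetaX (k := k) (i := i) La)).
by rewrite leq_add2l !leq_mul2l ltnW ?orbT.
Qed.

(** Only the leading term of the monic polynomial q_i matters. *)
Lemma param_mono i d : std d ->
  low (fine_wt d + n.+1 * (D * qdeg i))
    (param i * xmono d - xmono (shift i (qdeg i) d)).
Proof.
move=> sd; rewrite paramE mulrDl -addrA mulr_suml; apply: lowD;
  last exact: thetaX_mono.
apply: (supported_sum cP) => k _; rewrite -mulrA; apply: lowZ.
have Ld : low (fine_wt d).+1 (xmono d) by apply: (supported_gen cP).
refine (low_leq _ (low_thetaX (k := k) (i := i) Ld)).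
rewrite addSn ltn_add2l !ltn_pmul2l //.
Qed.

Definition quo_expo d i : nat := zquo D (qdeg i) (d i).

Definition rem_expo d : expo n := [ffun i => zrem D (qdeg i) (d i)].

(** A second basis, adapted to the elements param i: each of them maps basis
    elements to basis elements. *)
Definition pbasis d : A :=
    (\prod_i param i ^+ quo_expo d i) * xmono (rem_expo d).

Lemma pbasis_shift i d : pbasis (shift i (qdeg i) d) = param i * pbasis d.
Proof.
rewrite /pbasis mulrA; congr (_ * xmono _); last first.
  apply/ffunP => j; rewrite !ffunE; case: eqP => // ->.
  by rewrite zrem_shift ?qdeg_gt0.
rewrite (bigD1 i) //= [in RHS](bigD1 i) //= mulrA -exprS; congr (_ ^+ _ * _).
  by rewrite /quo_expo /shift upd_eq zquo_shift // qdeg_gt0.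
by apply: eq_bigr => j nji; rewrite /quo_expo /shift upd_neq.
Qed.

Lemma quo_expo_gt0 d i : (0 < quo_expo d i)%N ->
  exists2 d', d = shift i (qdeg i) d' & neg_set d' = neg_set d.
Proof.
move=> /(zquo_gt0 D_gt0 (qdeg_gt0 i)) [z ez]; exists (upd d i z).
  by rewrite /shift upd_upd upd_eq -ez upd_id.
by rewrite neg_set_upd // ez zshift_lt0.
Qed.

Lemma pbasis_lead d : std d -> low (fine_wt d) (pbasis d - xmono d).
Proof.
have [w] := ubnP (wtD d); elim: w d => // w IHw d ltw sd.
have [/existsP[i qi]|/existsPn q0] := boolP [exists i, (0 < quo_expo d i)%N].
  have [d' ed nd] := quo_expo_gt0 qi; have sd' : std d' by rewrite nd.
  have ltd : (wtD d' < w)%N.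
    apply: (@leq_trans (wtD d)); last by rewrite -ltnS.
    rewrite ed wt_shift -addn1 leq_add2l.
    by rewrite muln_gt0 D_gt0 qdeg_gt0.
  have Ld' := IHw d' ltd sd'.
  rewrite {2 3}ed ed pbasis_shift fine_wt_shift.
  have -> : param i * pbasis d' - xmono (shift i (qdeg i) d') =
    param i * (pbasis d' - xmono d') +
      (param i * xmono d' - xmono (shift i (qdeg i) d')).
    by ring.
  by apply: lowD; [exact: low_param | exact: param_mono].
have {}q0 i : quo_expo d i = 0%N by apply/eqP; rewrite -leqn0 leqNgt.
rewrite /pbasis big1 ?mul1r => [|i _]; last by rewrite q0 expr0.
have -> : rem_expo d = d.
  by apply/ffunP => i;
    rewrite ffunE (zrem_id D_gt0 (qdeg_gt0 i)) // -/(quo_expo d i).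
by rewrite subrr; apply: (supported0 cP).
Qed.

(** The transition from the standard monomials is unitriangular with respect to
    fine_wt. *)
Lemma pbasis_coordinates : exists g, coordinates io (fun d => std d) pbasis g.
Proof.
pose span_g := spanned io (fun d => std d) pbasis.
have span_id (T : expo n -> Prop) a :
    (forall d, std d -> T d -> span_g (xmono d)) -> supported c T a -> span_g a.
  move=> h; apply: (supported_linear (V := span_g) (f := id) cP _ _ _ _ _ h) =>
    //.
  - exact: spannedD.
  - exact: spanned0.
  - exact: spannedZ.
have span_mono d : std d -> span_g (xmono d).
  have [w] := ubnP (fine_wt d); elim: w d => // w IHw d ltw sd.
  rewrite -[xmono d](subKr (pbasis d)); apply: spannedB;
    first exact: spanned_gen.
  apply: span_id (pbasis_lead sd) => e se lte; apply: IHw => //.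
  exact: leq_trans lte ltw.
apply: exists_coordinates.
  by move=> a; apply: (@span_id (fun=> True)) => [d sd _|//]; apply: span_mono.
move=> k [s [us ss ks e0]] d0; apply/eqP/negPn/negP => kd0.
pose s' := [seq d <- s | k d != 0].
have [|d ds' maxd] := @seq_argmax _ fine_wt s'.
  by apply: contraTneq (ks _ kd0) => s'0;
    have := mem_filter (fun d => k d != 0) d0 s;
    rewrite -/s' s'0 kd0 /= => <-.
move: ds'; rewrite mem_filter => /andP[kd ds].
have := congr1 (c^~ d) e0; rewrite /= (coords0 cP) (coords_sum cP).
have low_d e : std e -> (fine_wt e <= fine_wt d)%N ->
  c (pbasis e) d = (e == d)%:R.
  move=> se le_e; rewrite -[pbasis e](subrK (xmono e)) (coordsD cP)
    (coords_gen cP) //.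
  have [->|/(pbasis_lead se)] := eqVneq (c (pbasis e - xmono e) d) 0;
    first by rewrite add0r.
  by rewrite ltnNge le_e.
rewrite (bigD1_seq d) //= (coordsZ cP) low_d ?ss // eqxx mulr1 big1_seq ?addr0.
  by move=> /esym/eqP; rewrite (negPf kd).
move=> e /andP[ned es]; rewrite (coordsZ cP).
have [->|ke] := eqVneq (k e) 0; first by rewrite mul0r.
by rewrite low_d ?ss ?maxd ?mem_filter ?ke // (negPf ned) mulr0.
Qed.

Definition params : seq A := [seq param i | i <- enum 'I_n].

Lemma nth_params (k : nat) (ltkn : (k < n)%N) :
    params`_k = param (Ordinal ltkn).
Proof.
rewrite /params (nth_map (Ordinal ltkn)) ?size_enum_ord //.
by congr param; apply: val_inj; rewrite /= nth_enum_ord.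
Qed.

Lemma size_params : size params = n.
Proof. by rewrite size_map size_enum_ord. Qed.

(** In the basis pbasis, the ideal spanned by the first k params consists of the
    elements supported on the exponents in the image of one of the first k
    shifts.  The k-th shift only changes the k-th entry, so it is injective and
    reflects membership in these images. *)
Lemma params_regular : forall k, (k < size params)%N -> forall a,
  ideal_span (take k params) (params`_k * a) -> ideal_span (take k params) a.
Proof.
have [g gP] := pbasis_coordinates.
pose T (k : nat) d := exists2 i : 'I_n, (i < k)%N & (0 < quo_expo d i)%N.
have spanT k a : (k <= n)%N -> ideal_span (take k params) a ->
  supported g (T k) a.
  move=> lekn [f ->]; apply: (supported_sum gP) => j _; rewrite mulrC.
  have : (j < minn k n)%N by rewrite -size_params -size_take_min ltn_ord.
  rewrite leq_min => /andP[ltjk ltjn].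
  rewrite nth_take // (nth_params ltjn).
  have : supported g (fun=> True) (f j) by [].
  apply: (supported_mul gP) => d sd _; rewrite -pbasis_shift.
  apply: (supported_gen gP); first by rewrite neg_set_shift.
  by exists (Ordinal ltjn) => //;
    rewrite /quo_expo /shift upd_eq zquo_shift // qdeg_gt0.
have Tspan k a : (k <= n)%N -> supported g (T k) a ->
  ideal_span (take k params) a.
  move=> lekn; have [I0 ID IM] := ideal_spanP (take k params).
  apply: (@supported_linear _ _ _ _ _ _ _ gP (ideal_span (take k params))
    (T k) id) => //.
    by move=> r b; apply: IM.
  move=> d sd [i ltik qi]; have [d' -> nd] := quo_expo_gt0 qi.
  rewrite pbasis_shift mulrC; apply: IM;
    rewrite [i](_ : _ = Ordinal (ltn_ord i)); last exact: val_inj.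
  rewrite -nth_params -(@nth_take k) //; apply: mem_ideal_span.
  by rewrite size_take_min size_params leq_min ltik ltn_ord.
move=> k; rewrite size_params => ltkn a; rewrite (nth_params ltkn).
set i := Ordinal ltkn => /(spanT _ _ (ltnW ltkn)) h; apply: (Tspan) => [|d gad].
  exact: ltnW.
have [j ltjk] : T k (shift i (qdeg i) d).
  apply: h; rewrite [X in g (_ * X)](_ : a = \sum_(e <- [:: a]) e);
    last by rewrite big_seq1.
  have [s [us ss ks ea]] := coords_expansion gP a.
  rewrite big_seq1 [X in _ * X]ea mulr_sumr (coords_sum gP).
  rewrite (bigD1_seq d) //=; last exact: ks.
  have sd : std d by apply/ss/ks.
  rewrite mulrCA -pbasis_shift (coordsZ gP) (coords_gen gP) ?neg_set_shift //.
  rewrite eqxx mulr1 big1_seq ?addr0 // => e /andP[ned es].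
  rewrite mulrCA -pbasis_shift (coordsZ gP)
    (coords_gen gP) ?neg_set_shift ?ss //.
  case: eqP => [/ffunP eed|_]; last by rewrite mulr0.
  case/eqP: ned; apply/ffunP => l; have := eed l; rewrite /shift !ffunE.
  by case: eqP => [->|//]; apply: zshift_inj.
rewrite /quo_expo /shift upd_neq; first by exists j.
by rewrite -val_eqE /= neq_ltn ltjk.
Qed.

End SystemOfParameters.

End RegularSequence.

Lemma maximal_preimage (R S : comPzRingType) (f : {rmorphism R -> S})
    (M : set S) :
  (forall y, exists x, f x = y) -> maximal_ideal M ->
  maximal_ideal [set a | M (f a)].
Proof.
move=> fsurj [[M0 MD MM] M1 maxM]; split.
- split=> [|a b|a b] /=; first by rewrite rmorph0.
    by rewrite rmorphD; apply: MD.
  by rewrite rmorphM; apply: MM.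
- by rewrite /= rmorph1.
- move=> J [J0 JD JM] J1 MJ a Ja /=.
  apply: (maxM [set b | exists2 u, J u & b = f u]) => [||b Mb|];
    last by exists a.
  + split=> [|b b' [u Ju ->] [v Jv ->]|b b' [u Ju ->]].
    * by exists 0; rewrite ?rmorph0.
    * by exists (u + v); [exact: JD | rewrite rmorphD].
    * by have [v <-] := fsurj b; exists (v * u); [exact: JM | rewrite rmorphM].
  + move=> [u Ju fu]; apply: J1; rewrite -(subrK u 1); apply: (JD) => //.
    by apply: MJ; rewrite /= rmorphB rmorph1 fu subrr.
  + by have [u ub] := fsurj b; exists u => //; apply: MJ; rewrite /= ub.
Qed.

Theorem straightening_cohen_macaulay (K : fieldType) (A : comNzRingType)
    (io : {rmorphism K -> A}) (n D : nat) (x y : 'I_n -> A)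
    (good : pred {set 'I_n}) (c : A -> expo n -> K) :
  straightening io D x y good c -> cohen_macaulay A.
Proof.
move=> st; have cP := st_coord st.
pose f : {rmorphism {mpoly K[n + n]} -> A} :=
  mmap io (fun j => match split j with inl i => x i | inr i => y i end).
pose X i : {mpoly K[n + n]} := 'X_(lshift n i).
pose Y i : {mpoly K[n + n]} := 'X_(rshift n i).
have fX i : f (X i) = x i by rewrite /f /= mmapX mmap1U (unsplitK (inl i)).
have fY i : f (Y i) = y i by rewrite /f /= mmapX mmap1U (unsplitK (inr i)).
have fC a : f a%:MP = io a by rewrite /f /= mmapC.
have fsurj a : exists p, f p = a.
  have [s [_ _ _ ->]] := coords_expansion cP a.
  exists (\sum_(d <- s) (c a d)%:MP * mono X Y d).
  rewrite rmorph_sum; apply: eq_bigr => d _; rewrite rmorphM fC; congr (_ * _).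
  rewrite /mono rmorph_prod; apply: eq_bigr => i _; rewrite /emono.
  by case: ifP => _; rewrite rmorphXn (fX, fY).
apply: (@cohen_macaulay_crit _ n).
- by apply: (noetherian_image fsurj); apply: noetherian_mpoly.
- exact: (krull_monoid_fil st).
move=> M maxM; have maxM' := maximal_preimage fsurj maxM.
have [[M0 MD MM] M1 _] := maxM.
have /choice[q hq] (i : 'I_n) : exists q : {poly K}, q \is monic /\
    M (f (map_poly (@mpolyC (n + n) K) q).[X i ^+ D + Y i]).
  by have [q ? ?] := maximal_mpoly_algebraic (X i ^+ D + Y i) maxM'; exists q.
have Mparam i : M (param io D x y q i).
  have [mon_q] := hq i; rewrite horner_coef size_map_poly rmorph_sum.
  rewrite /param /theta; congr (M _); apply: eq_bigr => k _.
  by rewrite rmorphM rmorphXn rmorphD rmorphXn /= fX fY coef_map /= fC.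
have q_monic i : q i \is monic by case: (hq i).
have q_size i : (1 < size (q i))%N.
  rewrite ltnNge; apply/negP => le1; apply: M1.
  have e : q i = 1.
    have /monicP := q_monic i; rewrite (size1_polyC le1) lead_coefC => ->.
    exact: polyC1.
  have := Mparam i; rewrite /param e size_poly1 big_ord1 coef1 eqxx.
  by rewrite rmorph1 expr0 mulr1.
have paramsM a : a \in params io D x y q -> M a by move=> /mapP[i _ ->].
exists (params io D x y q); last exact: size_params.
split=> //; split.
  by move=> h; apply: M1; apply: ideal_span_sub h.
exact: (params_regular st q_monic q_size).
Qed.

(** * Acyclic vertex sets and tropical equations *)

Section Quiver.
Variables (n : nat) (Q : ice_quiver n).
Implicit Types (i j : 'I_n) (S T : {set 'I_n}) (a : arrow Q).

Definition has_succ T i :=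
    [exists a : arrow Q, (source a == i) && (target a \in T)].
Definition has_pred T i :=
    [exists a : arrow Q, (target a == i) && (source a \in T)].

(** Such a set contains a directed cycle, and the vertices of a directed cycle
    form such a set; having both neighbours is what the determinant of
    stuck_matrix needs. *)
Definition stuck T : bool :=
  [&& T != finset.set0, T \subset unfrozen Q
    & [forall i in T, has_succ T i && has_pred T i]].

Definition acyclic S : bool :=
    [forall T : {set 'I_n}, stuck T ==> ~~ (T \subset S)].

Lemma acyclicS S S' : S' \subset S -> acyclic S -> acyclic S'.
Proof.
move=> sS /forallP gS; apply/forallP => T; apply/implyP => sT.
by apply: contra (implyP (gS T) sT) => /fintype.subset_trans ->.
Qed.

Lemma acyclic_set0 : acyclic finset.set0.
Proof.
apply/forallP => T; apply/implyP => /and3P[T0 _ _].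
by rewrite finset.subset0.
Qed.

Lemma acyclic_exit S : acyclic S -> S != finset.set0 ->
  exists2 i, i \in S &
    [|| i \notin unfrozen Q, ~~ has_succ S i | ~~ has_pred S i].
Proof.
move=> /forallP/(_ S); rewrite fintype.subxx implybF => nst S0.
have [/fintype.subsetP sSU|/fintype.subsetPn[i iS iU]] :=
  boolP (S \subset unfrozen Q); last first.
  by exists i; rewrite ?iU.
have : ~~ [forall i in S, has_succ S i && has_pred S i].
  by apply: contra nst => h; rewrite /stuck S0 h andbT; apply/fintype.subsetP.
rewrite negb_forall => /existsP[i]; rewrite negb_imply negb_and => /andP[iS h].
by exists i => //; rewrite h orbT.
Qed.

Section Tropical.
Implicit Types (u v : 'I_n -> int).

Definition trop_plus u i : int :=
    \sum_(a : arrow Q | source a == i) u (target a).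
Definition trop_minus u i : int :=
    \sum_(a : arrow Q | target a == i) u (source a).
(** The exponent of the growth of p_i at x_j = q ^ u_j. *)
Definition trop u i : int :=
  if i \in unfrozen Q then Num.max (trop_plus u i) (trop_minus u i) else 0.

Lemma trop_le u v i : (forall j, u j <= v j) -> trop u i <= trop v i.
Proof.
move=> uv; rewrite /trop; case: ifP => // _.
have hp : trop_plus u i <= trop_plus v i by apply: ler_sum.
have hm : trop_minus u i <= trop_minus v i by apply: ler_sum.
by rewrite ge_max !le_max hp hm orbT.
Qed.

Lemma sum_arrow_le (p : pred (arrow Q)) (f : arrow Q -> int) (C : nat) :
  (forall a, f a <= C%:Z) -> \sum_(a | p a) f a <= (#|arrow Q| * C)%N%:Z.
Proof.
move=> fC; rewrite big_mkcond /=.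
apply: (@le_trans _ _ (\sum_(a : arrow Q) C%:Z)).
  by apply: ler_sum => a _; case: ifP.
by rewrite sumr_const -mulr_natl natz -PoszM cardT -cardE.
Qed.

Lemma trop_bound u i (C : nat) : (forall j, u j <= C%:Z) ->
  trop u i <= (#|arrow Q| * C)%N%:Z.
Proof.
move=> uC; rewrite /trop; case: ifP => // _.
by rewrite ge_max /trop_plus /trop_minus !sum_arrow_le.
Qed.

Variables (beta : 'I_n -> nat) (C : nat).
Hypothesis beta_ge : forall i, (#|arrow Q| * C <= beta i)%N.

(** Remove the vertices of S one at a time.  A vertex i that is frozen, or
    without successors in S, or without predecessors in S, has one term of
    its tropical equation determined by values outside S, and this term serves
    as g i. *)
Lemma trop_subsolution S (alpha : 'I_n -> int) : acyclic S ->
  (forall i, alpha i <= C%:Z) -> (forall i, i \in S -> 0 <= alpha i) ->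
  exists g : 'I_n -> int, [/\ forall i, g i <= alpha i,
    forall i, i \notin S -> g i = alpha i &
    forall i, i \in S -> g i <= trop g i - (beta i)%:Z].
Proof.
move: {2}#|S| (leqnn #|S|) => m; elim: m S alpha => [|m IHm] S alpha.
  rewrite leqn0 cards_eq0 => /eqP -> _ _ _.
  by exists alpha; split=> // i; rewrite inE.
move=> leS gS alphaC alpha0; have [->|S0] := eqVneq S finset.set0.
  by exists alpha; split=> // i; rewrite inE.
have [i iS exit_i] := acyclic_exit gS S0.
pose t : int := (if i \notin unfrozen Q then 0 else
  if ~~ has_succ S i then trop_plus alpha i else trop_minus alpha i) -
    (beta i)%:Z.
have t_le0 : t <= 0.
  have := beta_ge i; rewrite /t /trop_plus /trop_minus subr_le0 -lez_nat.
  by apply: le_trans; case: ifP => // _; case: ifP => _; apply: sum_arrow_le.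
pose alpha' j := if j == i then t else alpha j.
have alpha'_le j : alpha' j <= alpha j.
  rewrite /alpha'; case: eqP => [->|//]; exact: le_trans t_le0 (alpha0 i iS).
have [||j|j|g [gle goff gin]] := IHm (S :\ i)%SET alpha'.
- by move: leS; rewrite (cardsD1 i) iS.
- by apply: acyclicS gS; apply: finset.subsetDl.
- exact: le_trans (alpha'_le j) _.
- rewrite !inE /alpha' => /andP[/negPf -> jS]; exact: alpha0.
have gi : g i = t by rewrite goff ?inE ?eqxx // /alpha' eqxx.
have g_off j : j \notin S -> g j = alpha j.
  move=> jS; rewrite goff ?inE ?negb_and ?jS ?orbT // /alpha'.
  by case: eqP jS => // ->; rewrite iS.
exists g; split=> // [j|j jS]; first exact: le_trans (alpha'_le j).
have [->|nji] := eqVneq j i; last by apply: gin; rewrite !inE nji.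
rewrite gi /t lerD2r /trop; have [iU|//] := boolP (i \in unfrozen Q).
move: exit_i; rewrite iU /= le_max.
have [_ /= npred|nsucc _] := boolP (has_succ S i); apply/orP; [right|left].
  rewrite /trop_minus [X in _ <= X](eq_bigr (fun a => alpha (source a))) // => a
    /eqP ta.
  apply: g_off; apply: contra npred => sa; apply/existsP.
  by exists a; rewrite ta eqxx.
rewrite /trop_plus [X in _ <= X](eq_bigr (fun a => alpha (target a))) // => a
  /eqP sa.
apply: g_off; apply: contra nsucc => ta; apply/existsP.
by exists a; rewrite sa eqxx.
Qed.

(** The right hand side is monotone in u, and alpha is a supersolution because
    beta is large.  Iteration from alpha decreases; it is bounded below by a
    subsolution, so it becomes stationary over the integers. *)
Lemma trop_solution S (alpha : 'I_n -> nat) : acyclic S ->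
  (forall i, (alpha i <= C)%N) ->
  exists u : 'I_n -> int, [/\ forall i, u i <= (alpha i)%:Z,
    forall i, i \notin S -> u i = (alpha i)%:Z &
    forall i, i \in S -> u i = trop u i - (beta i)%:Z].
Proof.
move=> gS alphaC; pose al i : int := (alpha i)%:Z.
have alC i : al i <= C%:Z by rewrite lez_nat.
have [||g [gle goff gin]] := @trop_subsolution S al gS; [exact: alC|by []|].
pose F u i : int := if i \in S then trop u i - (beta i)%:Z else al i.
have F_le u v i : (forall j, u j <= v j) -> F u i <= F v i.
  by move=> uv; rewrite /F; case: ifP => // _; rewrite lerD2r trop_le.
have gF i : g i <= F g i.
  by rewrite /F; case: ifP => iS; [exact: gin | rewrite goff ?iS].
(* iterate F; the distance to g decreases until a fixed point is reached *)
suff h m u : (\sum_i `|u i - g i|%N <= m)%N -> (forall i, g i <= u i) ->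
    (forall i, F u i <= u i) -> (forall i, u i <= al i) ->
    exists u' : 'I_n -> int, (forall i, u' i <= al i) /\ forall i,
      u' i = F u' i.
  have [//|i|//|u [ule uF]] := h _ al (leqnn _).
  - rewrite /F; case: ifP => // _; rewrite lerBlDr.
    apply: le_trans (trop_bound _ alC) _; have := beta_ge i; rewrite /al; lia.
  exists u; split=> // i iS; rewrite {1}uF /F.
    by rewrite (negPf iS).
  by rewrite iS.
elim: m u => [|m IHm] u lem gu Fu ual.
  exists u; split=> // i; apply/le_anti; rewrite Fu andbT.
  have -> : u i = g i.
    move: lem; rewrite leqn0 sum_nat_eq0 => /forallP/(_ i)/implyP/(_ isT).
    by rewrite absz_eq0 subr_eq0 => /eqP.
  exact: le_trans (gF i) (F_le _ _ _ gu).
have [/forallP fixu|] := boolP [forall i, u i == F u i].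
  by exists u; split=> // i; apply/eqP.
rewrite negb_forall => /existsP[i neq].
apply: (IHm (F u)) => [|j|j|j]; last exact: le_trans (Fu j) (ual j).
- rewrite -ltnS; apply: leq_trans lem.
  rewrite (bigD1 i) //= [X in (_ <= X)%N](bigD1 i) //= -addSn leq_add //.
    by have := Fu i; have := gF i; have := F_le _ _ i gu; move: neq; lia.
  apply: leq_sum => j _.
  by have := Fu j; have := gF j; have := F_le _ _ j gu; lia.
- exact: le_trans (gF j) (F_le _ _ _ gu).
- exact: F_le.
Qed.

End Tropical.

End Quiver.

(** * Linear independence of the standard monomials *)

Section Specialization.
Variables (n : nat) (xi : 'I_n -> rat).

Definition mpoly_at : {rmorphism {mpoly int[n]} -> rat} := mmap intr xi.

(** Evaluation at the point xi, on the local ring of rational functions that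
    are defined there. *)
Definition specializes (z : ratfun n) (r : rat) : Prop := exists p e,
  [/\ mpoly_at e != 0, z * tofrac e = tofrac p & r * mpoly_at e = mpoly_at p].

Lemma specializes_poly p : specializes (tofrac p) (mpoly_at p).
Proof. by exists p, 1; rewrite !rmorph1 !mulr1 oner_eq0. Qed.

Lemma specializes_var i : specializes (var i) (xi i).
Proof.
have <- : mpoly_at 'X_i = xi i by rewrite /mpoly_at /= mmapX mmap1U.
exact: specializes_poly.
Qed.

Lemma specializes_int k : specializes k%:~R k%:~R.
Proof. by have := specializes_poly k%:~R; rewrite !rmorph_int. Qed.

Lemma specializesD z w r s :
  specializes z r -> specializes w s -> specializes (z + w) (r + s).
Proof.
move=> [p [e [e0 ze re]]] [p' [e' [e0' we' se']]].
exists (p * e' + p' * e), (e * e'); split.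
- by rewrite rmorphM mulf_neq0.
- by rewrite tofracD !tofracM -ze -we'; ring.
- by rewrite rmorphD !rmorphM /= -re -se'; ring.
Qed.

Lemma specializesM z w r s :
  specializes z r -> specializes w s -> specializes (z * w) (r * s).
Proof.
move=> [p [e [e0 ze re]]] [p' [e' [e0' we' se']]].
exists (p * p'), (e * e'); split.
- by rewrite rmorphM mulf_neq0.
- by rewrite !tofracM -ze -we'; ring.
- by rewrite !rmorphM /= -re -se'; ring.
Qed.

Lemma specializesV z r : r != 0 -> specializes z r -> specializes z^-1 r^-1.
Proof.
move=> r0 [p [e [e0 ze re]]];
  have p0 : mpoly_at p != 0 by rewrite -re mulf_neq0.
have z0 : z != 0.
  apply: contraNneq p0 => z0; move/eqP: ze; rewrite z0 mul0r eq_sym tofrac_eq0.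
  by move=> /eqP ->; rewrite rmorph0.
exists e, p; split=> //; first by rewrite -ze mulKf.
by rewrite -re mulKf.
Qed.

Lemma specializes_sum (J : Type) (s : seq J) (p : pred J) F G :
  (forall j, p j -> specializes (F j) (G j)) ->
  specializes (\sum_(j <- s | p j) F j) (\sum_(j <- s | p j) G j).
Proof.
move=> FG; apply: (big_ind2 specializes) => // [|*]; last exact: specializesD.
exact: (specializes_int 0).
Qed.

Lemma specializes_prod (J : Type) (s : seq J) (p : pred J) F G :
  (forall j, p j -> specializes (F j) (G j)) ->
  specializes (\prod_(j <- s | p j) F j) (\prod_(j <- s | p j) G j).
Proof.
move=> FG; apply: (big_ind2 specializes) => // [|*]; last exact: specializesM.
exact: (specializes_int 1).
Qed.

Lemma specializesX z r k : specializes z r -> specializes (z ^+ k) (r ^+ k).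
Proof.
move=> zr; elim: k => [|k IHk]; first exact: (specializes_int 1).
by rewrite !exprS; apply: specializesM.
Qed.

Lemma specializes0 r : specializes 0 r -> r = 0.
Proof.
move=> [p [e [e0 ze re]]]; move/eqP: ze.
rewrite mul0r eq_sym tofrac_eq0 => /eqP p0.
by move/eqP: re; rewrite p0 rmorph0 mulf_eq0 (negPf e0) orbF => /eqP.
Qed.

End Specialization.

Section Independence.
Variables (n : nat) (Q : ice_quiver n).
Implicit Types (d : expo n) (i : 'I_n).

Definition rat_plus (xi : 'I_n -> rat) i :=
    \prod_(a : arrow Q | source a == i) xi (target a).
Definition rat_minus (xi : 'I_n -> rat) i :=
    \prod_(a : arrow Q | target a == i) xi (source a).

Definition rat_adjacent xi i : rat := (xi i)^-1 *
  (if i \in unfrozen Q then rat_plus xi i + rat_minus xi i else 1).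

Lemma specializes_mono xi d : (forall i, xi i != 0) ->
  specializes xi (mono (@var n) (adjacent_var Q) d)
    (mono xi (rat_adjacent xi) d).
Proof.
move=> xi0; apply: specializes_prod => i _; rewrite /emono.
case: ifP => _; apply: specializesX; first exact: specializes_var.
rewrite /adjacent_var /rat_adjacent;
  have xiV := specializesV (xi0 i) (specializes_var xi i).
case: ifP => _; last by rewrite mulr1.
apply: specializesM => //.
by apply: specializesD; apply: specializes_prod => a _; apply: specializes_var.
Qed.

Section Growth.
Variables (alpha beta : 'I_n -> nat) (u : 'I_n -> int) (q : nat)
  (S : {set 'I_n}).
Hypothesis q_gt0 : (0 < q)%N.
Hypothesis u_le : forall i, u i <= (alpha i)%:Z.
Hypothesis u_out : forall i, i \notin S -> u i = (alpha i)%:Z.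
Hypothesis u_in : forall i, i \in S -> u i = trop Q u i - (beta i)%:Z.
Hypothesis trop_beta : forall i, trop Q u i <= (beta i)%:Z.

Let qq : rat := q%:R.
Let xi i : rat := qq ^ u i.

Lemma qq_ge1 : 1 <= qq. Proof. by rewrite ler1n. Qed.
Lemma qq_neq0 : qq != 0. Proof. by rewrite pnatr_eq0 -lt0n. Qed.
Lemma qqz_gt0 z : 0 < qq ^ z. Proof. by rewrite exprz_gt0 // ltr0n. Qed.

Lemma qq_prod (p : pred (arrow Q)) (f : arrow Q -> int) :
  \prod_(a | p a) qq ^ f a = qq ^ (\sum_(a | p a) f a).
Proof.
rewrite (big_morph (fun z => qq ^ z) (id1 := 1) (op1 := *%R)) // => a b.
by rewrite expfzDr // qq_neq0.
Qed.

Lemma adjacent_bounds i :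
  qq ^ (trop Q u i - u i) <= rat_adjacent xi i <= qq ^ (trop Q u i - u i) *+ 2.
Proof.
have -> : qq ^ (trop Q u i - u i) = (xi i)^-1 * qq ^ trop Q u i.
  by rewrite expfzDr ?qq_neq0 // invr_expz mulrC.
have xiV : 0 < (xi i)^-1 by rewrite invr_gt0 qqz_gt0.
rewrite /rat_adjacent -mulrnAr !ler_pM2l //.
rewrite /trop; case: ifP => iU; last by rewrite expr0z lexx mulr2n lerDl ler01.
rewrite /rat_plus /rat_minus !qq_prod -/(trop_plus _ u i) -/(trop_minus _ u i).
set s := trop_plus _ u i; set t := trop_minus _ u i.
have hs := qqz_gt0 s; have ht := qqz_gt0 t.
have mon := ler_weXz2l qq_ge1.
apply/andP; split; last first.
  by rewrite mulr2n lerD // mon // le_max lexx ?orbT.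
by rewrite maxEle; case: ifP => _; [rewrite lerDr ltW | rewrite lerDl ltW].
Qed.

Definition genwt d : nat :=
  (\sum_i (if (0 <= d i)%R then alpha i * `|d i| else beta i * `|d i|))%N.

Lemma adjacent_upper i : rat_adjacent xi i <= 2%:R * qq ^+ beta i.
Proof.
have /andP[_ /le_trans] := adjacent_bounds i; apply.
rewrite -mulr_natl ler_pM2l // exprnP; apply: (ler_weXz2l qq_ge1).
have [iS|iS] := boolP (i \in S); first by rewrite u_in // subKr.
by have := trop_beta i; rewrite u_out //; lia.
Qed.

Lemma mono_upper d : mono xi (rat_adjacent xi) d <=
  2%:R ^+ (\sum_i `|d i|)%N * qq ^+ genwt d.
Proof.
rewrite /mono /genwt !expr_sum -big_split /=; apply: ler_prod => i _.
rewrite /emono; case: ifP => di.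
  have xi_ge0 : 0 <= xi i by apply/ltW/qqz_gt0.
  rewrite exprn_ge0 //=.
  have xi_le : xi i ^+ `|d i| <= qq ^+ (alpha i * `|d i|).
    rewrite exprM lerXn2r ?nnegrE ?exprn_ge0 ?ler0n //.
    by rewrite /xi exprnP; apply: (ler_weXz2l qq_ge1).
  apply: le_trans xi_le _; rewrite ler_peMl ?exprn_ge0 ?ler0n //.
  by rewrite exprn_ege1 // ler1n.
have eta0 : 0 <= rat_adjacent xi i.
  by have /andP[h _] := adjacent_bounds i; apply: le_trans h;
    rewrite ltW ?qqz_gt0.
rewrite exprn_ge0 //= exprM -exprMn lerXn2r ?nnegrE ?adjacent_upper //.
by rewrite mulr_ge0 ?exprn_ge0 ?ler0n.
Qed.

Lemma mono_lower d : neg_set d = S ->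
    qq ^+ genwt d <= mono xi (rat_adjacent xi) d.
Proof.
move=> dS; rewrite /mono /genwt expr_sum; apply: ler_prod => i _.
rewrite exprn_ge0 ?ler0n //= /emono; case: ifP => di; rewrite exprM.
  by rewrite /xi u_out // -dS inE -leNgt.
have iS : i \in S by rewrite -dS inE ltNge di.
have eta_ge : qq ^+ beta i <= rat_adjacent xi i.
  have /andP[+ _] := adjacent_bounds i; apply: le_trans.
  by rewrite u_in // subKr.
rewrite lerXn2r ?nnegrE ?exprn_ge0 ?ler0n //.
by apply: le_trans eta_ge; rewrite exprn_ge0 ?ler0n.
Qed.

End Growth.

(** With alpha i = B ^ i and beta i = B ^ (n + i) the base B digits of the weight
    are the exponents of the x_i followed by those of the y_i. *)
Definition digit d (j : 'I_(n + n)) : nat :=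
  match split j with
  | inl i => if (0 <= d i)%R then `|d i|%N else 0%N
  | inr i => if (0 <= d i)%R then 0%N else `|d i|%N
  end.

Lemma digit_inj d d' : digit d =1 digit d' -> d = d'.
Proof.
move=> e; apply/ffunP => i.
have := e (lshift n i); have := e (rshift n i).
rewrite /digit (unsplitK (inl i)) (unsplitK (inr i)).
by case: ifP; case: ifP; lia.
Qed.

Lemma genwt_digits B d :
  genwt (fun i => B ^ i)%N (fun i => B ^ (n + i))%N d
    = (\sum_j digit d j * B ^ j)%N.
Proof.
rewrite big_split_ord /= -big_split; apply: eq_bigr => i _ /=.
rewrite /digit (unsplitK (inl i)) (unsplitK (inr i)).
by case: ifP => _; rewrite mul0n ?addn0 ?add0n mulnC.
Qed.

Lemma genwt_inj B d d' : (forall i, `|d i| < B)%N ->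
    (forall i, `|d' i| < B)%N ->
  genwt (fun i => B ^ i)%N (fun i => B ^ (n + i))%N d =
  genwt (fun i => B ^ i)%N (fun i => B ^ (n + i))%N d' -> d = d'.
Proof.
move=> ltd ltd'; rewrite !genwt_digits => /digits_inj e; apply/digit_inj/e.
  move=> j; rewrite /digit; case: split => i; case: ifP => _ //;
    exact: leq_ltn_trans (ltd i).
move=> j; rewrite /digit; case: split => i; case: ifP => _ //;
  exact: leq_ltn_trans (ltd' i).
Qed.

(** Among the exponents of the relation with nonzero coefficient, one dominates
    for generic weights; the relation at x_i = q ^ u_i contradicts this when q
    exceeds a bound on the contributions of the others. *)
Lemma mono_free (k : expo n -> int) :
  expansion intr (fun d => acyclic Q (neg_set d))
    (mono (@var n) (adjacent_var Q)) 0 k ->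
  forall d, k d = 0.
Proof.
move=> [s [us ss ks e0]] d0; apply/eqP/negPn/negP => kd0.
(* B exceeds every exponent, so that weights separate exponents, and the number
   of arrows, so that beta is large enough for the tropical equations *)
pose B := (#|arrow Q| + \max_(d <- s) \max_i `|d i|).+1%N.
have ltB d : d \in s -> forall i, (`|d i| < B)%N.
  move=> ds i; rewrite ltnS; apply: leq_trans (leq_addl _ _).
  rewrite (big_rem d ds) /=; apply: leq_trans (leq_maxl _ _).
  exact: (leq_bigmax i).
pose alpha (i : 'I_n) := (B ^ i)%N; pose beta (i : 'I_n) := (B ^ (n + i))%N.
pose C := (B ^ n.-1)%N.
have B_gt0 : (0 < B)%N by [].
have alphaC i : (alpha i <= C)%N.
  by rewrite leq_pexp2l // -ltnS (ltn_predK (ltn_ord i)).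
have betaC i : (#|arrow Q| * C <= beta i)%N.
  apply: (@leq_trans (B * C));
    first by rewrite leq_mul2r ltnW ?orbT // ltnS leq_addr.
  rewrite /C -expnS (ltn_predK (ltn_ord i)) leq_pexp2l //; exact: leq_addr.
pose s' := [seq d <- s | k d != 0].
have [|d ds' maxd] := @seq_argmax _ (genwt alpha beta) s'.
  by apply: contraTneq (ks _ kd0) => s'0;
    have := mem_filter (fun d => k d != 0) d0 s;
    rewrite -/s' s'0 kd0 /= => <-.
move: ds'; rewrite mem_filter => /andP[kd ds].
have [u [u_le u_out u_in]] := trop_solution betaC (ss d ds) alphaC.
have trop_beta i : trop Q u i <= (beta i)%:Z.
  have uC j : u j <= C%:Z by apply: le_trans (u_le j) _; rewrite lez_nat.
  by apply: le_trans (trop_bound Q i uC) _; rewrite lez_nat.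
pose M (e : expo n) := (2 ^ \sum_i `|e i|)%N.
(* M e absorbs the factors 2 of the bounds on the adjacent variables *)
pose q := (\sum_(e <- s) `|k e| * M e).+1%N.
pose qq : rat := q%:R; pose xi i := qq ^ u i.
have xi0 i : xi i != 0 by rewrite lt0r_neq0 // exprz_gt0 // ltr0n.
have rel : \sum_(e <- s) (k e)%:~R * mono xi (rat_adjacent xi) e = 0 :> rat.
  apply: (@specializes0 n xi); rewrite [X in specializes _ X]e0.
  apply: specializes_sum => e _; apply: specializesM;
    first exact: specializes_int.
  exact: specializes_mono.
have wlt e : e \in s -> k e != 0 -> e != d ->
  (genwt alpha beta e < genwt alpha beta d)%N.
  move=> es ke ned; rewrite ltn_neqAle maxd ?mem_filter ?ke // andbT.
  apply: contraNneq ned => /(genwt_inj (ltB e es) (ltB d ds)) ->.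
  by [].
set w := genwt alpha beta d.
have q_gt0 : (0 < q)%N by [].
have lower : qq ^+ w <= mono xi (rat_adjacent xi) d.
  exact: (mono_lower q_gt0 u_out u_in (erefl _)).
have upper e : mono xi (rat_adjacent xi) e
  <= (M e)%:R * qq ^+ genwt alpha beta e.
  rewrite /M natrX; exact: (mono_upper q_gt0 u_le u_out u_in trop_beta).
have pos e : 0 <= mono xi (rat_adjacent xi) e.
  have xi_ge0 i : 0 <= xi i by rewrite exprz_ge0 // ler0n.
  apply: prodr_ge0 => i _; rewrite /emono; case: ifP => _; rewrite exprn_ge0 //.
  rewrite /rat_adjacent mulr_ge0 ?invr_ge0 //; case: ifP => _ //.
  by rewrite addr_ge0 // prodr_ge0.
have : qq ^+ w.+1 <= (\sum_(e <- s) `|k e| * M e)%N%:R * qq ^+ w.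
  have kd1 : 1 <= `|(k d)%:~R| :> rat by rewrite -intr_norm ler1z; lia.
  apply: (@le_trans _ _ (qq * `|(k d)%:~R * mono xi (rat_adjacent xi) d|)).
    rewrite exprS ler_wpM2l ?ler0n // normrM (ger0_norm (pos d)).
    by rewrite (le_trans lower) // ler_peMl.
  have /eqP := rel; rewrite (bigD1_seq d) //= addr_eq0 => /eqP ->.
  rewrite normrN natr_sum mulr_suml
    (bigD1_seq d) //= -[X in X <= _]add0r lerD //.
    by rewrite mulr_ge0 ?exprn_ge0 ?ler0n.
  apply: (@le_trans _ _
    (qq * \sum_(e <- s | e != d) `|(k e)%:~R * mono xi (rat_adjacent xi) e|)).
    by rewrite ler_wpM2l ?ler0n // ler_norm_sum.
  rewrite mulr_sumr big_seq_cond [X in _ <= X]big_seq_cond;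
    apply: ler_sum => e /andP[es ned].
  have [->|ke] := eqVneq (k e) 0;
    first by rewrite mul0r normr0 mulr0 absz0 mul0n mul0r.
  rewrite normrM (ger0_norm (pos e)) natrM mulrCA -intr_norm -mulrA.
  have -> : (`|k e|%:~R : rat) = `|k e|%N%:R by rewrite -abszE.
  rewrite ler_wpM2l ?ler0n //.
  apply: (@le_trans _ _ (qq * ((M e)%:R * qq ^+ genwt alpha beta e))).
    by rewrite ler_wpM2l ?ler0n.
  rewrite mulrCA -exprS ler_wpM2l ?ler0n // ler_weXn2l ?ler1n //.
  exact: wlt.
rewrite exprS ler_pM2r ?exprn_gt0 ?ltr0n // ler_nat.
by rewrite ltnn.
Qed.

End Independence.

(** * The standard monomials span the lower bound algebra *)

Section AdditiveSpan.
Variable V : zmodType.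

Inductive zspan (G : V -> Prop) : V -> Prop :=
  | zspan0 : zspan G 0
  | zspanB u v : zspan G u -> zspan G v -> zspan G (u - v)
  | zspan_gen g : G g -> zspan G g.

Variables (G : V -> Prop).

Lemma zspanN u : zspan G u -> zspan G (- u).
Proof. by move=> h; rewrite -sub0r; apply: zspanB => //; apply: zspan0. Qed.

Lemma zspanD u v : zspan G u -> zspan G v -> zspan G (u + v).
Proof. by move=> hu hv; rewrite -[v]opprK; apply: zspanB => //;
  apply: zspanN. Qed.

Lemma zspan_sum (J : Type) (s : seq J) (p : pred J) (F : J -> V) :
  (forall j, p j -> zspan G (F j)) -> zspan G (\sum_(j <- s | p j) F j).
Proof.
move=> GF; apply: (big_ind (zspan G)) => //; first exact: zspan0.
exact: zspanD.
Qed.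

Lemma zspan_sub (H : V -> Prop) u : (forall g, G g -> zspan H g) ->
  zspan G u -> zspan H u.
Proof.
by move=> GH; elim=> [|v w _ hv _ hw|g /GH //]; [exact: zspan0 | exact: zspanB].
Qed.

End AdditiveSpan.

Lemma zspanM (A : comPzRingType) (G H L : A -> Prop) u v :
  (forall g h, G g -> H h -> zspan L (g * h)) ->
  zspan G u -> zspan H v -> zspan L (u * v).
Proof.
move=> GHL Gu; elim=> [|w t _ hw _ ht|h Hh]; first by rewrite mulr0;
  apply: zspan0.
  by rewrite mulrBr; apply: zspanB.
elim: Gu => [|w t _ hw _ ht|g Gg]; first by rewrite mul0r; apply: zspan0.
  by rewrite mulrBl; apply: zspanB.
exact: GHL.
Qed.

Section Spanning.
Variables (n : nat) (Q : ice_quiver n).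
Local Notation X := (@var n).
Local Notation Y := (adjacent_var Q).
Local Notation N := #|arrow Q|.
Local Notation D := #|arrow Q|.+1.
Implicit Types (i j : 'I_n) (T : {set 'I_n}) (b e : 'I_n -> nat) (d : expo n).

Definition bimono b e : ratfun n := \prod_i (Y i ^+ b i * X i ^+ e i).

Definition biwt b e : nat := (\sum_i (D * b i + e i))%N.

Lemma bimonoD b b' e e' :
    bimono (fun i => b i + b' i)%N (fun i => e i + e' i)%N =
  bimono b e * bimono b' e'.
Proof.
by rewrite /bimono -big_split; apply: eq_bigr => i _; rewrite /= !exprD mulrACA.
Qed.

Lemma biwtD b b' e e' : biwt (fun i => b i + b' i)%N (fun i => e i + e' i)%N =
  (biwt b e + biwt b' e')%N.
Proof.
by rewrite /biwt -big_split; apply: eq_bigr => i _; rewrite /= mulnDr addnACA.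
Qed.

Definition pfil (r : nat) : ratfun n -> Prop :=
  zspan (fun z => exists b e, (biwt b e <= r)%N /\ z = bimono b e).

Lemma pfil_leq r s z : (r <= s)%N -> pfil r z -> pfil s z.
Proof.
move=> lers; apply: zspan_sub => g [b [e [le_r ->]]].
by apply: zspan_gen; exists b, e; split=> //; apply: leq_trans lers.
Qed.

Lemma pfilM r s z w : pfil r z -> pfil s w -> pfil (r + s) (z * w).
Proof.
apply: zspanM => g h [b [e [le_r ->]]] [b' [e' [le_s ->]]].
apply: zspan_gen; exists (fun i => b i + b' i)%N, (fun i => e i + e' i)%N.
by rewrite biwtD bimonoD leq_add.
Qed.

Lemma pfil_bimono b e : pfil (biwt b e) (bimono b e).
Proof. by apply: zspan_gen; exists b, e. Qed.

Lemma pfil1 : pfil 0 1.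
Proof.
have -> : 1 = bimono (fun=> 0%N) (fun=> 0%N).
  by rewrite /bimono big1 // => i _; rewrite !expr0 mulr1.
by apply: pfil_leq (pfil_bimono _ _); rewrite /biwt big1 // => i _;
  rewrite muln0.
Qed.

Lemma pfil_var i : pfil 1 (X i).
Proof.
have -> : X i = bimono (fun=> 0%N) (fun j => (j == i)%N).
  rewrite /bimono (bigD1 i) //= big1 ?mulr1 => [|j /negPf ->].
    by rewrite eqxx /= ?expr0 mul1r ?expr1.
  by rewrite /= ?expr0 mulr1.
apply: pfil_leq (pfil_bimono _ _);
  rewrite /biwt (bigD1 i) //= big1 => [|j /negPf ->].
  by rewrite eqxx muln0.
by rewrite muln0.
Qed.

Lemma pfil_adj i : pfil D (Y i).
Proof.
have -> : Y i = bimono (fun j => (j == i)%N) (fun=> 0%N).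
  rewrite /bimono (bigD1 i) //= big1 ?mulr1 => [|j /negPf ->].
    by rewrite eqxx.
  by rewrite /= ?expr0 ?mulr1.
apply: pfil_leq (pfil_bimono _ _);
  rewrite /biwt (bigD1 i) //= big1 => [|j /negPf ->].
  by rewrite eqxx muln1 ?addn0.
by rewrite muln0.
Qed.

Lemma pfil_prod (J : finType) (p : pred J) (F : J -> ratfun n) (r : J -> nat) :
  (forall a, p a -> pfil (r a) (F a)) ->
  pfil (\sum_(a | p a) r a)%N (\prod_(a | p a) F a).
Proof.
move=> rF; apply: (big_ind2 (fun w z => pfil w z)) => //; first exact: pfil1.
by move=> *; apply: pfilM.
Qed.

Lemma pfil_prod_var (p : pred (arrow Q)) (f : arrow Q -> 'I_n) :
  pfil N (\prod_(a | p a) X (f a)).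
Proof.
have h : pfil (\sum_(a | p a) 1)%N (\prod_(a | p a) X (f a)).
  by apply: pfil_prod => a _; apply: pfil_var.
by apply: pfil_leq h; rewrite sum1_card max_card.
Qed.

Definition exchange i : ratfun n :=
  if i \in unfrozen Q then p_plus Q i + p_minus Q i else 1.

Lemma var_neq0 i : X i != 0.
Proof.
rewrite /var tofrac_eq0; apply/eqP => /(congr1 (meval (fun=> 1))).
by rewrite mevalXU meval0 => /eqP; rewrite oner_eq0.
Qed.

Lemma var_adj i : X i * Y i = exchange i.
Proof.
by rewrite /adjacent_var /exchange; case: ifP => _;
  rewrite ?mulVKf ?mulfV ?var_neq0.
Qed.

Lemma pfil_exchange i : pfil N (exchange i).
Proof.
rewrite /exchange; case: ifP => _; last exact: pfil_leq pfil1.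
by apply: zspanD; apply: pfil_prod_var.
Qed.

Lemma stuck_succ T i : stuck Q T -> i \in T -> exists s C,
  [/\ s \in T, s != i, pfil N C & p_plus Q i = X s * C].
Proof.
move=> /and3P[_ _ /forallP/(_ i)/implyP h] /h
  /andP[/existsP[a /andP[/eqP sa ta]] _].
exists (target a), (\prod_(a' | (source a' == i) && (a' != a)) X (target a')).
split=> //; first by apply/eqP => e; apply: (@no_loop _ Q a); rewrite sa e.
  exact: pfil_prod_var.
by rewrite /p_plus (bigD1 a) ?sa.
Qed.

Lemma stuck_pred T i : stuck Q T -> i \in T -> exists s C,
  [/\ s \in T, s != i, pfil N C & p_minus Q i = X s * C].
Proof.
move=> /and3P[_ _ /forallP/(_ i)/implyP h] /h
  /andP[_ /existsP[a /andP[/eqP ta sa]]].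
exists (source a), (\prod_(a' | (target a' == i) && (a' != a)) X (source a')).
split=> //; first by apply/eqP => e; apply: (@no_loop _ Q a); rewrite ta e.
  exact: pfil_prod_var.
by rewrite /p_minus (bigD1 a) ?ta.
Qed.

(** Row i in T expresses x_i * y_i = p_i^+ + p_i^-, where a variable x_s, resp.
    x_r, with s, r in T has been factored out of p_i^+, resp. p_i^-.  These rows
    annihilate the vector with entries x_j for j in T and 0 elsewhere; identity
    rows outside T avoid indexing a matrix by T. *)
Lemma stuck_matrix T : stuck Q T -> exists M : 'M[ratfun n]_n, [/\ \det M = 0,
  forall i, i \notin T -> forall j, M i j = (i == j)%:R,
  forall i, i \in T -> M i i = Y i &
  forall i j, i \in T -> i != j -> pfil N (M i j)].
Proof.
move=> sT; have /and3P[T0 TU _] := sT.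
have /choice[s hs] (i : 'I_n) : exists sC : 'I_n * ratfun n, i \in T ->
    [/\ sC.1 \in T, sC.1 != i, pfil N sC.2 & p_plus Q i = X sC.1 * sC.2].
  have [iT|] := boolP (i \in T); last by exists (i, 0).
  by have [s [C h]] := stuck_succ sT iT; exists (s, C).
have /choice[r hr] (i : 'I_n) : exists sC : 'I_n * ratfun n, i \in T ->
    [/\ sC.1 \in T, sC.1 != i, pfil N sC.2 & p_minus Q i = X sC.1 * sC.2].
  have [iT|] := boolP (i \in T); last by exists (i, 0).
  by have [s' [C h]] := stuck_pred sT iT; exists (s', C).
pose M : 'M[ratfun n]_n := \matrix_(i, j) (if i \in T then
   (i == j)%:R * Y i - ((s i).1 == j)%:R * (s i).2 - ((r i).1 == j)%:R * (r i).2
   else (i == j)%:R).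
exists M; split.
- rewrite -det_tr; apply/eqP/det0P.
  exists (\row_j (if j \in T then X j else 0)).
    have /set0Pn[i iT] := T0; apply/eqP => /matrixP/(_ ord0 i)/eqP.
    by rewrite !mxE iT (negPf (var_neq0 i)).
  have delta (k : 'I_n) (F : 'I_n -> ratfun n) :
    \sum_j (if j \in T then X j else 0) * ((k == j)%:R * F j) =
      (if k \in T then X k else 0) * F k.
    rewrite (bigD1 k) //= eqxx mul1r big1 ?addr0 // => j njk.
    by rewrite eq_sym (negPf njk) mul0r mulr0.
  apply/rowP => i; rewrite [RHS]mxE [LHS]mxE.
  under eq_bigr do rewrite !mxE.
  case iT: (i \in T); last first.
    transitivity (\sum_j (if j \in T then X j else 0) * ((i == j)%:R * 1)).
      by apply: eq_bigr => j _; rewrite mulr1.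
    by rewrite (delta i (fun=> 1)) iT mul0r.
  have [sT1 _ _ es] := hs i iT; have [rT1 _ _ er] := hr i iT.
  under eq_bigr do rewrite !mulrBr.
  rewrite !sumrB !delta iT sT1 rT1 -es -er var_adj /exchange.
  by rewrite (fintype.subsetP TU _ iT) addrAC addrK subrr.
- by move=> i iT j; rewrite mxE (negPf iT).
- move=> i iT; rewrite mxE iT eqxx mul1r.
  have [_ /negPf -> _ _] := hs i iT; have [_ /negPf -> _ _] := hr i iT.
  by rewrite !mul0r !subr0.
- move=> i j iT /negPf nij; rewrite mxE iT nij mul0r.
  have [_ _ fs _] := hs i iT; have [_ _ fr _] := hr i iT.
  have f0 (k : bool) z : pfil N z -> pfil N (k%:R * z).
    by case: k => hz; rewrite ?mul1r ?mul0r //; apply: zspan0.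
  by apply: zspanB; [apply: zspanB; [exact: zspan0|exact: f0]|exact: f0].
Qed.

(** In the expansion of the determinant, the identity contributes the product of
    the y_i, and every other permutation loses at least one y_i. *)
Lemma stuck_reduces T : stuck Q T -> pfil (D * #|T|).-1 (\prod_(i in T) Y i).
Proof.
move=> sT; have /and3P[T0 TU _] := sT.
have [M [detM Mout Mdiag Moff]] := stuck_matrix sT.
have -> : \prod_(i in T) Y i = \prod_i M i i.
  rewrite [RHS](bigID (mem T)) /= [X in _ * X]big1 ?mulr1.
    by apply: eq_bigr => i /Mdiag.
  by move=> i /Mout ->; rewrite eqxx.
have -> : \prod_i M i i
  = - \sum_(p : 'S_n | p != 1%g) (-1) ^+ p * \prod_i M i (p i).
  apply/eqP; rewrite -addr_eq0 -[X in _ == X]detM /determinant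
    [X in _ == X](bigD1 1%g) //=.
  rewrite odd_perm1 expr0 mul1r.
  by apply/eqP; congr (_ + _); apply: eq_bigr => i _; rewrite perm1.
apply: zspanN; apply: zspan_sum => p np.
have sgn z : pfil (D * #|T|).-1 z -> pfil (D * #|T|).-1 ((-1) ^+ p * z).
  by move=> hz; case: (odd_perm p); rewrite ?expr1 ?expr0 ?mulN1r ?mul1r //;
    apply: zspanN.
apply: sgn.
have [/forallP pT|] := boolP [forall i, (i \in T) ==> (p i == i)].
  have [i pi] : exists i, p i != i.
    apply/existsP; rewrite -negb_forall; apply: contra np => /forallP h.
    by apply/eqP/permP => i; rewrite perm1; apply/eqP.
  rewrite (bigD1 i) //= Mout; last by apply: contra pi => iT;
    apply: (implyP (pT i)).
  by rewrite eq_sym (negPf pi) mul0r; apply: zspan0.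
rewrite negb_forall => /existsP[i]; rewrite negb_imply => /andP[iT pi].
pose w j : nat := if j \in T then if p j == j then D else N else 0%N.
have h : pfil (\sum_j w j)%N (\prod_j M j (p j)).
  apply: pfil_prod => j _; rewrite /w; case: ifP => jT; last first.
    rewrite Mout ?jT //; case: (_ == _); [exact: pfil1 | exact: zspan0].
  case: eqP => [->|/eqP pj]; first by rewrite Mdiag //; apply: pfil_adj.
  by apply: Moff => //; rewrite eq_sym.
apply: pfil_leq h; rewrite (bigD1 i) //= {1}/w iT (negPf pi).
have le_rest : (\sum_(j | j != i) w j <= #|(T :\ i)%SET| * D)%N.
  rewrite -sum_nat_const big_mkcond [X in (_ <= X)%N]big_mkcond.
  apply: leq_sum => j _; rewrite !inE /w; case: (j == i) => //=.
  by case: (j \in T) => //; case: ifP.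
rewrite (cardsD1 i T) iT mulnDr muln1 addSn /= leq_add2l mulnC.
exact: le_rest.
Qed.

End Spanning.

Section Straightening.
Variables (n : nat) (Q : ice_quiver n).
Local Notation X := (@var n).
Local Notation Y := (adjacent_var Q).
Local Notation N := #|arrow Q|.
Local Notation D := #|arrow Q|.+1.
Implicit Types (i j : 'I_n) (T : {set 'I_n}) (b e : 'I_n -> nat) (d : expo n).

Definition bsupp b : {set 'I_n} := [set i | (0 < b i)%N]%SET.

Lemma eq_bimono b b' e e' : b =1 b' -> e =1 e' -> bimono Q b e = bimono Q b' e'.
Proof. by move=> eb ee; apply: eq_bigr => i _; rewrite eb ee. Qed.

Lemma eq_biwt b b' e e' : b =1 b' -> e =1 e' -> biwt Q b e = biwt Q b' e'.
Proof. by move=> eb ee; apply: eq_bigr => i _; rewrite eb ee. Qed.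

(** A monomial can be rewritten as soon as one of its factors can. *)
Lemma bimono_factor b b' e e' : (forall i, b' i <= b i)%N ->
  (forall i, e' i <= e i)%N -> (0 < biwt Q b' e')%N ->
  pfil Q (biwt Q b' e').-1 (bimono Q b' e') ->
  (0 < biwt Q b e)%N /\ pfil Q (biwt Q b e).-1 (bimono Q b e).
Proof.
move=> leb lee w_gt0 fb.
pose b'' i := (b i - b' i)%N; pose e'' i := (e i - e' i)%N.
have eb : b =1 (fun i => b' i + b'' i)%N by move=> i; rewrite subnKC.
have ee : e =1 (fun i => e' i + e'' i)%N by move=> i; rewrite subnKC.
rewrite (eq_biwt eb ee) (eq_bimono eb ee) biwtD bimonoD.
split; first by rewrite addn_gt0 w_gt0.
have -> : (biwt Q b' e' + biwt Q b'' e'').-1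
  = ((biwt Q b' e').-1 + biwt Q b'' e'')%N.
  by rewrite -[in LHS](prednK w_gt0) addSn.
exact: pfilM fb (pfil_bimono _ _ _).
Qed.

Lemma bimono_reduces b e :
  (exists2 i, (0 < b i)%N & (0 < e i)%N) \/ ~~ acyclic Q (bsupp b) ->
  (0 < biwt Q b e)%N /\ pfil Q (biwt Q b e).-1 (bimono Q b e).
Proof.
move=> [[i bi ei]|].
  pose dl j := nat_of_bool (j == i).
  have wE : biwt Q dl dl = D.+1.
    rewrite /biwt (bigD1 i) //= big1 => [|j /negPf nji].
      by rewrite /dl eqxx muln1 addn0 addn1.
    by rewrite /dl nji muln0.
  apply: (@bimono_factor _ dl _ dl); rewrite ?wE //=.
  - by move=> j; rewrite /dl; case: eqP => // ->.
  - by move=> j; rewrite /dl; case: eqP => // ->.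
  have -> : bimono Q dl dl = exchange Q i.
    rewrite -var_adj /bimono (bigD1 i) //= big1 => [|j /negPf nji].
      by rewrite /dl eqxx !expr1 mulr1 mulrC.
    by rewrite /dl nji !expr0 mulr1.
  exact: pfil_leq (pfil_exchange _ _).
rewrite /acyclic negb_forall => /existsP[T];
  rewrite negb_imply negbK => /andP[sT TS].
have /and3P[T0 _ _] := sT.
pose dl j := nat_of_bool (j \in T).
have wE : biwt Q dl (fun=> 0%N) = (D * #|T|)%N.
  rewrite /biwt -sum1_card big_distrr [RHS]big_mkcond; apply: eq_bigr => j _.
  by rewrite addn0 /dl /=; case: (j \in T); rewrite ?muln0.
apply: (@bimono_factor _ dl _ (fun=> 0%N)); rewrite ?wE //.
- move=> j; rewrite /dl; have [/(fintype.subsetP TS)|//] := boolP (j \in T).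
  by rewrite inE.
- by rewrite muln_gt0 /= card_gt0.
have -> : bimono Q dl (fun=> 0%N) = \prod_(j in T) Y j.
  rewrite /bimono [RHS]big_mkcond; apply: eq_bigr => j _.
  by rewrite expr0 mulr1 /dl; case: (j \in T); rewrite ?expr0 ?expr1.
exact: stuck_reduces.
Qed.

Definition sfil (r : nat) : ratfun n -> Prop :=
  zspan (fun z => exists d,
    [/\ acyclic Q (neg_set d), (wt D d <= r)%N & z = mono X Y d]).

Lemma sfil_leq r s z : (r <= s)%N -> sfil r z -> sfil s z.
Proof.
move=> lers; apply: zspan_sub => g [d [gd le_r ->]].
by apply: zspan_gen; exists d; split=> //; apply: leq_trans lers.
Qed.

(** Rewriting a monomial that is not standard lowers the weight, so it
    terminates. *)
Lemma pfil_sfil r z : pfil Q r z -> sfil r z.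
Proof.
have [s] := ubnP r; elim: s r z => // s IHs r z lers.
apply: zspan_sub => _ [b [e [le_r ->]]].
have [red|nred] := pselect
    ((exists2 i, (0 < b i)%N & (0 < e i)%N) \/ ~~ acyclic Q (bsupp b)).
  have [w_gt0 fw] := bimono_reduces red.
  apply: (@sfil_leq (biwt Q b e).-1).
    by apply: leq_trans le_r; apply: leq_pred.
  by apply: IHs => //; rewrite prednK //; apply: leq_trans le_r _;
    rewrite -ltnS.
have gb : acyclic Q (bsupp b) by apply/negPn/negP => h; apply: nred; right.
pose d : expo n := [ffun i => if (0 < b i)%N then - (b i)%:Z else (e i)%:Z].
have e0 i : (0 < b i)%N -> e i = 0%N.
  by move=> bi; apply/eqP; rewrite -leqn0 leqNgt; apply/negP => ei; apply: nred;
    left; exists i.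
apply: zspan_gen; exists d; split.
- rewrite (_ : neg_set d = bsupp b) //; apply/setP => i; rewrite !inE ffunE.
  by case: posnP => bi; lia.
- apply: leq_trans le_r; apply: leq_sum => i _; rewrite /ewt ffunE.
  case: posnP => [->|bi]; first by rewrite muln0.
  rewrite ifF; last lia.
  by rewrite abszN; apply: leq_addr.
- apply: eq_bigr => i _; rewrite /emono ffunE.
  case: posnP => [->|bi]; first by rewrite expr0 mul1r.
  rewrite ifF; last lia.
  by rewrite abszN e0 // expr0 mulr1.
Qed.

Definition npart d i : nat := if (0 <= d i)%R then 0%N else `|d i|%N.
Definition ppart d i : nat := if (0 <= d i)%R then `|d i|%N else 0%N.

Lemma mono_bimono d : mono X Y d = bimono Q (npart d) (ppart d).
Proof.
apply: eq_bigr => i _; rewrite /emono /npart /ppart.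
by case: ifP => _; rewrite expr0 ?mul1r ?mulr1.
Qed.

Lemma wt_biwt d : wt D d = biwt Q (npart d) (ppart d).
Proof.
apply: eq_bigr => i _; rewrite /ewt /npart /ppart.
by case: ifP => _; rewrite ?muln0 ?addn0.
Qed.

Lemma sfil_x d i : d i < 0 -> sfil (wt D d) (X i * mono X Y d).
Proof.
move=> di; pose dl j := nat_of_bool (j == i).
have [w_gt0 fw] : (0 < biwt Q (npart d) (fun j => dl j + ppart d j)%N)%N /\
   pfil Q (biwt Q (npart d) (fun j => dl j + ppart d j)%N).-1
     (bimono Q (npart d) (fun j => dl j + ppart d j)%N).
  apply: bimono_reduces; left; exists i; last by rewrite /dl eqxx.
  by rewrite /npart ifF; lia.
apply: pfil_sfil.
have wE : biwt Q (npart d) (fun j => dl j + ppart d j)%N = (wt D d).+1.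
  rewrite (@eq_biwt _ (fun j => 0 + npart d j)%N _
    (fun j => dl j + ppart d j)%N) //.
  rewrite biwtD -wt_biwt -[(wt D d).+1]add1n; congr (_ + _)%N.
  rewrite /biwt (bigD1 i) //= big1 => [|j /negPf nji];
    first by rewrite /dl eqxx muln0.
  by rewrite /dl nji muln0.
rewrite wE /= in fw; congr (pfil _ _ _): fw.
rewrite (@eq_bimono _ (fun j => 0 + npart d j)%N _
  (fun j => dl j + ppart d j)%N) //.
rewrite bimonoD -mono_bimono; congr (_ * _).
rewrite /bimono (bigD1 i) //= big1 => [|j /negPf nji].
  by rewrite /dl eqxx expr0 mul1r mulr1 expr1.
by rewrite /dl nji !expr0 mulr1.
Qed.

Lemma sfil_y d i : 0 < d i \/ ~~ acyclic Q (i |: neg_set d)%SET ->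
  sfil (wt D d + D).-1 (Y i * mono X Y d).
Proof.
move=> hd; pose dl j := nat_of_bool (j == i).
have [w_gt0 fw] : (0 < biwt Q (fun j => dl j + npart d j)%N (ppart d))%N /\
   pfil Q (biwt Q (fun j => dl j + npart d j)%N (ppart d)).-1
     (bimono Q (fun j => dl j + npart d j)%N (ppart d)).
  apply: bimono_reduces; case: hd => [di|ng]; [left|right].
    by exists i; rewrite /dl ?eqxx // /ppart ifT; lia.
  rewrite (_ : bsupp _ = (i |: neg_set d)%SET) //; apply/setP => j;
    rewrite !inE /dl /npart.
  by case: (j == i) => //=; case: ifP; lia.
apply: pfil_sfil.
have wE : biwt Q (fun j => dl j + npart d j)%N (ppart d) = (wt D d + D)%N.
  rewrite (@eq_biwt _ (fun j => dl j + npart d j)%N _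
    (fun j => 0 + ppart d j)%N) //.
  rewrite biwtD -wt_biwt addnC; congr (_ + _)%N.
  rewrite /biwt (bigD1 i) //= big1 => [|j /negPf nji].
    by rewrite /dl eqxx muln1 !addn0.
  by rewrite /dl nji muln0.
rewrite wE in fw; congr (pfil _ _ _): fw.
rewrite (@eq_bimono _ (fun j => dl j + npart d j)%N _
  (fun j => 0 + ppart d j)%N) //.
rewrite bimonoD -mono_bimono; congr (_ * _).
rewrite /bimono (bigD1 i) //= big1 => [|j /negPf nji].
  by rewrite /dl eqxx expr0 !mulr1 expr1.
by rewrite /dl nji !expr0 mulr1.
Qed.

End Straightening.

(** * The lower bound algebra over the integers and over a field *)

Section IntegralForm.
Variables (n : nat) (Q : ice_quiver n).
Local Notation L := (lower_bound_int Q).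
Local Notation D := #|arrow Q|.+1.
Implicit Types (i : 'I_n) (d : expo n).

Definition lvar i : L :=
  SubringOf (mem_subring_span (ex_intro _ i (or_introl (erefl (var i))) :
    lower_bound_gens Q (var i))).
Definition ladj i : L :=
  SubringOf (mem_subring_span
    (ex_intro _ i (or_intror (erefl (adjacent_var Q i))) :
    lower_bound_gens Q (adjacent_var Q i))).

Lemma val_mono d : val (mono lvar ladj d) = mono (@var n) (adjacent_var Q) d.
Proof.
rewrite /mono rmorph_prod; apply: eq_bigr => i _.
by rewrite /emono; case: ifP => _; rewrite rmorphXn.
Qed.

Lemma lower_bound_pfil (l : L) : exists r, pfil Q r (val l).
Proof.
case: l => z /= /asboolP zL.
suff : z \in [pred z | `[< exists r, pfil Q r z >]] by move/asboolP.
apply: zL => [|_ [i [->|->]]]; last 2 first.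
- by apply/asboolP; exists 1%N; apply: pfil_var.
- by apply/asboolP; exists D; apply: pfil_adj.
split=> [|u v /asboolP[r hu] /asboolP[s hv]|u v /asboolP[r hu] /asboolP[s hv]];
  apply/asboolP.
- by exists 0%N; apply: pfil1.
- exists (maxn r s); apply: zspanB; [apply: pfil_leq hu|apply: pfil_leq hv].
    exact: leq_maxl.
  exact: leq_maxr.
- by exists (r + s)%N; apply: pfilM.
Qed.

Lemma sfil_lift r z : sfil Q r z -> exists (l : L) k, [/\ val l = z,
  expansion intr (fun d => acyclic Q (neg_set d)) (mono lvar ladj) l k &
  forall d, k d != 0 -> (wt D d <= r)%N].
Proof.
elim=> [|u v _ [l [k [<- lk kr]]] _ [l' [k' [<- lk' kr']]]|_ [d [gd le_r ->]]].
- by exists 0, (fun=> 0); split;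
    [exact: rmorph0|exact: expansion0|move=> d /eqP].
- exists (l - l'), (fun d => k d - k' d); split; first exact: rmorphB.
    exact: expansionB.
  move=> d kd; have [k0|] := eqVneq (k d) 0; last exact: kr.
  by apply: kr'; apply: contraNneq kd => k0'; rewrite k0 k0' subrr.
- exists (mono lvar ladj d), (fun e => (d == e)%:R); split.
  + exact: val_mono.
  + exact: expansion_gen.
  + by move=> e; case: (d =P e) => [<- //|_]; rewrite eqxx.
Qed.

Lemma lower_bound_straightening :
  exists c, straightening intr D lvar ladj (acyclic Q) c.
Proof.
have [|k k0 d|c cP] := @exists_coordinates _ _ (intr : {rmorphism int -> L}) _
    (fun d => acyclic Q (neg_set d)) (mono lvar ladj).
- move=> l; have [r /pfil_sfil/sfil_lift[l' [k [e lk _]]]] :=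
    lower_bound_pfil l.
  by exists k; rewrite (val_inj e) in lk.
- apply: (@mono_free n Q k); have [s [us ss ks e0]] := k0; exists s; split=> //.
  have := congr1 val e0; rewrite rmorph0 rmorph_sum => e1; apply: etrans e1 _.
  apply: eq_bigr => e _; rewrite rmorphM rmorph_int; congr (_ * _);
    exact: val_mono.
have sup r l : sfil Q r (val l) -> supported c (fun d => wt D d <= r)%N l.
  move=> /sfil_lift[l' [k [/val_inj <- [s [us ss ks ->]] kr]]].
  rewrite big_seq; apply: (supported_sum cP) => d ds.
  have [->|kd] := eqVneq (k d) 0; first by rewrite rmorph0 mul0r;
    apply: (supported0 cP).
  by apply: (supportedZ cP); apply: (supported_gen cP); [exact: ss|exact: kr].
exists c; split=> //.
- exact: acyclic_set0.
- move=> d i _ di; apply: sup.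
  by rewrite rmorphM [X in _ * X]val_mono; apply: sfil_x.
- move=> d i _ hd e ce; rewrite addnS ltnS.
  have fy := sfil_y hd; rewrite addnS /= in fy.
  by apply: (sup _ _ _ e ce); rewrite rmorphM [X in _ * X]val_mono.
Qed.

End IntegralForm.

Section BaseChange.
Variables (L : comPzRingType) (K : fieldType).
Local Notation A := (tensor L K).

Definition tensorl (l : L) : A := pure_tensor l 1.
Definition tensorr (k : K) : A := pure_tensor 1 k.

Lemma tensorl_zmod : zmod_morphism tensorl.
Proof. by case: (pure_tensor_biadditive L K) => h _; apply: h. Qed.

Lemma tensorl_monoid : monoid_morphism tensorl.
Proof. by split=> // l l'; rewrite /tensorl pure_tensorM mulr1. Qed.

HB.instance Definition _ := GRing.isZmodMorphism.Build L A tensorl tensorl_zmod.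
HB.instance Definition _ :=
  GRing.isMonoidMorphism.Build L A tensorl tensorl_monoid.

Lemma tensorr_zmod : zmod_morphism tensorr.
Proof. by case: (pure_tensor_biadditive L K) => _ h; apply: h. Qed.

Lemma tensorr_monoid : monoid_morphism tensorr.
Proof. by split=> // k k'; rewrite /tensorr pure_tensorM mulr1. Qed.

HB.instance Definition _ := GRing.isZmodMorphism.Build K A tensorr tensorr_zmod.
HB.instance Definition _ :=
  GRing.isMonoidMorphism.Build K A tensorr tensorr_monoid.

Lemma pure_tensorE l k : pure_tensor l k = tensorr k * tensorl l.
Proof. by rewrite /tensorr /tensorl pure_tensorM mul1r mulr1. Qed.

Lemma tensorl_int (z : int) : tensorl z%:~R = tensorr z%:~R.
Proof. by rewrite !rmorph_int. Qed.

(** Independence: the coordinate of index i over the integers and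
    multiplication in K define a biadditive map, hence an additive form on the
    tensor product that reads off the i-th coefficient of an expansion. *)
Lemma tensor_coordinates (I : choiceType) (P : I -> Prop) (g : I -> L) c :
  coordinates (intr : {rmorphism int -> L}) P g c ->
  exists c', coordinates tensorr P (tensorl \o g) c'.
Proof.
move=> cP; apply: exists_coordinates.
  pose span_g := spanned tensorr P (tensorl \o g).
  elim/quotW=> s; rewrite pi_formal_sum.
  apply: (big_ind span_g) => [||[l k] _ /=]; [exact: spanned0|exact: spannedD|].
  rewrite pure_tensorE; apply: spannedZ.
  have [t [ut tP kt el]] := coords_expansion cP l.
  rewrite el rmorph_sum big_seq.
  apply: (big_ind span_g) => [||i it]; [exact: spanned0|exact: spannedD|].
  rewrite rmorphM /= tensorl_int; apply: spannedZ.
  exact: (spanned_gen tensorr (tensorl \o g) (tP i it)).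
move=> k [s [us sP ks e0]] i.
have hf : biadditive (fun (l : L) (r : K) => (c l i)%:~R * r).
  split=> [r l l'|l r r'].
    by rewrite (coordsB cP) rmorphB mulrBl.
  by rewrite mulrBr.
have [h [[hB hE] _]] := tensor_lift hf.
have h0 : h 0 = 0 by have := hB 0 0; rewrite !subrr.
have hD a b : h (a + b) = h a + h b.
  by rewrite -{1}[b]opprK hB -[- b]sub0r hB h0 sub0r opprK.
have := congr1 h e0; rewrite h0 (big_morph h hD h0).
have [k0|/ks is_] := eqVneq (k i) 0; first by rewrite k0.
rewrite (bigD1_seq i) //= -pure_tensorE hE (coords_gen cP); last exact: sP.
rewrite eqxx mul1r big1_seq ?addr0 // => j /andP[nji js].
rewrite -pure_tensorE hE (coords_gen cP); last exact: sP.
by rewrite (negPf nji) mul0r.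
Qed.

Lemma tensor_straightening n D (x y : 'I_n -> L) (acyclic : pred {set 'I_n}) c :
  straightening intr D x y acyclic c ->
  exists c', straightening tensorr D (tensorl \o x) (tensorl \o y) acyclic c'.
Proof.
move=> st; have cP := st_coord st; have [c' cP'] := tensor_coordinates cP.
have mE d : mono (tensorl \o x) (tensorl \o y) d = tensorl (mono x y d).
  rewrite /mono rmorph_prod; apply: eq_bigr => i _.
  by rewrite /emono; case: ifP => _; rewrite rmorphXn.
have sup (T : expo n -> Prop) l : supported c T l -> supported c' T (tensorl l).
  move=> Tl; have [s [us sP ks ->]] := coords_expansion cP l.
  rewrite rmorph_sum big_seq; apply: (supported_sum cP') => d ds.
  rewrite rmorphM /= tensorl_int; have [->|cd] := eqVneq (c l d) 0.
    by rewrite rmorph0 mul0r; apply: (supported0 cP').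
  apply: (supportedZ cP'); apply: (supported_gen cP'); first exact: sP.
  exact: Tl.
exists c'; split.
- have -> : mono (tensorl \o x) (tensorl \o y)
    = tensorl \o mono x y by apply/funext.
  exact: cP'.
- exact: st_D_gt0 st.
- exact: st_good0 st.
- by move=> d i sd di; rewrite mE -rmorphM; apply: sup; apply: (st_x st).
- by move=> d i sd di; rewrite mE -rmorphM; apply: sup; apply: (st_y st).
Qed.

End BaseChange.

Theorem corollary1p19 (n : nat) (Q : ice_quiver n) (K : fieldType) :
  cohen_macaulay (lower_bound_algebra Q K).
Proof.
have [c0 st0] := lower_bound_straightening Q.
have [c st] := tensor_straightening K st0.
have cP := st_coord st.
have nz : 1 != 0 :> lower_bound_algebra Q K.
  apply/eqP => e; have := coords_gen cP (i := expo0 n) (expo0 n).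
  rewrite neg_set0 mono0 e (coords0 cP) eqxx => /(_ (acyclic_set0 Q)) /eqP.
  by rewrite eq_sym oner_eq0.
pose A : comNzRingType := HB.pack (tensor (lower_bound_int Q) K)
  (GRing.PzSemiRing_isNonZero.Build (tensor (lower_bound_int Q) K) nz).
exact: (@straightening_cohen_macaulay K A (tensorr (lower_bound_int Q) (K := K))
  _ _ _ _ _ c st).
Qed.
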